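(* Let $f$ be a regular solution of the gravitational Vlasov-Poisson system, with mass $M$, energy $E$ and total linear momentum $Q$, satisfying \[ E=\frac{|Q|^2}{2M}. \] Then $f$ is statistically dispersive.
   Context: The gravitational Vlasov-Poisson system for $f=f(t,x,p)\ge 0$, $t\in\mathbb{R}$, $x,p\in\mathbb{R}^3$, is \[ \partial_t f+p\cdot\nabla_x f-\nabla_xU\cdot\nabla_pf=0,\qquad \rho(t,x)=\int_{\mathbb{R}^3}f(t,x,p)\,dp, \] \[ \Delta_xU=\rho,\quad \lim_{|x|\to\infty}U=0,\qquad\text{i.e. } U(t,x)=-\frac1{4\pi}\int_{\mathbb{R}^3}\frac{\rho(t,y)}{|x-y|}\,dy . \] A regular solution is a non-trivial, non-negative, global classical ($C^1$) solution such that at each fixed time $t$, $f(t,\cdot,\cdot)$ has compact support in $(x,p)$. Notation: $M=\int_{\mathbb{R}^6}f\,dp\,dx>0$ (mass), $Q=\int_{\mathbb{R}^6}p\,f\,dp\,dx\in\mathbb{R}^3$ (linear momentum), $E=\frac12\int_{\mathbb{R}^6}|p|^2f\,dp\,dx-\frac12\int_{\mathbb{R}^3}|\nabla_xU|^2dx$ (energy). The quantities $M$, $Q$, $E$ and all norms $\|f(t)\|_{L^q(\mathbb{R}^6)}$, $1\le q\le\infty$, are independent of $t$. The statistical dispersion is \[ \langle(\Delta x)^2\rangle(t)=\frac1M\left[\int_{\mathbb{R}^3}|x|^2\rho(t,x)\,dx-\frac1M\left|\int_{\mathbb{R}^3}x\,\rho(t,x)\,dx\right|^2\right], \] and $f$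 is statistically dispersive if $\sup_{t>0}\langle(\Delta x)^2\rangle(t)=+\infty$. *)

(* Defs.v *)
From HB Require Import structures.
From mathcomp Require Import all_boot all_order all_algebra.
From mathcomp Require Import all_classical all_reals all_analysis.

Set Implicit Arguments.
Unset Strict Implicit.
Unset Printing Implicit Defensive.

Import Order.TTheory GRing.Theory Num.Theory numFieldNormedType.Exports.

Local Open Scope classical_set_scope.
Local Open Scope ring_scope.

(* R^3 as a nested product, which carries both the normed-module structure
   used by ['D_v] and the sigma-algebra used by product measures.  The
   library's norm on it is the max norm; the Euclidean one is [enorm]. *)
Notation vec3 R := (R * R * R)%type.

Section Euclidean.
Context {R : realType}.
Implicit Types (u v x : vec3 R) (g : vec3 R -> R).

Definition dot u v : R := u.1.1 * v.1.1 + u.1.2 * v.1.2 + u.2 * v.2.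

Definition enorm v : R := Num.sqrt (dot v v).

Definition e1 : vec3 R := (1, 0, 0).
Definition e2 : vec3 R := (0, 1, 0).
Definition e3 : vec3 R := (0, 0, 1).

Definition grad g x : vec3 R := ('D_e1 g x, 'D_e2 g x, 'D_e3 g x).

Definition laplacian g x : R :=
  'D_e1 ('D_e1 g) x + 'D_e2 ('D_e2 g) x + 'D_e3 ('D_e3 g) x.

Definition vanishes_at_infinity g : Prop :=
  forall e : R, 0 < e -> \forall r \near +oo, forall x, r <= enorm x -> `|g x| < e.

End Euclidean.

Definition C1 {R : realType} {V : normedModType R} (F : V -> R) : Prop :=
  (forall z, differentiable F z) /\ (forall v, continuous ('D_v F)).

Definition C2 {R : realType} {V : normedModType R} (F : V -> R) : Prop :=
  C1 F /\ (forall v, C1 ('D_v F)).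

(* The library's sigma-finite instance on products is shadowed by its
   (sub)probability one, so it is redeclared on the measures used below. *)
Lemma sigma_finite_product d1 d2 (T1 : measurableType d1)
    (T2 : measurableType d2) (R : realType)
    (m1 : {sigma_finite_measure set T1 -> \bar R})
    (m2 : {sigma_finite_measure set T2 -> \bar R}) :
  sigma_finite setT (m1 \x m2)%E.
Proof.
have /sigma_finiteP[F [TF ndF Foo]] := sigma_finiteT m1.
have /sigma_finiteP[G [TG ndG Goo]] := sigma_finiteT m2.
exists (fun n => F n `*` G n).
  rewrite -setXTT TF TG predeqE => -[x y]; split.
    move=> [/= [n _ Fnx] [k _ Gky]]; exists (maxn n k) => //; split.
    - by move: x Fnx; exact/subsetPset/ndF/leq_maxl.
    - by move: y Gky; exact/subsetPset/ndG/leq_maxr.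
  by move=> [n _ []/= ? ?]; split; exists n.
move=> k; have [? ?] := Foo k; have [? ?] := Goo k.
split; first exact: measurableX.
by rewrite product_measure1E// lte_mul_pinfty// ge0_fin_numE.
Qed.

Section Lebesgue.
Context {R : realType}.
Local Notation T := (measurableTypeR R).

Definition leb2 : set (T * T) -> \bar R :=
  (@lebesgue_measure R \x @lebesgue_measure R)%E.
HB.instance Definition _ := Measure.on leb2.
HB.instance Definition _ := Measure_isSigmaFinite.Build _ _ _ leb2
  (sigma_finite_product lebesgue_measure lebesgue_measure).

Definition leb3 : set (vec3 T) -> \bar R :=
  (leb2 \x @lebesgue_measure R)%E.
HB.instance Definition _ := Measure.on leb3.
HB.instance Definition _ := Measure_isSigmaFinite.Build _ _ _ leb3
  (sigma_finite_product leb2 lebesgue_measure).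

Definition leb6 : set (vec3 T * vec3 T) -> \bar R := (leb3 \x leb3)%E.
HB.instance Definition _ := Measure.on leb6.
HB.instance Definition _ := Measure_isSigmaFinite.Build _ _ _ leb6
  (sigma_finite_product leb3 leb3).

Definition vintegral3 (g : vec3 R -> vec3 R) : vec3 R :=
  (\int[leb3]_x (g x).1.1, \int[leb3]_x (g x).1.2, \int[leb3]_x (g x).2).

Definition vintegral6 (g : vec3 R * vec3 R -> vec3 R) : vec3 R :=
  (\int[leb6]_z (g z).1.1, \int[leb6]_z (g z).1.2, \int[leb6]_z (g z).2).

End Lebesgue.

Section VlasovPoisson.
Context {R : realType}.
Variable f : R -> vec3 R -> vec3 R -> R.

Definition density (t : R) (x : vec3 R) : R := \int[leb3]_p f t x p.

(* The integrand is [0] at [y = x] since [0^-1 = 0]; this is a null set. *)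
Definition potential (t : R) (x : vec3 R) : R :=
  - (4 * pi)^-1 * \int[leb3]_y (density t y / enorm (x - y)).

Definition vlasov : Prop := forall t x p,
  derive1 (fun s => f s x p) t + dot p (grad (fun y => f t y p) x)
    - dot (grad (potential t) x) (grad (f t x) p) = 0.

(* The potential is given by its integral formula; the regularity, the
   equation and the limit below are kept so that the whole displayed system
   is read in the classical sense ('D_v is a total function). *)
Definition poisson : Prop := forall t,
  [/\ C2 (potential t),
      (forall x, laplacian (potential t) x = density t x)
    & vanishes_at_infinity (potential t)].

Definition regular_solution : Prop :=
  [/\ (exists t x p, f t x p != 0),
      (forall t x p, 0 <= f t x p),
      C1 (fun z : R * (vec3 R * vec3 R) => f z.1 z.2.1 z.2.2),
      (forall t, compact (closure
         [set z : vec3 R * vec3 R | f t z.1 z.2 != 0]))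
    & vlasov /\ poisson].

Definition mass (t : R) : R := \int[leb6]_z f t z.1 z.2.

Definition momentum (t : R) : vec3 R :=
  vintegral6 (fun z => f t z.1 z.2 *: z.2).

Definition energy (t : R) : R :=
  2^-1 * \int[leb6]_z (enorm z.2 ^+ 2 * f t z.1 z.2)
    - 2^-1 * \int[leb3]_x (enorm (grad (potential t) x) ^+ 2).

Definition Lq_norm (q : \bar R) (t : R) : \bar R :=
  Lnorm leb6 q (fun z => (f t z.1 z.2)%:E).

Definition dispersion (t : R) : R :=
  (mass t)^-1 * (\int[leb3]_x (enorm x ^+ 2 * density t x)
    - (mass t)^-1 * enorm (vintegral3 (fun x => density t x *: x)) ^+ 2).

Definition statistically_dispersive : Prop :=
  ereal_sup [set (dispersion t)%:E | t in [set t : R | 0 < t]] = +oo%E.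

End VlasovPoisson.

(* Main.v *)
(* Put V = Q/M and G(t) = \int x.(p - V) f, and suppose the dispersion D stays
   bounded for t > 0.  The Vlasov equation and the virial identity
   \int (x.grad U) rho = 1/2 \int |grad U|^2 give
   G' = \int |p|^2 f - |Q|^2/M - 1/2 \int |grad U|^2, which is
   1/2 \int |grad U|^2 because E = |Q|^2/(2M).  A bound on D bounds the
   potential energy away from 0, so G grows at least linearly.  But
   |G| <= 1/2 (M D + \int |p - V|^2 f) is bounded, since the kinetic energy is:
   \int |grad U|^2 <= e C (M + \int |p|^2 f) + M^2/(4e) for every e > 0, where C
   depends only on M and on the conserved sup norm of f. *)
Require Import Defs.
From HB Require Import structures.
From mathcomp Require Import all_boot all_order all_algebra.
From mathcomp Require Import all_classical all_reals all_analysis.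
From mathcomp Require Import measurable_realfun ess_sup_inf ring lra.
Set Implicit Arguments.
Unset Strict Implicit.
Unset Printing Implicit Defensive.
Import Order.TTheory GRing.Theory Num.Theory numFieldNormedType.Exports.
Local Open Scope classical_set_scope.
Local Open Scope ring_scope.

(** The support of [f t] is compact for each [t], but no bound uniform on time intervals is assumed,
    so the moment G is not differentiated directly. It is reached through test functions cut off in
    momentum and in position, and in time only the identity integrated over [[S, T]] is used. The
    momentum cutoff is removed first and the spatial one next, each time by dominated convergence
    with bounds uniform in [t] on the kinetic energy, on \int |grad U| rho and on \int |grad U|^2.
    All three bounds come from one quantity, the double integral of f f' |x - y|^-2: this kernel
    dominates that of grad U and, up to a constant, |x - y|^-1. It is estimated in phase space by
    the mass, the kinetic energy and the sup norm, with no L^p inequality for rho. The virial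
    identity of the field needs no pointwise decay of grad U. Two derivatives are first moved onto a
    cutoff, where |U| = O(1/|x|) is enough; this makes |grad U|^2 integrable, and it then dominates
    the truncated stress tensor. *)

Local Notation phase R := (vec3 R * vec3 R)%type.
Local Notation mvec R := (vec3 (measurableTypeR R)).
Local Notation mphase R := (vec3 (measurableTypeR R) * vec3 (measurableTypeR R))%type.

(** * Continuity of explicit expressions *)

Section continuity.
Context {R : realType} {X : topologicalType}.
Implicit Types f g : X -> R.

Lemma contD f g : continuous f -> continuous g -> continuous (fun x => f x + g x).
Proof. by move=> cf cg x; apply: cvgD; [exact: cf|exact: cg]. Qed.
Lemma contM f g : continuous f -> continuous g -> continuous (fun x => f x * g x).
Proof. by move=> cf cg x; apply: cvgM; [exact: cf|exact: cg]. Qed.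
Lemma contN f : continuous f -> continuous (fun x => - f x).
Proof. by move=> cf x; apply: cvgN; exact: cf. Qed.
Lemma contDv (V : normedModType R) (f g : X -> V) :
  continuous f -> continuous g -> continuous (fun x => f x + g x).
Proof. by move=> cf cg x; apply: cvgD; [exact: cf|exact: cg]. Qed.
Lemma contNv (V : normedModType R) (f : X -> V) :
  continuous f -> continuous (fun x => - f x).
Proof. by move=> cf x; apply: cvgN; exact: cf. Qed.
Lemma contZv (V : normedModType R) (k : X -> R) (f : X -> V) :
  continuous k -> continuous f -> continuous (fun x => k x *: f x).
Proof. by move=> ck cf x; apply: cvgZ; [exact: ck|exact: cf]. Qed.
Lemma contX f n : continuous f -> continuous (fun x => f x ^+ n).
Proof. move=> cf x; apply: (@continuous_comp _ _ _ f (fun y : R => y ^+ n)); [exact: cf|exact: exprn_continuous]. Qed.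
Lemma contnorm f : continuous f -> continuous (fun x => `|f x|).
Proof. move=> cf x; apply: cvg_norm; exact: cf. Qed.
Lemma contcst (T : topologicalType) (a : T) : continuous (fun _ : X => a).
Proof. by move=> x; exact: cvg_cst. Qed.
Lemma contid : continuous (fun x : X => x).
Proof. by move=> x. Qed.
Lemma contpair (T U : topologicalType) (f : X -> T) (g : X -> U) :
  continuous f -> continuous g -> continuous (fun x => (f x, g x)).
Proof. by move=> cf cg x; apply: cvg_pair; [exact: cf|exact: cg]. Qed.
Lemma contfst (T U : topologicalType) (f : X -> T * U) :
  continuous f -> continuous (fun x => (f x).1).
Proof. move=> cf x; apply: (@continuous_comp _ _ _ f fst); [exact: cf|exact: cvg_fst]. Qed.
Lemma contsnd (T U : topologicalType) (f : X -> T * U) :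
  continuous f -> continuous (fun x => (f x).2).
Proof. move=> cf x; apply: (@continuous_comp _ _ _ f snd); [exact: cf|exact: cvg_snd]. Qed.
Lemma contcomp (T U : topologicalType) (f : X -> T) (g : T -> U) :
  continuous g -> continuous f -> continuous (fun x => g (f x)).
Proof. by move=> cg cf x; apply: (@continuous_comp _ _ _ f g); [exact: cf|exact: cg]. Qed.
End continuity.
(** The leaves are closed by [auto] from the context. This is why many proofs below first copy
    continuity lemmas into the context with [have]. *)
Ltac cont := lazymatch goal with
  | |- continuous (fun x => (@?f x + @?g x)%R) => first [apply: (@contD _ _ f g)|apply: (@contDv _ _ _ f g)]; cont
  | |- continuous (fun x => (@?f x *: @?g x)%R) => apply: (@contZv _ _ _ f g); cont
  | |- continuous (fun x => (@?f x * @?g x)%R) => apply: (@contM _ _ f g); cont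
  | |- continuous (fun x => (- @?f x)%R) => first [apply: (@contN _ _ f)|apply: (@contNv _ _ _ f)]; cont
  | |- continuous (fun x => (@?f x ^+ ?n)%R) => apply: (@contX _ _ f n); cont
  | |- continuous (fun x => `|@?f x|%R) => apply: (@contnorm _ _ f); cont
  | |- continuous (fun x => (@?f x, @?g x)) => apply: (@contpair _ _ _ f g); cont
  | |- continuous (fun x => (@?f x).1) => apply: (@contfst _ _ _ f); cont
  | |- continuous (fun x => (@?f x).2) => apply: (@contsnd _ _ _ f); cont
  | |- continuous (fun x => x) => exact: contid
  | |- continuous (fun _ => ?c) => exact: (@contcst _ _ c)
  | |- continuous (fun x => ?g (@?f x)) =>
      apply: (@contcomp _ _ _ f g); [solve [auto]|cont]
  | |- _ => solve [auto]
  end.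

(** An injection into the natural numbers regroups the union by codes; the fibre over each code is
    empty or a singleton. *)
Lemma measurable_countable_bigcup d (T : measurableType d) U (D : set U)
    (F : U -> set T) : countable D -> (forall i, D i -> measurable (F i)) ->
  measurable (\bigcup_(i in D) F i).
Proof.
move=> /countable_injP[f injf] mF.
have -> : \bigcup_(i in D) F i =
    \bigcup_k \bigcup_(i in D `&` f @^-1` [set k]) F i.
  apply/seteqP; split => [t [i Di Fit]|t [k _ [i [Di _] Fit]]].
    by exists (f i) => //; exists i.
  by exists i.
apply: bigcupT_measurable => k.
have [-> |/set0P[i [Di fik]]] := eqVneq (D `&` f @^-1` [set k]) set0.
  by rewrite bigcup_set0.
rewrite (_ : D `&` _ = [set i]) ?bigcup_set1; first exact: mF.
apply/seteqP; split => [j [Dj fjk]|_ -> //].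
by apply: injf; rewrite ?inE// fjk.
Qed.

(** * Continuity and measurability on products *)

Section lebesgue_like_measures.
Context {R : realType}.

(* The library does not identify the product sigma-algebra with the Borel one.
   Continuous functions on [X] are measurable on [T] as limits along countably
   valued measurable approximations [q n] of the identity, and such
   approximations multiply. *)
Definition lebesgue_like d (T : measurableType d) (X : normedModType R) (e : T -> X)
    (m : set T -> \bar R) :=
  [/\ exists q : nat -> T -> T,
        (forall t, (fun n => e (q n t)) @ \oo --> e t) /\
        (forall n, countable (range (q n)) /\
           forall a, measurable (q n @^-1` [set a])),
      (forall K : R, compact [set x : X | `|x| <= K]) &
      (forall K : R, measurable (e @^-1` [set x : X | `|x| <= K]) /\
         (m (e @^-1` [set x : X | (`|x| <= K)%R]) < +oo)%E)].

Lemma lebesgue_like_ext d (T : measurableType d) (X : normedModType R) (e e' : T -> X)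
    (m : set T -> \bar R) : lebesgue_like e m -> e =1 e' -> lebesgue_like e' m.
Proof. by move=> + /funext <-. Qed.

(** Rounding down to a multiple of 1/(n+1) serves as approximation of the identity: the error is at
    most 1/(n+1), the values are indexed by the integers, and monotonicity gives measurability. *)
Lemma lebesgue_like_lebesgue :
  lebesgue_like (id : measurableTypeR R -> R) (@lebesgue_measure R).
Proof.
split.
- exists (fun n x => (Num.floor (x * n.+1%:R))%:~R / n.+1%:R); split.
    move=> t /=; apply/cvgrPdist_le => e e0.
    near=> n.
    have n0 : 0 < n.+1%:R :> R by [].
    rewrite -[X in X - _](mulfK (lt0r_neq0 n0)) -mulrBl normrM normfV.
    rewrite (ger0_norm (ltW n0)) ler_pdivrMr//.
    have /andP[h1 h2] := floor_itv (t * n.+1%:R).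
    rewrite ger0_norm ?subr_ge0//.
    apply: (@le_trans _ _ 1).
      by rewrite intrD1 in h2; rewrite lerBlDl addrC ltW// addrC.
    rewrite -ler_pdivrMl// mulr1.
    have : e^-1 <= n%:R by near: n; exact: nbhs_infty_ger.
    by move/le_trans; apply; rewrite ler_nat.
  move=> n; split.
    apply: (@sub_countable _ _ _ (range (fun k : int => k%:~R / n.+1%:R : R))).
      apply: subset_card_le => _ [x _ <-] /=.
      by exists (Num.floor (x * n.+1%:R)).
    by apply: sub_countable (card_image_le _ _) _; exact: countableP.
  move=> a.
  rewrite -[X in measurable X]setTI.
  have : measurable_fun [set: measurableTypeR R]
     (fun x : R => (Num.floor (x * n.+1%:R))%:~R / n.+1%:R : R).
    apply: nondecreasing_measurable => //= x y xy.
    by rewrite ler_pM2r// ler_int; apply: Num.Theory.le_floor; rewrite ler_pM2r.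
  by apply => //; exact: measurable_set1.
- move=> K.
  have -> : [set x : R | `|x| <= K] = `[- K, K]%classic.
    by apply/seteqP; split => x /=; rewrite in_itv/= ler_norml.
  exact: segment_compact.
- move=> K.
  have -> : id @^-1` [set x : R | `|x| <= K] = `[- K, K]%classic.
    by apply/seteqP; split => x /=; rewrite in_itv/= ler_norml.
  split; first exact: measurable_itv.
  by rewrite /= lebesgue_measure_itv/=; case: ifP => // _; rewrite -EFinD ltry.
Unshelve. all: by end_near. Qed.

(** The norm of a product is the max norm, so its balls are products of balls; compactness,
    measurability and finite measure therefore pass to the product. *)
Lemma lebesgue_like_prod d1 d2 (T1 : measurableType d1) (T2 : measurableType d2)
    (X1 X2 : normedModType R) (e1 : T1 -> X1) (e2 : T2 -> X2)
    (m1 : {sigma_finite_measure set T1 -> \bar R})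
    (m2 : {sigma_finite_measure set T2 -> \bar R}) :
  lebesgue_like e1 m1 -> lebesgue_like e2 m2 ->
  lebesgue_like (fun z : T1 * T2 => (e1 z.1, e2 z.2)) (m1 \x m2)%E.
Proof.
move=> [[q1 [c1 r1]] k1 b1] [[q2 [c2 r2]] k2 b2].
have ballE K : [set x : X1 * X2 | `|x| <= K] =
    [set x : X1 | `|x| <= K] `*` [set x : X2 | `|x| <= K].
  apply/seteqP; split => -[x y] /=; rewrite prod_normE/= ge_max.
    by move/andP.
  by move=> [-> ->].
split.
- exists (fun n z => (q1 n z.1, q2 n z.2)); split.
    by move=> [t1 t2] /=; apply: cvg_pair; [exact: c1|exact: c2].
  move=> n; have [cr1 mr1] := r1 n; have [cr2 mr2] := r2 n; split.
    apply: (@sub_countable _ _ _ (range (q1 n) `*` range (q2 n))); last exact: countableX.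
    apply: subset_card_le => _ [[x y] _ <-] /=; split; [by exists x|by exists y].
  move=> [a b].
  rewrite (_ : _ @^-1` _ = (q1 n @^-1` [set a]) `*` (q2 n @^-1` [set b])).
    exact: measurableX.
  by apply/seteqP; split => -[x y] /= [-> ->].
- by move=> K; rewrite ballE; apply: compact_setX.
- move=> K; rewrite ballE.
  have [mb1 fb1] := b1 K; have [mb2 fb2] := b2 K.
  rewrite (_ : _ @^-1` _ = (e1 @^-1` [set x : X1 | `|x| <= K]) `*` (e2 @^-1` [set x : X2 | `|x| <= K])); last first.
    by apply/seteqP; split => -[x y] /= [].
  split; first exact: measurableX.
  by rewrite product_measure1E// lte_mul_pinfty// ge0_fin_numE.
Qed.

Section lebesgue_like_theory.
Context d (T : measurableType d) (X : normedModType R) (e : T -> X)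
  (m : {measure set T -> \bar R}).
Hypothesis nm : lebesgue_like e m.

Lemma lebesgue_like_measurable (g : X -> R) : continuous g ->
  measurable_fun [set: T] (g \o e).
Proof.
move=> cg; have [[q [cq rq]] _ _] := nm.
apply: (@measurable_fun_cvg _ _ _ _ (fun n => g \o e \o q n)).
  move=> n; have [cr mr] := rq n.
  move=> _ B mB; rewrite setTI.
  rewrite (_ : _ @^-1` B = \bigcup_(a in range (q n) `&` [set a | B (g (e a))]) (q n @^-1` [set a])).
    apply: measurable_countable_bigcup.
      by apply: sub_countable cr; apply: subset_card_le; exact: subIsetl.
    by move=> a _; exact: mr.
  apply/seteqP; split => [t /= Bt|t /= [a [_ Ba] qa]].
    by exists (q n t) => //; split => //; exists t.
  by rewrite qa.
move=> t _; have := cq t.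
move=> /(continuous_cvg _ (cg (e t))).
exact.
Qed.

Lemma lebesgue_like_integrable (g : X -> R) (B : set T) (K : R) : continuous g ->
  measurable B -> (forall t, B t -> `|e t| <= K) ->
  m.-integrable B (EFin \o (g \o e)).
Proof.
move=> cg mB BK; have [_ k b] := nm.
have [mb fb] := b K.
have BS : B `<=` e @^-1` [set x | `|x| <= K] by move=> t /BK.
apply: measurable_bounded_integrable => //.
- by apply: le_lt_trans fb; apply: le_measure => //; rewrite inE.
- exact: measurable_funS (lebesgue_like_measurable cg).
- have /compact_bounded[M [Mr Mb]] : compact (g @` [set x : X | `|x| <= K]).
    by apply: continuous_compact (k K); exact: continuous_subspaceT.
  exists M; split => // N MN t Bt.
  by apply: Mb MN _ _; exists (e t) => //; exact: BK.
Qed.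

Lemma lebesgue_like_integrableT (g : X -> R) (K : R) : continuous g ->
  (forall x, K < `|x| -> g x = 0) -> m.-integrable setT (EFin \o (g \o e)).
Proof.
move=> cg gK; have [_ k b] := nm; have [mb fb] := b K.
have := lebesgue_like_integrable cg mb (fun t h => h).
move/(integrable_mkcond _ mb).
apply: eq_integrable => // t _.
rewrite /patch; case: ifPn => // /negP; rewrite inE /= => /negP.
by rewrite -ltNge => /gK /= ->.
Qed.

Lemma lebesgue_like_bounded (g : X -> R) (K : R) : continuous g ->
  (forall x, K < `|x| -> g x = 0) -> exists2 B, 0 <= B & forall x, `|g x| <= B.
Proof.
move=> cg gK; have [_ k _] := nm.
have /compact_bounded[M [Mr Mb]] : compact (g @` [set x : X | `|x| <= K]).
  by apply: continuous_compact (k K); exact: continuous_subspaceT.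
exists (`|M| + 1) => [|x]; first by rewrite addr_ge0.
have [xK|xK] := leP `|x| K.
  by apply: Mb; [rewrite (le_lt_trans (ler_norm _))// ltrDl|exists x].
by rewrite gK// normr0 addr_ge0.
Qed.

End lebesgue_like_theory.

Lemma lebesgue_like_leb2 : lebesgue_like (id : (measurableTypeR R * measurableTypeR R)%type -> R * R) (@leb2 R).
Proof. by apply: lebesgue_like_ext (lebesgue_like_prod lebesgue_like_lebesgue lebesgue_like_lebesgue) _ => -[]. Qed.

Lemma lebesgue_like_leb3 : lebesgue_like (id : vec3 (measurableTypeR R) -> vec3 R) (@leb3 R).
Proof. by apply: lebesgue_like_ext (lebesgue_like_prod lebesgue_like_leb2 lebesgue_like_lebesgue) _ => -[]. Qed.

Lemma lebesgue_like_leb6 : lebesgue_like (id : (vec3 (measurableTypeR R) * vec3 (measurableTypeR R))%type -> vec3 R * vec3 R) (@leb6 R).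
Proof. by apply: lebesgue_like_ext (lebesgue_like_prod lebesgue_like_leb3 lebesgue_like_leb3) _ => -[]. Qed.

End lebesgue_like_measures.

(** * Coordinates, derivatives along lines and integration by parts *)

Inductive axis := ax1 | ax2 | ax3.

Section coordinates.
Context {R : realType}.

Definition ax (i : axis) : vec3 R :=
  match i with ax1 => e1 | ax2 => e2 | ax3 => e3 end.

Definition co (i : axis) (v : vec3 R) : R :=
  match i with ax1 => v.1.1 | ax2 => v.1.2 | ax3 => v.2 end.

Definition sum3 (F : axis -> R) : R := F ax1 + F ax2 + F ax3.

End coordinates.

Lemma vec3_ext (R : realType) (u v : vec3 R) :
  u.1.1 = v.1.1 -> u.1.2 = v.1.2 -> u.2 = v.2 -> u = v.
Proof. by case: u v => [[a b] c] [[a' b'] c'] /= -> -> ->. Qed.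

Section curves.
Context {R : realType} {V W : normedModType R}.

(** The difference quotients of both sides are equal because [psi] maps the line through [a] along
    [u] to the line through [psi a] along [v]. It serves to freeze some of the variables and to
    restrict a function to a line. *)
Lemma is_derive_affine (psi : V -> W) (g : W -> R) (a u : V) (v : W) (d : R) :
  (forall h, psi (h *: u + a) = h *: v + psi a) ->
  is_derive (psi a) v g d -> is_derive a u (g \o psi) d.
Proof.
move=> hp [dg <-].
have E : (fun h => h^-1 *: ((g \o psi \o shift a) (h *: u) - (g \o psi) a)) =
  (fun h => h^-1 *: ((g \o shift (psi a)) (h *: v) - g (psi a))).
  by apply/funext => h /=; rewrite hp.
by split; [rewrite /derivable E; exact: dg|rewrite /derive E].
Qed.

(** The region [K < |x|] is open, so [g] vanishes in a neighbourhood of [a]. *)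
Lemma is_derive_out (g : V -> R) (a v : V) (d K : R) :
  (forall x, K < `|x| -> g x = 0) -> is_derive a v g d -> K < `|a| -> d = 0.
Proof.
move=> gK [dg <-] Ka; have [->|v0] := eqVneq v 0; first by rewrite derive0.
rewrite (@near_eq_derive _ _ _ g (cst 0))// ?derive_cst//.
have : \forall x \near a, K < `|x|.
  by apply: (cvgr_gt _ (@norm_continuous _ V a)).
by apply: filterS => x /gK ->.
Qed.

End curves.

Section integration_by_parts.
Context {R : realType}.

(** The fundamental theorem of calculus on [[- L, L]], where [g] vanishes at both ends. The choice
    [L = |K| + 1] keeps [L] positive and above [K] even when [K] is negative. *)
Lemma integral_derive0_R (g dg : R -> R) (K : R) :
  (forall s, is_derive (s : R) (1 : R) g (dg s)) -> continuous dg ->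
  (forall s, K < `|s| -> g s = 0) ->
  (\int[lebesgue_measure]_s (dg s)%:E = 0)%E.
Proof.
move=> g' cdg gK.
pose L : R := `|K| + 1.
have L0 : 0 < L by rewrite ltr_pwDr.
have KL : K < L by rewrite /L (le_lt_trans (ler_norm K))// ltrDl.
have dg0 s : K < `|s| -> dg s = 0 by exact: is_derive_out gK (g' s).
have -> : (\int[lebesgue_measure]_s (dg s)%:E =
    \int[lebesgue_measure]_(s in `[(- L)%R, L]) (dg s)%:E)%E.
  rewrite [RHS]integral_mkcond; apply: eq_integral => s _.
  rewrite patchE; case: ifPn => // /negP; rewrite inE /= in_itv/= -ler_norml.
  by move=> /negP; rewrite -ltNge => sL; rewrite dg0// (lt_trans KL).
have cg : continuous g.
  move=> s; have [ds _] := g' s.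
  by apply: differentiable_continuous; exact/derivable1_diffP.
have gL : g L = 0 by rewrite gK// gtr0_norm.
have gNL : g (- L) = 0 by rewrite gK// normrN gtr0_norm.
rewrite (@continuous_FTC2 _ dg g)//.
- by rewrite gL gNL sube0.
- by rewrite gtrN.
- by apply: continuous_subspaceT.
- split.
  + by move=> s _; case: (g' s).
  + by apply: cvg_at_right_filter; exact: cg.
  + by apply: cvg_at_left_filter; exact: cg.
- by move=> s _; rewrite derive1E; case: (g' s).
Qed.

(** By Fubini the innermost integral can be taken along axis [i], where the one-dimensional
    statement applies. Space is the nested product (R * R) * R, so the first two axes need Fubini
    twice. *)
Lemma integral_derive0 (i : axis) (g dg : vec3 R -> R) (K : R) :
  (forall x, is_derive x (ax i) g (dg x)) -> continuous dg ->
  (forall x, K < `|x| -> g x = 0) ->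
  \int[leb3]_x dg x = 0.
Proof.
move=> g' cdg gK.
have dg0 x : K < `|x| -> dg x = 0 by exact: is_derive_out gK (g' x).
have idg : leb3.-integrable setT (EFin \o dg).
  exact: (lebesgue_like_integrableT lebesgue_like_leb3 cdg dg0).
have nrm (a b c : R) : `|((a, b), c) : vec3 R| = Num.max (Num.max `|a| `|b|) `|c|.
  by rewrite !prod_normE.
rewrite /Rintegral.
rewrite (_ : (\int[leb3]_x _)%E = 0%E)//.
case: i g' => /= g'.
- rewrite -integral21_prod_meas1//.
  apply: integral0_eq => x3 _.
  have cx : continuous (fun y : R * R => dg (y, x3)).
    cont.
  have i2 : leb2.-integrable setT (EFin \o (fun y => dg (y, x3))).
    apply: (lebesgue_like_integrableT lebesgue_like_leb2 cx (K := K)) => y Ky.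
    by apply: dg0; rewrite prod_normE/= lt_max Ky.
  rewrite /fubini_G -integral21_prod_meas1//.
  apply: integral0_eq => x2 _.
  apply: (@integral_derive0_R (fun s => g ((s, x2), x3)) _ K).
  + move=> s; apply: (@is_derive_affine _ _ _ (fun s => ((s, x2), x3))) (g' _).
    by move=> h; apply: vec3_ext => /=; rewrite ?scaler0 ?add0r.
  + cont.
  + by move=> s Ks; apply: gK; rewrite nrm !lt_max Ks.
- rewrite -integral21_prod_meas1//.
  apply: integral0_eq => x3 _.
  have cx : continuous (fun y : R * R => dg (y, x3)).
    cont.
  have i2 : leb2.-integrable setT (EFin \o (fun y => dg (y, x3))).
    apply: (lebesgue_like_integrableT lebesgue_like_leb2 cx (K := K)) => y Ky.
    by apply: dg0; rewrite prod_normE/= lt_max Ky.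
  rewrite /fubini_G -integral12_prod_meas1//.
  apply: integral0_eq => x1 _.
  apply: (@integral_derive0_R (fun s => g ((x1, s), x3)) _ K).
  + move=> s; apply: (@is_derive_affine _ _ _ (fun s => ((x1, s), x3))) (g' _).
    by move=> h; apply: vec3_ext => /=; rewrite ?scaler0 ?add0r.
  + cont.
  + by move=> s Ks; apply: gK; rewrite nrm !lt_max Ks orbT.
- rewrite -integral12_prod_meas1//.
  apply: integral0_eq => -[x1 x2] _.
  apply: (@integral_derive0_R (fun s => g ((x1, x2), s)) _ K).
  + move=> s; apply: (@is_derive_affine _ _ _ (fun s => ((x1, x2), s))) (g' _).
    by move=> h; apply: vec3_ext => /=; rewrite ?scaler0 ?add0r.
  + cont.
  + by move=> s Ks; apply: gK; rewrite nrm !lt_max Ks orbT.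
Qed.

End integration_by_parts.

(** * Differentiation rules and symmetry of second derivatives *)

Section directional_derivatives.
Context {R : realType} {V : normedModType R}.
Implicit Types (f g : V -> R) (x v : V).

Lemma isdD f g x v df dg : is_derive x v f df -> is_derive x v g dg ->
  is_derive x v (fun y => f y + g y) (df + dg).
Proof. by move=> ? ?; exact: is_deriveD. Qed.

Lemma isdB f g x v df dg : is_derive x v f df -> is_derive x v g dg ->
  is_derive x v (fun y => f y - g y) (df - dg).
Proof. by move=> ? ?; exact: is_deriveB. Qed.

Lemma isdN f x v df : is_derive x v f df ->
  is_derive x v (fun y => - f y) (- df).
Proof. by move=> ?; exact: is_deriveN. Qed.

Lemma isdM f g x v df dg : is_derive x v f df -> is_derive x v g dg ->
  is_derive x v (fun y => f y * g y) (f x * dg + g x * df).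
Proof. by move=> ? ?; exact: is_deriveM. Qed.

Lemma isdX2 f x v df : is_derive x v f df ->
  is_derive x v (fun y => f y ^+ 2) (2 * f x * df).
Proof.
move=> h; rewrite (_ : 2 * f x * df = f x * df + f x * df); last by ring.
by apply: isdM.
Qed.

Lemma isdcst (c : R) x v : is_derive x v (fun _ => c) 0.
Proof. exact: is_derive_cst. Qed.

(** A directional derivative is an ordinary derivative along the line, which brings in one-variable
    results such as the chain rule. *)
Lemma is_derive_line g x v d :
  is_derive (0 : R) (1 : R) (fun s : R => g (s *: v + x)) d <-> is_derive x v g d.
Proof.
have E : (fun h : R => h^-1 *: (((fun s : R => g (s *: v + x)) \o shift 0) (h *: (1 : R)) - g ((0 : R) *: v + x))) =
    (fun h => h^-1 *: ((g \o shift x) (h *: v) - g x)).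
  by apply/funext => h /=; rewrite scale0r add0r addr0 [h *: 1]mulr1.
by split => -[dg <-]; split;
  rewrite /derivable /derive ?E// -?E//; move: dg; rewrite /derivable ?E// -?E.
Qed.

Lemma isdcomp (phi : R -> R) (q : V -> R) x v d1 d2 :
  is_derive (q x) (1 : R) phi d1 -> is_derive x v q d2 ->
  is_derive x v (fun y => phi (q y)) (d1 * d2).
Proof.
move=> h1 /is_derive_line h2; apply/is_derive_line.
apply: (@is_derive1_comp _ phi (fun s => q (s *: v + x)) 0 d1 d2) => //.
by rewrite scale0r add0r.
Qed.

Lemma mvt_line g dg x v (h : R) : 0 < h ->
  (forall y, is_derive y v g (dg y)) ->
  exists s : R, [/\ 0 < s, s < h & g (h *: v + x) - g x = h * dg (s *: v + x)].
Proof.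
move=> h0 g'.
have kronecker (s : R) : is_derive s (1 : R) (fun r => g (r *: v + x)) (dg (s *: v + x)).
  apply: (@is_derive_affine _ _ _ (fun r : R => r *: v + x)) (g' _) => k.
  by rewrite [k *: 1]mulr1 scalerDl addrA.
have cl : {within `[0, h], continuous (fun r : R => g (r *: v + x))}.
  apply: continuous_subspaceT => s; have [ds _] := kronecker s.
  by apply: differentiable_continuous; exact/derivable1_diffP.
have [s] := MVT h0 (fun s _ => kronecker s) cl.
rewrite in_itv/= => /andP[s0 sh]; rewrite scale0r add0r subr0 mulrC => E.
by exists s.
Qed.

(** Two applications of the mean value theorem write the second difference of [u] over the
    parallelogram with sides [h *: v] and [h *: w] as h^2 times a mixed derivative at a nearby
    point. The two orders of application give equal values of [uvw] and [uwv] at two points near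
    [x], and continuity concludes. *)
Lemma schwarz (u uv uw uvw uwv : V -> R) v w :
  (forall x, is_derive x v u (uv x)) -> (forall x, is_derive x w u (uw x)) ->
  (forall x, is_derive x w uv (uvw x)) -> (forall x, is_derive x v uw (uwv x)) ->
  continuous uvw -> continuous uwv -> uvw =1 uwv.
Proof.
move=> hv hw hvw hwv cvw cwv x.
have slow_pairs (a b : V) (ua uab : V -> R) (h : R) : 0 < h ->
    (forall x, is_derive x a u (ua x)) -> (forall x, is_derive x b ua (uab x)) ->
    exists s r : R, [/\ `|s| <= h, `|r| <= h &
      u (h *: a + (h *: b + x)) - u (h *: b + x) - u (h *: a + x) + u x =
      h * (h * uab (r *: b + (s *: a + x)))].
  move=> h0 ha hab.
  have dphi y : is_derive y a (fun y => u (h *: b + y) - u y) (ua (h *: b + y) - ua y).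
    apply: isdB => //; apply: (@is_derive_affine _ _ _ (fun y => h *: b + y)) (ha _).
    by move=> k; rewrite addrCA.
  have [s [s0 sh Es]] := @mvt_line _ _ x a h h0 dphi.
  have [r [r0 rh Er]] := @mvt_line _ _ (s *: a + x) b h h0 hab.
  exists s, r; rewrite !gtr0_norm// !ltW//; split => //.
  rewrite -Er -Es (addrCA (h *: a)).
  ring.
apply/eqP; rewrite -subr_eq0 -normr_le0; apply/ler_addgt0Pl => e e0.
rewrite addr0.
have e20 : 0 < e / 2 by rewrite divr_gt0.
have /cvgrPdist_lt/(_ _ e20)/nbhs_ballP[d1 /= d10 H1] := cvw x.
have /cvgrPdist_lt/(_ _ e20)/nbhs_ballP[d2 /= d20 H2] := cwv x.
pose d := Num.min d1 d2; have d0 : 0 < d by rewrite lt_min d10.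
(* With [h = d / n] every point of the parallelogram is at distance less than [d] from [x]; the
   summand 1 makes this strict and covers [v = w = 0]. *)
pose n : R := `|v| + `|w| + 1.
have n0 : 0 < n by rewrite ltr_pwDr// addr_ge0.
pose h : R := d / n.
have h0 : 0 < h by rewrite divr_gt0.
have [s [r [sh rh E1]]] := slow_pairs v w uv uvw h h0 hv hvw.
have [s' [r' [sh' rh' E2]]] := slow_pairs w v uw uwv h h0 hw hwv.
have near (a b : R) : `|a| <= h -> `|b| <= h -> `|x - (a *: v + (b *: w + x))| < d.
  move=> ah bh; rewrite distrC addrA addrK (le_lt_trans (ler_normD _ _))// !normrZ.
  apply: (@le_lt_trans _ _ (h * `|v| + h * `|w|)).
    by rewrite lerD// ler_wpM2r.
  rewrite -mulrDr -[ltRHS](divfK (lt0r_neq0 n0)) ltr_pM2l// /n ltrDl//.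
have E : uvw (r *: w + (s *: v + x)) = uwv (r' *: v + (s' *: w + x)).
  apply: (mulfI (lt0r_neq0 h0)); apply: (mulfI (lt0r_neq0 h0)); rewrite -E1 -E2.
  by rewrite (addrCA (h *: v)); ring.
have N1 : ball x d1 (r *: w + (s *: v + x)).
  rewrite -ball_normE /= addrCA; apply: (lt_le_trans (near _ _ sh rh)).
  by rewrite ge_min lexx.
have N2 : ball x d2 (r' *: v + (s' *: w + x)).
  rewrite -ball_normE /=; apply: (lt_le_trans (near _ _ rh' sh')).
  by rewrite ge_min lexx orbT.
have := H1 _ N1; have := H2 _ N2; rewrite -E => B1 B2.
rewrite (splitr e) -(subrKA (uvw (r *: w + (s *: v + x)))).
by rewrite (le_trans (ler_normD _ _))// lerD// ltW// distrC.
Qed.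

End directional_derivatives.

(** The derivative is synthesised in an existential variable. The tactic is meant to follow
    [eapply is_derive_eq], whose other goal compares the result with the announced formula. *)
Ltac derive_rule := lazymatch goal with
  | |- is_derive _ _ (fun x => (@?f x + @?g x)%R) _ => eapply (@isdD _ _ f g); derive_rule
  | |- is_derive _ _ (fun x => (- @?f x)%R) _ => eapply (@isdN _ _ f); derive_rule
  | |- is_derive _ _ (fun x => (@?f x * @?g x)%R) _ => eapply (@isdM _ _ f g); derive_rule
  | |- is_derive _ _ (fun x => (@?f x ^+ 2)%R) _ => eapply (@isdX2 _ _ f); derive_rule
  | |- is_derive _ _ (fun _ => ?c) _ => exact: (@isdcst _ _ c)
  | |- is_derive _ _ (fun x => x) _ => exact: is_derive_id
  | |- _ => solve [eauto]
  end.

(** * Cutoff functions *)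

Section cutoff.
Context {R : realType}.
Implicit Types (x : vec3 R) (r : R).

Definition kronecker (i j : axis) : R :=
  match i, j with
  | ax1, ax1 | ax2, ax2 | ax3, ax3 => 1
  | _, _ => 0
  end.

Definition nsq x : R := sum3 (fun i => co i x ^+ 2).

Lemma is_derive_co i j x : is_derive x (ax j) (co i) (kronecker i j).
Proof.
apply/is_derive_line.
rewrite (_ : (fun s => _) = (fun s : R => s * kronecker i j + co i x)).
  eapply is_derive_eq; first by derive_rule.
  by rewrite mulr0 add0r mulr1 addr0.
by apply/funext => s; case: i; case: j.
Qed.

Lemma continuous_co i : continuous (co i : vec3 R -> R).
Proof. by case: i; rewrite /co/=; cont. Qed.

Lemma continuous_nsq : continuous nsq.
Proof. by rewrite /nsq /sum3; have c := continuous_co; cont. Qed.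

Lemma nsq_ge0 x : 0 <= nsq x.
Proof. by rewrite /nsq /sum3 !addr_ge0// sqr_ge0. Qed.

Lemma is_derive_nsq j x : is_derive x (ax j) nsq (2 * co j x).
Proof.
have h := is_derive_co.
rewrite /nsq /sum3; eapply is_derive_eq; first by derive_rule.
by case: j; rewrite /kronecker; ring.
Qed.

Definition pos (s : R) : R := Num.max 0 s.

Lemma pos_ge0 s : 0 <= pos s. Proof. by rewrite /pos le_max lexx. Qed.

Lemma mul_pos s : s * pos s = pos s ^+ 2.
Proof. by rewrite /pos; case: leP => s0; rewrite ?mulr0 ?expr0n//= expr2. Qed.

Lemma continuous_pos : continuous pos.
Proof.
rewrite (_ : pos = (fun s => (s + `|s|) * 2^-1)).
  by cont.
apply/funext => s; rewrite /pos; case: leP => s0.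
  by rewrite ger0_norm//; lra.
by rewrite ltr0_norm//; lra.
Qed.

Lemma is_derive_pos2 s :
  is_derive (s : R) (1 : R) (fun y : R => pos y ^+ 2) (2 * pos s).
Proof.
have [s0|s0|->] := ltgtP s 0.
- apply: (@near_eq_is_derive _ _ _ (fun _ : R => (0 : R))).
    have := lt_nbhsl s0.
    by apply: filterS => y y0; rewrite /pos max_l ?expr0n//= ltW.
  by rewrite /pos max_l ?mulr0 ?(ltW s0)//; exact: isdcst.
- apply: (@near_eq_is_derive _ _ _ (fun y : R => y ^+ 2 : R)).
    have := lt_nbhsr s0.
    by apply: filterS => y y0; rewrite /pos max_r// ltW.
  rewrite /pos max_r ?(ltW s0)//.
  eapply is_derive_eq; first by derive_rule.
  by rewrite mulr1.
(* At the kink the identity [pos h ^+ 2 = h * pos h] reduces the difference quotient to [pos h],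
   which tends to 0. *)
- have E : h^-1 *: (pos (h *: (1 : R) + 0) ^+ 2 - pos 0 ^+ 2) @[h --> (0 : R)^'] --> (0 : R).
    have : pos h @[h --> (0 : R)^'] --> (0 : R).
      apply: cvg_within_filter.
      have := @continuous_pos (0 : R); rewrite /continuous_at.
      by rewrite (_ : pos 0 = 0)// /pos maxxx.
    apply: cvg_trans; apply: near_eq_cvg.
    near=> h.
    rewrite addr0 [h *: 1]mulr1 [in RHS]/pos maxxx expr0n/= subr0 -mul_pos.
    rewrite [_ *: _]mulKf//; near: h.
    exact: nbhs_dnbhs_neq.
  split; first by apply/cvg_ex; exists 0.
  by rewrite /derive (cvg_lim _ E)// /pos maxxx mulr0.
Unshelve. all: by end_near. Qed.

Lemma is_derive_pos3 s :
  is_derive (s : R) (1 : R) (fun y : R => pos y ^+ 3) (3 * pos s ^+ 2).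
Proof.
rewrite (_ : (fun y => _) = (fun y => y * pos y ^+ 2)).
  eapply is_derive_eq.
    by eapply isdM; [exact: is_derive_id|exact: is_derive_pos2].
  by rewrite mulrCA mul_pos mulr1; ring.
by apply/funext => y; rewrite exprS; case: (leP 0 y) => y0;
  rewrite /pos ?(max_l (ltW y0)) ?(max_r y0)// expr0n/= !mulr0.
Qed.

(* The cube makes the cutoff (1 - |x|^2/r^2)_+^3 twice continuously
   differentiable; [cut1] and [cut2] are its first and its pure second partial
   derivatives. *)
Definition cutw r x : R := pos (1 - nsq x / r ^+ 2).
Definition cutf r x : R := cutw r x ^+ 3.
Definition cut1 r i x : R := - 6 / r ^+ 2 * co i x * cutw r x ^+ 2.
Definition cut2 r i x : R :=
  - 6 / r ^+ 2 * cutw r x ^+ 2 + 24 / r ^+ 4 * co i x ^+ 2 * cutw r x.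

Lemma continuous_cutw r : continuous (cutw r).
Proof.
apply: (@contcomp _ _ _ (fun x => 1 - nsq x / r ^+ 2) pos).
  exact: continuous_pos.
by have h := continuous_nsq; cont.
Qed.

Lemma continuous_cut r : continuous (cutf r).
Proof. by have h := @continuous_cutw r; rewrite /cutf; cont. Qed.

Lemma continuous_cut1 r i : continuous (cut1 r i).
Proof.
have h := @continuous_cutw r; have h' := @continuous_co i.
by rewrite /cut1; cont.
Qed.

Lemma continuous_cut2 r i : continuous (cut2 r i).
Proof.
have h := @continuous_cutw r; have h' := @continuous_co i.
by rewrite /cut2; cont.
Qed.

Lemma is_derive_cutarg r j x :
  is_derive x (ax j) (fun x => 1 - nsq x / r ^+ 2) (- 2 * co j x / r ^+ 2).
Proof.
have h := is_derive_nsq.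
eapply is_derive_eq; first by derive_rule.
by ring.
Qed.

Lemma is_derive_cut r j x : is_derive x (ax j) (cutf r) (cut1 r j x).
Proof.
eapply is_derive_eq.
  by eapply (@isdcomp _ _ (fun y => pos y ^+ 3)); [exact: is_derive_pos3|exact: is_derive_cutarg].
by rewrite /cut1 /cutw; ring.
Qed.

Lemma is_derive_cut1 r j x : is_derive x (ax j) (cut1 r j) (cut2 r j x).
Proof.
have h1 := is_derive_co.
have h2 : is_derive x (ax j) (fun x => cutw r x ^+ 2) (2 * cutw r x * (- 2 * co j x / r ^+ 2)).
  by eapply (@isdcomp _ _ (fun y => pos y ^+ 2)); [exact: is_derive_pos2|exact: is_derive_cutarg].
eapply is_derive_eq.
  by eapply isdM; [derive_rule|exact: h2].
rewrite /cut2 (_ : kronecker j j = 1); last by case: j {h2}.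
(* For [r = 0] both sides vanish because the inverse of 0 is 0; [field] needs [r] nonzero. *)
have [->|r0] := eqVneq r 0; first by rewrite expr0n/= expr0n/= invr0; ring.
by field.
Qed.

Lemma cutw_ge0 r x : 0 <= cutw r x. Proof. exact: pos_ge0. Qed.

Lemma cutw_le1 r x : cutw r x <= 1.
Proof.
rewrite /cutw /pos ge_max ler01/= lerBlDr lerDl.
by rewrite divr_ge0// ?nsq_ge0// sqr_ge0.
Qed.

Lemma cutw_out r x : 0 < r -> r ^+ 2 <= nsq x -> cutw r x = 0.
Proof.
move=> r0 h; rewrite /cutw /pos max_l// lerBlDr add0r ler_pdivlMr ?exprn_gt0//.
by rewrite mul1r.
Qed.

(** Supports and regions of integration are described in the max norm, whose balls are boxes, while
    the physical quantities are Euclidean. This bound and [nsq_normr] translate between the two. *)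
Lemma normr_nsq x : `|x| ^+ 2 <= nsq x.
Proof.
have -> : `|x| = Num.max (Num.max `|x.1.1| `|x.1.2|) `|x.2|.
  by rewrite !prod_normE.
rewrite /nsq /sum3 /=.
rewrite -(real_normK (num_real x.1.1)) -(real_normK (num_real x.1.2)).
rewrite -(real_normK (num_real x.2)).
move: `|x.1.1| `|x.1.2| `|x.2| => a b c.
have a0 := sqr_ge0 a; have b0 := sqr_ge0 b; have c0 := sqr_ge0 c.
by case: (leP a b) => _; [case: (leP b c)|case: (leP a c)] => _; lra.
Qed.

Lemma co_normr i x : `|co i x| <= `|x|.
Proof.
have -> : `|x| = Num.max (Num.max `|x.1.1| `|x.1.2|) `|x.2|.
  by rewrite !prod_normE.
by case: i; rewrite /= !le_max lexx ?orbT.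
Qed.

Lemma nsq_normr x : nsq x <= 3 * `|x| ^+ 2.
Proof.
have H i : co i x ^+ 2 <= `|x| ^+ 2.
  by rewrite -real_normK ?num_real// lerXn2r ?nnegrE// co_normr.
rewrite /nsq /sum3; have := H ax1; have := H ax2; have := H ax3; lra.
Qed.

Lemma cutw_out' r x : 0 < r -> r < `|x| -> cutw r x = 0.
Proof.
move=> r0 rx; apply: cutw_out => //; apply: le_trans (normr_nsq x).
by rewrite lerXn2r ?nnegrE ?ltW// (lt_trans r0).
Qed.

Lemma cut_ge0 r x : 0 <= cutf r x.
Proof. by rewrite exprn_ge0// cutw_ge0. Qed.

Lemma cut_le1 r x : cutf r x <= 1.
Proof. by rewrite exprn_ile1// ?cutw_ge0 ?cutw_le1. Qed.

Lemma cvg_cut_aux x : (fun n : nat => 1 - nsq x / n.+1%:R ^+ 2) @ \oo --> (1 : R).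
Proof.
rewrite -[X in _ --> X](subr0 1); apply: cvgB; first exact: cvg_cst.
rewrite -(mulr0 (nsq x)); apply: cvgM; first exact: cvg_cst.
have h := @cvg_harmonic R.
rewrite (_ : (fun n => _) = (fun n => harmonic n * harmonic n :> R)); last first.
  by apply/funext => n /=; rewrite expr2 invfM.
by rewrite -(mulr0 0); apply: cvgM.
Qed.

Lemma cvg_cutw x : (fun n : nat => cutw n.+1%:R x) @ \oo --> (1 : R).
Proof.
have := continuous_cvg _ (@continuous_pos (1 : R)) (cvg_cut_aux x).
have -> : pos 1 = 1 :> R by rewrite /pos max_r// ler01.
exact.
Qed.

Lemma cvg_cut x : (fun n : nat => cutf n.+1%:R x) @ \oo --> (1 : R).
Proof.
have -> : (fun n : nat => cutf n.+1%:R x) =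
    (fun n : nat => cutw n.+1%:R x * (cutw n.+1%:R x * cutw n.+1%:R x)).
  by apply/funext => n; rewrite /cutf; ring.
have c := cvg_cutw x; have := cvgM c (cvgM c c); rewrite !mulr1.
exact.
Qed.

End cutoff.

(** * The kernel |w|^-2 *)

Section kernel.
Context {R : realType}.
Implicit Types (x y c w : vec3 R) (r : R).

(** The size of the gradient of 1/|w|, and also the square of 1/|w|. Its value at the singularity is
    0. *)
Definition kern w : R := (nsq w)^-1.

Lemma kern_ge0 w : 0 <= kern w.
Proof. by rewrite invr_ge0 nsq_ge0. Qed.

Lemma kernN w : kern (- w) = kern w.
Proof. by rewrite /kern /nsq /sum3 /= !sqrrN. Qed.

Lemma measurable_continuous3 (g : vec3 R -> R) : continuous g ->
  measurable_fun [set: vec3 (measurableTypeR R)] g.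
Proof. exact: lebesgue_like_measurable lebesgue_like_leb3 g. Qed.

Lemma measurable_continuous6 (g : vec3 R * vec3 R -> R) : continuous g ->
  measurable_fun [set: (vec3 (measurableTypeR R) * vec3 (measurableTypeR R))%type] g.
Proof. exact: lebesgue_like_measurable lebesgue_like_leb6 g. Qed.

Lemma measurable_inv d (T : measurableType d) (g : T -> R) :
  measurable_fun setT g -> measurable_fun setT (fun t => (g t)^-1).
Proof.
move=> mg.
have mi : measurable_fun [set: measurableTypeR R] (fun t : R => t^-1).
  have -> : [set: measurableTypeR R] = [set~ (0 : R)] `|` [set (0 : R)].
    by rewrite setUC setUv.
  apply/measurable_funU => //; [exact: measurableC|].
  split; last first.
    apply: (@eq_measurable_fun _ _ _ _ _ (fun _ => 0 : R)); last exact: measurable_cst.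
    by move=> x; rewrite inE /= => ->; rewrite invr0.
  apply: open_continuous_measurable_fun.
    by apply: closed_openC; exact: closed_eq.
  by move=> t; rewrite inE /= => /eqP t0; apply: inv_continuous.
exact: (measurableT_comp mi mg).
Qed.

Lemma measurable_kern c :
  measurable_fun [set: vec3 (measurableTypeR R)] (fun y => kern (c - y)).
Proof.
apply: measurable_inv.
apply: (@measurable_continuous3 (fun y => nsq (c - y))).
by have h := @continuous_nsq R; cont.
Qed.

Definition box c r : set (vec3 R) := [set y | `|c - y| <= r].

Lemma boxE c r : box c r =
  (`[c.1.1 - r, c.1.1 + r] `*` `[c.1.2 - r, c.1.2 + r]) `*` `[c.2 - r, c.2 + r].
Proof.
have H (a b : R) : (`|a - b| <= r) = (b \in `[a - r, a + r]).
  by rewrite in_itv/= ler_distlC.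
apply/seteqP; split=> -[[y1 y2] y3]; rewrite /box /=.
  by rewrite !prod_normE/= !ge_max -!H => /andP[/andP[]].
by rewrite !prod_normE/= !ge_max -!H => -[[-> ->] ->].
Qed.

Lemma measurable_box c r : measurable (box c r : set (vec3 (measurableTypeR R))).
Proof.
by rewrite boxE; apply: measurableX => //; apply: measurableX.
Qed.

Lemma leb2X (A B : set (measurableTypeR R)) : measurable A -> measurable B ->
  leb2 (A `*` B) = (lebesgue_measure A * lebesgue_measure B)%E.
Proof. exact: product_measure1E. Qed.

Lemma leb3X (A : set (measurableTypeR R * measurableTypeR R)%type)
    (B : set (measurableTypeR R)) : measurable A -> measurable B ->
  leb3 (A `*` B) = (leb2 A * lebesgue_measure B)%E.
Proof. exact: product_measure1E. Qed.

Lemma leb3_box c r : 0 <= r -> leb3 (box c r) = (8 * r ^+ 3)%:E.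
Proof.
move=> r0.
have H (a : R) : @lebesgue_measure R `[a - r, a + r] = (2 * r)%:E.
  rewrite lebesgue_measure_itv/= lte_fin.
  have [a1|a1] := ltP.
    by rewrite -EFinD; congr EFin; ring.
  by congr EFin; lra.
rewrite boxE leb3X//; last exact: measurableX.
rewrite leb2X// !H -!EFinM.
by congr EFin; ring.
Qed.

(** The least [n] satisfying the lower bound works: minimality gives the upper bound, except for
    [n = 0], where it is the hypothesis [a <= r]. *)
Lemma dyadic_bracket (a r : R) : 0 < a -> a <= r ->
  exists n : nat, r / 2 ^+ n.+1 < a <= r / 2 ^+ n.
Proof.
move=> a0 ar.
have ex : exists n, r / 2 ^+ n.+1 < a.
  have r0 : 0 < r by exact: lt_le_trans ar.
  have [n nP] : exists n : nat, r / a < n%:R.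
    exists (Num.truncn (r / a)).+1; exact: truncnS_gt.
  exists n; rewrite ltr_pdivrMr ?exprn_gt0// mulrC -ltr_pdivrMr//.
  rewrite (lt_trans nP)// -natrX ltr_nat.
  by rewrite (ltn_trans (ltnSn n))// ltn_expl.
have := ex_minnP ex; case=> -[|n] n1 n2; first by exists 0%N; rewrite n1 expr0 divr1.
exists n.+1; rewrite n1/= leNgt; apply/negP => h.
by have := n2 _ h; rewrite ltnn.
Qed.

(* Sum over the dyadic shells r/2^(n+1) < |c - y| <= r/2^n. *)
Lemma integral_kern_box c r : 0 < r ->
  (\int[leb3]_(y in box c r) (kern (c - y))%:E <= (64 * r)%:E)%E.
Proof.
move=> r0.
pose B n := box c (r / 2 ^+ n).
pose F n y := (4 ^+ n.+1 / r ^+ 2 * \1_(B n) y)%:E.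
have F0 n y : (0 <= F n y)%E.
  by rewrite lee_fin mulr_ge0// divr_ge0 ?exprn_ge0// ltW.
have mF n : measurable_fun [set: vec3 (measurableTypeR R)] (F n).
  apply/measurable_EFinP; apply: measurable_funM => //.
  by apply: measurable_indic; exact: measurable_box.
apply: (@le_trans _ _ (\int[leb3]_y (\sum_(n <oo) F n y))%E).
  rewrite integral_mkcond; apply: ge0_le_integral => //.
  - move=> y _; rewrite patchE; case: ifP => // _; exact: kern_ge0.
  - apply/(measurable_restrictT _ _).1; first exact: measurable_box.
    by apply/measurable_funTS/measurable_EFinP; exact: measurable_kern.
  - exact: ge0_emeasurable_sum.
  - move=> y _; rewrite patchE; case: ifPn => [|_]; last exact: nneseries_ge0.
    rewrite inE /box /= => yr.
    (* The centre lies in no dyadic shell, but [kern] is 0 there. *)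
    have [->|cy0] := eqVneq (c - y) 0.
      rewrite /kern (_ : nsq 0 = 0) ?invr0; first exact: nneseries_ge0.
      by rewrite /nsq /sum3/= expr0n/= !addr0.
    have [|n /andP[n1 n2]] := dyadic_bracket _ yr; first by rewrite normr_gt0.
    apply: le_trans (nneseries_lim_ge n.+1 _) => //.
    rewrite big_nat_recr//=; apply: (@le_trans _ _ (F n y)); last first.
      by rewrite leeDr// sume_ge0.
    rewrite /F indicE mem_set//= mulr1 lee_fin /kern.
    rewrite -[leRHS]invrK lef_pV2 ?posrE ?invr_gt0 ?divr_gt0 ?exprn_gt0//; last first.
      by apply: lt_le_trans (normr_nsq _); rewrite exprn_gt0// normr_gt0.
    apply: le_trans (normr_nsq _).
    rewrite invf_div (_ : 4 = 2 ^+ 2 :> R); last by ring.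
    rewrite -exprM mulnC exprM -expr_div_n lerXn2r ?nnegrE//.
      by rewrite divr_ge0 ?exprn_ge0// ltW.
    exact: ltW.
rewrite integral_nneseries//.
(* On the n-th shell the kernel is at most 4^(n+1) / r^2, and the box has volume 8 (r / 2^n)^3. The
   product is 64 r / 2^(n+1), a geometric series of sum 64 r. *)
have -> : (\sum_(n <oo) \int[leb3]_y F n y =
    \sum_(n <oo) ((64 * r) / (2 ^ (n + 1))%:R)%:E)%E.
  apply: eq_eseriesr => n _; rewrite /F.
  under eq_integral do rewrite EFinM.
  rewrite ge0_integralZl_EFin//; first last.
  - by rewrite divr_ge0 ?exprn_ge0// ltW.
  - by apply/measurable_EFinP; apply: measurable_indic; exact: measurable_box.
  rewrite integral_indic ?setIT//; last exact: measurable_box.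
  rewrite [X in (_ * X)%E](_ : _ = (8 * (r / 2 ^+ n) ^+ 3)%:E); last first.
    by apply: leb3_box; rewrite divr_ge0 ?exprn_ge0 ?ltW.
  rewrite -EFinM; congr EFin.
  have -> : 4 ^+ n.+1 = 4 * (2 ^+ n) ^+ 2 :> R.
    by rewrite exprS (_ : 4 = 2 ^+ 2 :> R) -?exprM ?(mulnC 2)// expr2 -natrM.
  rewrite natrX addn1 (exprS _ n).
  have : 2 ^+ n != 0 :> R by rewrite expf_neq0.
  move: (2 ^+ n) => p p0.
  by field; rewrite p0 gt_eqF.
by rewrite (cvg_lim _ (@cvg_geometric_eseries_half R (64 * r) 0))// expr0 divr1.
Qed.

End kernel.

(** * Dominated convergence and the divergence theorem *)

Section Rintegral_lemmas.
Context {R : realType} d (T : measurableType d) (mu : {measure set T -> \bar R}).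

Lemma Rintegral_dominated (D : set T) (f_ : nat -> T -> R) (f g : T -> R) :
  measurable D -> (forall n, measurable_fun D (f_ n)) ->
  (forall t, D t -> f_ ^~ t @ \oo --> f t) ->
  mu.-integrable D (EFin \o g) ->
  (forall n t, D t -> `|f_ n t| <= g t) ->
  mu.-integrable D (EFin \o f) /\
  (fun n => \int[mu]_(t in D) f_ n t) @ \oo --> \int[mu]_(t in D) f t.
Proof.
move=> mD measurable_f cf ig fg.
have mf' : measurable_fun D f by exact: measurable_fun_cvg measurable_f cf.
have [|||||i _ c] := @dominated_convergence _ _ _ mu D mD (fun n => EFin \o f_ n) (EFin \o f) (EFin \o g).
- by move=> n; apply/measurable_EFinP.
- exact/measurable_EFinP.
- by apply: aeW => t Dt; apply: cvg_EFin; [exact: nearW|exact: cf].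
- exact: ig.
- by apply: aeW => t n Dt; rewrite /= lee_fin fg.
split => //.
apply: (@fine_cvg _ _ _ _ (fun n => \int[mu]_(t in D) (f_ n t)%:E)%E).
by rewrite /Rintegral fineK//; exact: integrable_fin_num.
Qed.

Lemma Rintegral_cvg (D : set T) (f_ : nat -> T -> R) (f g : T -> R) :
  measurable D -> (forall n, measurable_fun D (f_ n)) ->
  (forall t, D t -> f_ ^~ t @ \oo --> f t) ->
  mu.-integrable D (EFin \o g) ->
  (forall n t, D t -> `|f_ n t| <= g t) ->
  (fun n => \int[mu]_(t in D) f_ n t) @ \oo --> \int[mu]_(t in D) f t.
Proof. by move=> mD measurable_f cf ig fg; have [] := Rintegral_dominated mD measurable_f cf ig fg. Qed.

Lemma eq_RintegralT (f g : T -> R) : f =1 g -> \int[mu]_t f t = \int[mu]_t g t.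
Proof. by move=> /funext ->. Qed.

Lemma integrable_fin (D : set T) (f : T -> R) : mu.-integrable D (EFin \o f) -> measurable D ->
  (\int[mu]_(t in D) (f t)%:E = (\int[mu]_(t in D) f t)%:E)%E.
Proof. by move=> i mD; rewrite /Rintegral fineK//; exact: integrable_fin_num. Qed.

End Rintegral_lemmas.

Section integral3.
Context {R : realType}.

Lemma integrable3 (g : vec3 R -> R) (K : R) : continuous g ->
  (forall x, K < `|x| -> g x = 0) -> leb3.-integrable setT (EFin \o g).
Proof. by move=> cg gK; exact: (lebesgue_like_integrableT lebesgue_like_leb3 cg gK). Qed.

(** The divergence theorem for a compactly supported field, applied below to fields multiplied by a
    cutoff. *)
Lemma integral_div (g dg : axis -> vec3 R -> R) (K : R) :
  (forall i x, is_derive x (ax i) (g i) (dg i x)) ->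
  (forall i, continuous (dg i)) ->
  (forall i x, K < `|x| -> g i x = 0) ->
  \int[@leb3 R]_x sum3 (fun i => dg i x) = 0.
Proof.
move=> g' cdg gK; rewrite /sum3.
have dgK i x : K < `|x| -> dg i x = 0 by exact: is_derive_out (gK i) (g' i x).
have idg i : leb3.-integrable setT (EFin \o dg i) by apply: integrable3 (cdg i) (dgK i).
have i12 : leb3.-integrable setT (EFin \o (fun x => dg ax1 x + dg ax2 x)).
  rewrite (_ : _ \o _ = (EFin \o dg ax1) \+ (EFin \o dg ax2)).
    by apply: integrableD.
  by apply/funext => x /=; rewrite EFinD.
by rewrite !RintegralD// !(integral_derive0 (g' _) (cdg _) (gK _)) !addr0.
Qed.

End integral3.

(** * The virial of the field *)

Section field.
Context {R : realType}.
Variables (U rho : vec3 R -> R) (DU : axis -> vec3 R -> R)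
  (DDU : axis -> axis -> vec3 R -> R).
Hypothesis U' : forall i x, is_derive x (ax i) U (DU i x).
Hypothesis DU' : forall i j x, is_derive x (ax j) (DU i) (DDU i j x).
Hypothesis cU : continuous U.
Hypothesis cDU : forall i, continuous (DU i).
Hypothesis cDDU : forall i j, continuous (DDU i j).
Hypothesis lapU : forall x, sum3 (fun i => DDU i i x) = rho x.

Definition nrm2 (x : vec3 R) : R := sum3 (fun i => DU i x ^+ 2).

(** In the stress tensor identity the Hessian terms cancel only thanks to this symmetry. *)
Let DDUC i j x : DDU i j x = DDU j i x.
Proof. exact: (schwarz (U' i) (U' j) (DU' i j) (DU' j i)). Qed.

Let crho : continuous rho.
Proof.
rewrite (_ : rho = fun x => sum3 (fun i => DDU i i x)); last by apply/funext.
by rewrite /sum3; cont.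
Qed.

Lemma continuous_nrm2 : continuous nrm2.
Proof. by rewrite /nrm2 /sum3; cont. Qed.

Lemma nrm2_ge0 x : 0 <= nrm2 x.
Proof. by rewrite /nrm2 /sum3 !addr_ge0 ?sqr_ge0. Qed.

(** The integrand is the divergence of chi U grad U - 1/2 U^2 grad chi, with chi the cutoff. The two
    terms U grad U . grad chi cancel, so the error carries U^2 and the Laplacian of chi, and decay
    of U alone controls it. *)
Lemma energy_cut0 (r : R) : 0 < r ->
  \int[@leb3 R]_x (cutf r x * nrm2 x + cutf r x * (U x * rho x)
      - 2^-1 * (U x ^+ 2 * sum3 (fun i => cut2 r i x))) = 0.
Proof.
move=> r0.
pose g i x := cutf r x * (U x * DU i x) - 2^-1 * (U x ^+ 2 * cut1 r i x).
pose dg i x := cutf r x * (U x * DDU i i x + DU i x ^+ 2) - 2^-1 * (U x ^+ 2 * cut2 r i x).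
have hc := @continuous_cut R r; have hc1 := @continuous_cut1 R r; have hc2 := @continuous_cut2 R r.
have E := @integral_div R g dg r.
rewrite -[RHS]E; last 3 first.
- have h1 := is_derive_cut r; have h2 := @is_derive_cut1 R r.
  move=> i x; rewrite /g; eapply is_derive_eq; first by derive_rule.
  by rewrite /dg; field.
- by move=> i; rewrite /dg; cont.
- by move=> i x rx; rewrite /g /cut1 /cutf (cutw_out' r0 rx); ring.
by apply: eq_RintegralT => x; rewrite /dg /nrm2 -lapU /sum3; ring.
Qed.

Lemma energy_cut (r : R) : 0 < r ->
  \int[@leb3 R]_x (cutf r x * nrm2 x) = - (\int[@leb3 R]_x (cutf r x * (U x * rho x)))
      + 2^-1 * \int[@leb3 R]_x (U x ^+ 2 * sum3 (fun i => cut2 r i x)).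
Proof.
move=> r0; have := energy_cut0 r0.
have hc := @continuous_cut R r; have hc2 := @continuous_cut2 R r; have hn := continuous_nrm2.
have i1 : leb3.-integrable setT (EFin \o (fun x => cutf r x * nrm2 x)).
  by apply: (@integrable3 _ _ r); [cont|move=> x rx; rewrite /cutf (cutw_out' r0 rx); ring].
have i2 : leb3.-integrable setT (EFin \o (fun x => cutf r x * (U x * rho x))).
  by apply: (@integrable3 _ _ r); [cont|move=> x rx; rewrite /cutf (cutw_out' r0 rx); ring].
have i3 : leb3.-integrable setT (EFin \o (fun x => U x ^+ 2 * sum3 (fun i => cut2 r i x))).
  apply: (@integrable3 _ _ r); first by rewrite /sum3; cont.
  by move=> x rx; rewrite /sum3 /cut2 /cutf (cutw_out' r0 rx); ring.
have i12 : leb3.-integrable setT (EFin \o (fun x => cutf r x * nrm2 x + cutf r x * (U x * rho x))).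
  by apply: (@integrable3 _ _ r); [cont|move=> x rx; rewrite /cutf (cutw_out' r0 rx); ring].
have i3' : leb3.-integrable setT (EFin \o (fun x => 2^-1 * (U x ^+ 2 * sum3 (fun i => cut2 r i x)))).
  apply: (@integrable3 _ _ r); first by rewrite /sum3; cont.
  by move=> x rx; rewrite /sum3 /cut2 /cutf (cutw_out' r0 rx); ring.
rewrite RintegralB// RintegralD// RintegralZl//.
by lra.
Qed.

(* With b(x) = cutf r x * x, this is 1/2 (div b) |grad U|^2 - sum_ij D_j b_i D_i U D_j U,
   the Maxwell stress tensor of U contracted with the gradient of b. *)
Definition stress (r : R) x : R :=
  2^-1 * (3 * cutf r x - 6 / r ^+ 2 * nsq x * cutw r x ^+ 2) * nrm2 x
  - cutf r x * nrm2 x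
  + 6 / r ^+ 2 * cutw r x ^+ 2 * sum3 (fun i => co i x * DU i x) ^+ 2.

(** With b the truncated position and S = b . grad U, the divergence of S grad U - 1/2 |grad U|^2 b
    is S rho minus the stress: the second derivatives left after [lapU] cancel by symmetry of the
    Hessian. *)
Lemma stress_cut (r : R) : 0 < r ->
  \int[@leb3 R]_x (cutf r x * sum3 (fun i => co i x * DU i x) * rho x) =
  \int[@leb3 R]_x stress r x.
Proof.
move=> r0.
pose b i x := cutf r x * co i x.
pose S x := b ax1 x * DU ax1 x + b ax2 x * DU ax2 x + b ax3 x * DU ax3 x.
pose g i x := S x * DU i x - 2^-1 * (nrm2 x * b i x).
pose db i j x := cutf r x * kronecker i j + co i x * cut1 r j x.
pose dS j x := (b ax1 x * DDU ax1 j x + DU ax1 x * db ax1 j x) +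
   (b ax2 x * DDU ax2 j x + DU ax2 x * db ax2 j x) +
   (b ax3 x * DDU ax3 j x + DU ax3 x * db ax3 j x).
pose dN j x := 2 * DU ax1 x * DDU ax1 j x + 2 * DU ax2 x * DDU ax2 j x + 2 * DU ax3 x * DDU ax3 j x.
pose dg i x := S x * DDU i i x + DU i x * dS i x - 2^-1 * (nrm2 x * db i i x + b i x * dN i x).
have hc := @continuous_cut R r; have hc1 := @continuous_cut1 R r; have hn := continuous_nrm2.
have hco := @continuous_co R.
have h1 := is_derive_cut r; have h2 := @is_derive_co R.
have hb i j x : is_derive x (ax j) (b i) (db i j x).
  by rewrite /b; eapply is_derive_eq; [derive_rule|rewrite /db; ring].
have hS j x : is_derive x (ax j) S (dS j x).
  by rewrite /S; eapply is_derive_eq; [derive_rule|rewrite /dS; ring].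
have hN j x : is_derive x (ax j) nrm2 (dN j x).
  by rewrite /nrm2 /sum3; eapply is_derive_eq; [derive_rule|rewrite /dN; ring].
have cdg i : continuous (dg i) by rewrite /dg /S /dS /dN /db /b; cont.
have gr i x : r < `|x| -> g i x = 0.
  by move=> rx; rewrite /g /S /b /cutf (cutw_out' r0 rx); ring.
have hg i x : is_derive x (ax i) (g i) (dg i x).
  by rewrite /g; eapply is_derive_eq; [derive_rule|rewrite /dg; field].
have E := integral_div hg cdg gr.
apply/eqP; rewrite -subr_eq0 -RintegralB//.
- apply/eqP; rewrite -[RHS]E; apply: eq_RintegralT => x.
  rewrite -lapU /dg /stress /dS /dN /db /S /b /cut1 /nrm2 /nsq /sum3 /kronecker.
  rewrite (DDUC ax2 ax1) (DDUC ax3 ax1) (DDUC ax3 ax2).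
  by field; rewrite gt_eqF.
- apply: (@integrable3 _ _ r); first by rewrite /sum3; cont.
  by move=> x rx; rewrite /cutf (cutw_out' r0 rx); ring.
- have hw := @continuous_cutw R r; have hs := @continuous_nsq R.
  apply: (@integrable3 _ _ r); first by rewrite /stress /sum3; cont.
  by move=> x rx; rewrite /stress /cutf (cutw_out' r0 rx); ring.
Qed.

End field.

Section field_limits.
Context {R : realType}.
Variables (U rho : vec3 R -> R) (DU : axis -> vec3 R -> R)
  (DDU : axis -> axis -> vec3 R -> R).
Hypothesis U' : forall i x, is_derive x (ax i) U (DU i x).
Hypothesis DU' : forall i j x, is_derive x (ax j) (DU i) (DDU i j x).
Hypothesis cU : continuous U.
Hypothesis cDU : forall i, continuous (DU i).
Hypothesis cDDU : forall i j, continuous (DDU i j).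
Hypothesis lapU : forall x, sum3 (fun i => DDU i i x) = rho x.
Variables (K C R1 : R).
Hypothesis rhoK : forall x, K < `|x| -> rho x = 0.
Hypothesis C0 : 0 <= C.
Hypothesis R10 : 0 < R1.
Hypothesis decay : forall x, R1 < `|x| -> U x ^+ 2 <= C * kern x.

Lemma bounded_on_ball (g : vec3 R -> R) (L : R) : continuous g ->
  exists2 B, 0 <= B & forall x, `|x| <= L -> `|g x| <= B.
Proof.
move=> cg; have [_ k _] := @lebesgue_like_leb3 R.
have /compact_bounded[N [Nr Nb]] : compact (g @` [set x : vec3 R | `|x| <= L]).
  by apply: continuous_compact (k L); exact: continuous_subspaceT.
exists (`|N| + 1) => [|x xL]; first by rewrite addr_ge0.
by apply: Nb; [rewrite (le_lt_trans (ler_norm _))// ltrDl|exists x].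
Qed.

Lemma continuous_source : continuous rho.
Proof.
rewrite (_ : rho = fun x => sum3 (fun i => DDU i i x)); last by apply/funext.
by rewrite /sum3; cont.
Qed.

Lemma lap_cut_out (r : R) (x : vec3 R) : cutw r x = 0 ->
  sum3 (fun i => cut2 r i x) = 0.
Proof. by move=> h; rewrite /sum3 /cut2 h expr0n/= !mulr0 !addr0. Qed.

(** With s = |x|^2 / r^2 and w the base of the cutoff, the Laplacian is r^-2 (- 18 w^2 + 24 s w). On
    the support s and w lie in [0, 1], and 42 = 18 + 24. *)
Lemma lap_cut_bound (r : R) (x : vec3 R) : 0 < r ->
  `|sum3 (fun i => cut2 r i x)| <= 42 / r ^+ 2 * \1_(box 0 r) x.
Proof.
move=> r0; rewrite indicE.
have r20 : 0 < r ^+ 2 by rewrite exprn_gt0.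
have [xr|xr] := boolP (x \in box 0 r); last first.
  have rx : r < `|x|.
    by move: xr => /negP; rewrite inE /box /= sub0r normrN => /negP; rewrite -ltNge.
  by rewrite lap_cut_out ?cutw_out'// normr0 mulr0.
rewrite mulr1.
have [h|h] := leP (r ^+ 2) (nsq x).
  by rewrite lap_cut_out ?cutw_out// normr0 divr_ge0// ltW.
have -> : sum3 (fun i => cut2 r i x) =
    r^-2 * (- 18 * cutw r x ^+ 2 + 24 * (nsq x / r ^+ 2) * cutw r x).
  rewrite /sum3 /cut2 /nsq /sum3; field; by rewrite gt_eqF.
have w0 := cutw_ge0 r x; have w1 := cutw_le1 r x.
have s0 : 0 <= nsq x / r ^+ 2 by rewrite divr_ge0 ?nsq_ge0// ltW.
have s1 : nsq x / r ^+ 2 <= 1 by rewrite ler_pdivrMr// mul1r ltW.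
rewrite normrM ger0_norm ?invr_ge0 ?(ltW r20)// mulrC.
rewrite ler_wpM2r ?invr_ge0 ?(ltW r20)//.
move: (nsq x / r ^+ 2) (cutw r x) s0 s1 w0 w1 => s w s0 s1 w0 w1.
rewrite ler_norml; apply/andP; split; nra.
Qed.

(* Only |x| <~ r contributes, and there the second derivatives of the cutoff are
   O(r^-2) while U^2 = O(|x|^-2). *)
Lemma energy_tail : exists2 C' : R, 0 <= C' & forall r : R, 1 <= r ->
  `|\int[@leb3 R]_x (U x ^+ 2 * sum3 (fun i => cut2 r i x))| <= C' / r.
Proof.
have [B B0 UB] := bounded_on_ball R1 cU.
(* After the factor 42 / r^2, the box of radius [R1], where U is only bounded, contributes B^2 times
   its volume 8 R1^3. The rest contributes C times the integral of [kern] over the box of radius r,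
   at most 64 r. Since [1 <= r], both are O(1/r). *)
exists (42 * (B ^+ 2 * (8 * R1 ^+ 3) + C * 64)).
  by rewrite mulr_ge0// addr_ge0// !mulr_ge0 ?sqr_ge0 ?exprn_ge0 ?(ltW R10).
move=> r r1; have r0 : 0 < r by apply: lt_le_trans r1.
have hc2 := @continuous_cut2 R r.
pose h x := U x ^+ 2 * sum3 (fun i => cut2 r i x).
have ch : continuous h by rewrite /h /sum3; cont.
have ih : leb3.-integrable setT (EFin \o h).
  apply: (@integrable3 _ _ r) => // x rx.
  by rewrite /h /sum3 /cut2 (cutw_out' r0 rx); ring.
rewrite -lee_fin EFin_normr_Rintegral//.
have mh : measurable_fun setT (EFin \o h) by exact: measurable_int ih.
have HH := le_abse_integral (@leb3 R) measurableT mh.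
apply: (le_trans HH).
pose G1 x := (42 / r ^+ 2 * B ^+ 2 * \1_(box 0 R1) x)%:E.
pose kr := (fun x : vec3 R => (kern (0 - x))%:E) \_ (box 0 r).
pose G2 x := ((42 / r ^+ 2 * C)%R%:E * kr x)%E.
have c0 : 0 <= 42 / r ^+ 2 by rewrite divr_ge0// exprn_ge0// ltW.
have mG1 : measurable_fun [set: vec3 (measurableTypeR R)] G1.
  apply/measurable_EFinP; apply: measurable_funM => //.
  by apply: measurable_indic; exact: measurable_box.
have mk : measurable_fun [set: vec3 (measurableTypeR R)] kr.
  apply/(measurable_restrictT _ _).1; first exact: measurable_box.
  by apply/measurable_funTS/measurable_EFinP; exact: measurable_kern.
have k0 x : (0 <= kr x)%E.
  by rewrite /kr patchE; case: ifP => // _; rewrite lee_fin kern_ge0.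
have mG2 : measurable_fun [set: vec3 (measurableTypeR R)] G2.
  by apply: emeasurable_funM => //; exact: measurable_cst.
have G10 x : (0 <= G1 x)%E by rewrite lee_fin mulr_ge0// mulr_ge0// sqr_ge0.
have G20 x : (0 <= G2 x)%E by rewrite mule_ge0// lee_fin mulr_ge0.
apply: (@le_trans _ _ (\int[leb3]_x (G1 x + G2 x))%E).
  apply: ge0_le_integral => //.
  - exact: (measurableT_comp (@abse_measurable R setT) mh).
  - exact: emeasurable_funD.
  move=> x _ /=; rewrite /h normrM ger0_norm ?sqr_ge0//.
  have LB := lap_cut_bound x r0.
  have [xr|xr] := boolP (x \in box 0 r); last first.
    move: LB; rewrite indicE (negbTE xr) mulr0 normr_le0 => /eqP ->.
    by rewrite normr0 mulr0 adde_ge0.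
  rewrite /G2 /kr patchE xr -!EFinM -EFinD lee_fin.
  move: LB; rewrite indicE xr mulr1 => LB.
  apply: (@le_trans _ _ (U x ^+ 2 * (42 / r ^+ 2))); first by rewrite ler_wpM2l ?sqr_ge0.
  rewrite (_ : _ + _ = (B ^+ 2 * \1_(box 0 R1) x + C * kern (0 - x)) * (42 / r ^+ 2)); last by ring.
  rewrite ler_wpM2r// sub0r kernN.
  have [xR|xR] := leP `|x| R1.
    rewrite indicE mem_set /=; last by rewrite /box /= sub0r normrN.
    rewrite mulr1 -[leLHS]addr0 lerD ?mulr_ge0 ?kern_ge0//.
    by rewrite -real_normK ?num_real// lerXn2r ?nnegrE// UB.
  rewrite -[leLHS]add0r lerD ?decay// mulr_ge0 ?sqr_ge0//.
rewrite ge0_integralD//; apply: (@le_trans _ _ ((42 / r ^+ 2 * B ^+ 2 * (8 * R1 ^+ 3))%:E + (42 / r ^+ 2 * C * (64 * r))%:E)%E).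
  apply: leeD.
    rewrite /G1; under eq_integral do rewrite EFinM.
    rewrite ge0_integralZl_EFin//; first last.
    - by rewrite mulr_ge0// sqr_ge0.
    - by apply/measurable_EFinP; apply: measurable_indic; exact: measurable_box.
    rewrite integral_indic ?setIT//; last exact: measurable_box.
    rewrite [X in (_ * X)%E](_ : _ = (8 * R1 ^+ 3)%:E) ?EFinM//.
    by apply: leb3_box; exact: ltW.
  rewrite /G2 ge0_integralZl_EFin//; last by rewrite mulr_ge0.
  rewrite /kr -integral_mkcond [X in (_ <= X)%E]EFinM; apply: lee_wpmul2l.
    by rewrite lee_fin mulr_ge0.
  exact: integral_kern_box.
rewrite -EFinD lee_fin.
rewrite (_ : 42 / r ^+ 2 * C * (64 * r) = 42 * (C * 64) / r); last by field; rewrite gt_eqF.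
rewrite [leRHS](_ : _ = 42 * (B ^+ 2 * (8 * R1 ^+ 3)) / r + 42 * (C * 64) / r); last by ring.
rewrite lerD2r.
rewrite [leLHS](_ : _ = 42 * (B ^+ 2 * (8 * R1 ^+ 3)) / r ^+ 2); last by ring.
rewrite ler_wpM2l//.
  by rewrite mulr_ge0// mulr_ge0 ?sqr_ge0// mulr_ge0// exprn_ge0// ltW.
by rewrite lef_pV2 ?posrE ?exprn_gt0// expr2 ler_peMr// ltW.
Qed.

(** In the truncated energy identity the source term converges because [rho] has compact support,
    and the error term tends to 0. Integrability of |grad U|^2 is not known beforehand: Fatou's
    lemma extracts it from the convergent truncated integrals, and then |grad U|^2 itself dominates
    them. *)
Lemma nrm2_integral :
  leb3.-integrable setT (EFin \o nrm2 DU) /\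
  \int[@leb3 R]_x nrm2 DU x = - (\int[@leb3 R]_x (U x * rho x)).
Proof.
have crho := continuous_source.
have hc := @continuous_cut R; have hn := continuous_nrm2 cDU.
have iUrho : leb3.-integrable setT (EFin \o (fun x => U x * rho x)).
  by apply: (@integrable3 _ _ K); [cont|move=> x /rhoK ->; rewrite mulr0].
have ccut := @cvg_cut R.
have lim1 : (fun n : nat => \int[@leb3 R]_x (cutf n.+1%:R x * (U x * rho x))) @ \oo -->
    \int[@leb3 R]_x (U x * rho x).
  apply: (@Rintegral_cvg R _ _ (@leb3 R) setT (fun n x => cutf n.+1%:R x * (U x * rho x)) _ (fun x => `|U x * rho x|)) => //.
  - by move=> n; apply: (@measurable_continuous3 _ (fun x => cutf n.+1%:R x * (U x * rho x))); cont.
  - move=> x _; rewrite -[X in _ --> X]mul1r; apply: cvgM; [exact: ccut|exact: cvg_cst].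
  - exact: integrable_norm.
  - move=> n x _; rewrite normrM ger0_norm ?cut_ge0//.
    by rewrite ler_piMl// cut_le1.
have [C' C'0 tail] := energy_tail.
have lim2 : (fun n : nat => \int[@leb3 R]_x (U x ^+ 2 * sum3 (fun i => cut2 n.+1%:R i x))) @ \oo --> (0 : R).
  apply/norm_cvg0P.
  apply: (@squeeze_cvgr _ _ _ _ (fun=> 0) (fun n : nat => C' * harmonic n)).
  - by apply: nearW => n; rewrite normr_ge0/= tail// ler1n.
  - exact: cvg_cst.
  - by rewrite -(mulr0 C'); apply: cvgM; [exact: cvg_cst|exact: cvg_harmonic].
have lim3 : (fun n : nat => \int[@leb3 R]_x (cutf n.+1%:R x * nrm2 DU x)) @ \oo -->
   - (\int[@leb3 R]_x (U x * rho x)).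
  have -> : (fun n : nat => \int[@leb3 R]_x (cutf n.+1%:R x * nrm2 DU x)) =
    (fun n : nat => - (\int[@leb3 R]_x (cutf n.+1%:R x * (U x * rho x))) + 2^-1 *
     (\int[@leb3 R]_x (U x ^+ 2 * sum3 (fun i => cut2 n.+1%:R i x)))).
    by apply/funext => n; apply: (energy_cut U' DU' cU cDU cDDU lapU).
  rewrite -[X in _ --> X]addr0 -[X in _ + X](mulr0 2^-1); apply: cvgD.
    exact: cvgN.
  by apply: cvgM => //; exact: cvg_cst.
have i_n n : leb3.-integrable setT (EFin \o (fun x => cutf n.+1%:R x * nrm2 DU x)).
  apply: (@integrable3 _ _ n.+1%:R); first by cont.
  by move=> x nx; rewrite /cutf (cutw_out' _ nx)// expr0n mul0r.
have cn x : (fun n : nat => cutf n.+1%:R x * nrm2 DU x) @ \oo --> nrm2 DU x.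
  by rewrite -[X in _ --> X]mul1r; apply: cvgM; [exact: ccut|exact: cvg_cst].
have mn : measurable_fun setT (EFin \o nrm2 DU).
  by apply/measurable_EFinP; exact: measurable_continuous3.
have inrm : leb3.-integrable setT (EFin \o nrm2 DU).
  apply/integrableP; split => //.
  have -> : (\int[leb3]_x `|(EFin \o nrm2 DU) x| =
      \int[@leb3 R]_x limn_einf (fun n => (cutf n.+1%:R x * nrm2 DU x)%R%:E))%E.
    apply: eq_integral => x _; have cE : (fun n : nat => (cutf n.+1%:R x * nrm2 DU x)%:E) @ \oo --> (nrm2 DU x)%:E.
      by apply: cvg_EFin; [exact: nearW|exact: cn].
    rewrite is_cvg_limn_einfE; last by apply/cvg_ex; eexists; exact: cE.
    by rewrite (cvg_lim _ cE)//= ger0_norm// nrm2_ge0.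
  have F := @fatou _ _ _ (@leb3 R) setT measurableT (fun n x => (cutf n.+1%:R x * nrm2 DU x)%:E).
  apply: (le_lt_trans (F _ _)).
  - by move=> n; exact: measurable_int (i_n n).
  - by move=> n x _; rewrite lee_fin mulr_ge0 ?cut_ge0 ?nrm2_ge0.
  have -> : (fun n => \int[leb3]_x (cutf n.+1%:R x * nrm2 DU x)%:E)%E = (fun n => (\int[@leb3 R]_x (cutf n.+1%:R x * nrm2 DU x))%:E).
    by apply/funext => n; rewrite integrable_fin.
  have cE : (fun n => (\int[@leb3 R]_x (cutf n.+1%:R x * nrm2 DU x))%:E) @ \oo --> (- (\int[@leb3 R]_x (U x * rho x)))%:E.
    by apply: cvg_EFin; [exact: nearW|exact: lim3].
  rewrite is_cvg_limn_einfE; last by apply/cvg_ex; eexists; exact: cE.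
  by rewrite (cvg_lim _ cE)// ltry.
split => //.
apply: cvg_unique (lim3) => //.
apply: (@Rintegral_cvg R _ _ (@leb3 R) setT (fun n x => cutf n.+1%:R x * nrm2 DU x) (nrm2 DU) (nrm2 DU)) => //.
- by move=> n; apply: (@measurable_continuous3 _ (fun x => cutf n.+1%:R x * nrm2 DU x)); cont.
- move=> n x _; rewrite ger0_norm; last by apply: mulr_ge0; [exact: cut_ge0|exact: nrm2_ge0].
  by rewrite ler_piMl ?cut_le1 ?nrm2_ge0.
Qed.

End field_limits.

Section sequences.
Context {R : realType}.
Implicit Types (u v : nat -> R) (a b : R).
Lemma cvg_seqD u v a b : u @ \oo --> a -> v @ \oo --> b ->
  (fun n => u n + v n) @ \oo --> (a + b).
Proof. by move=> ? ?; exact: cvgD. Qed.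
Lemma cvg_seqB u v a b : u @ \oo --> a -> v @ \oo --> b ->
  (fun n => u n - v n) @ \oo --> (a - b).
Proof. by move=> ? ?; exact: cvgB. Qed.
Lemma cvg_seqM u v a b : u @ \oo --> a -> v @ \oo --> b ->
  (fun n => u n * v n) @ \oo --> (a * b).
Proof. by move=> ? ?; exact: cvgM. Qed.
End sequences.

Section virial.
Context {R : realType}.
Variables (U rho : vec3 R -> R) (DU : axis -> vec3 R -> R)
  (DDU : axis -> axis -> vec3 R -> R).
Hypothesis U' : forall i x, is_derive x (ax i) U (DU i x).
Hypothesis DU' : forall i j x, is_derive x (ax j) (DU i) (DDU i j x).
Hypothesis cU : continuous U.
Hypothesis cDU : forall i, continuous (DU i).
Hypothesis cDDU : forall i j, continuous (DDU i j).
Hypothesis lapU : forall x, sum3 (fun i => DDU i i x) = rho x.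
Hypothesis inrm : leb3.-integrable setT (EFin \o nrm2 DU).

(** Lagrange's identity: the difference is the squared length of the cross product. *)
Lemma cauchy_schwarz3 (a b : axis -> R) :
  sum3 (fun i => a i * b i) ^+ 2 <= sum3 (fun i => a i ^+ 2) * sum3 (fun i => b i ^+ 2).
Proof.
rewrite /sum3 -subr_ge0.
rewrite (_ : _ - _ = (a ax1 * b ax2 - a ax2 * b ax1) ^+ 2 +
  (a ax1 * b ax3 - a ax3 * b ax1) ^+ 2 + (a ax2 * b ax3 - a ax3 * b ax2) ^+ 2); last by ring.
by rewrite !addr_ge0 ?sqr_ge0.
Qed.

(** On the support of the cutoff |x| is below r, so the factors r^-2 are absorbed by |x|^2 and,
    through Cauchy-Schwarz, by (x . grad U)^2. The constant is not sharp; what matters is that it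
    does not depend on [r]. *)
Lemma stress_bound (r : R) x : 0 < r -> `|stress DU r x| <= 12 * nrm2 DU x.
Proof.
move=> r0; have r20 : 0 < r ^+ 2 by rewrite exprn_gt0.
have N0 := nrm2_ge0 DU x.
have [h|h] := leP (r ^+ 2) (nsq x).
  rewrite /stress /cutf (cutw_out r0 h) !expr0n/= !(mulr0, mul0r, subr0, addr0) normr0.
  exact: mulr_ge0.
have w0 := cutw_ge0 r x; have w1 := cutw_le1 r x.
have c0 := cut_ge0 r x; have c1 := cut_le1 r x.
have s0 : 0 <= nsq x / r ^+ 2 by rewrite divr_ge0 ?nsq_ge0// ltW.
have s1 : nsq x / r ^+ 2 <= 1 by rewrite ler_pdivrMr// mul1r ltW.
have cs : sum3 (fun i => co i x * DU i x) ^+ 2 / r ^+ 2 <= nsq x / r ^+ 2 * nrm2 DU x.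
  rewrite [leRHS]mulrAC; apply: ler_wpM2r; first by rewrite invr_ge0 ltW.
  exact: cauchy_schwarz3.
have q0 : 0 <= sum3 (fun i => co i x * DU i x) ^+ 2 / r ^+ 2.
  by rewrite divr_ge0 ?sqr_ge0// ltW.
rewrite (_ : stress DU r x = 2^-1 * (3 * cutf r x - 6 * (nsq x / r ^+ 2) * cutw r x ^+ 2) * nrm2 DU x
  - cutf r x * nrm2 DU x
  + 6 * cutw r x ^+ 2 * (sum3 (fun i => co i x * DU i x) ^+ 2 / r ^+ 2)); last first.
  by rewrite /stress; field; rewrite gt_eqF.
have v0 : 0 <= cutw r x ^+ 2 by exact: sqr_ge0.
have v1 : cutw r x ^+ 2 <= 1 by rewrite exprn_ile1.
move: (cutw r x ^+ 2) (cutf r x) (nsq x / r ^+ 2) (nrm2 DU x)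
  (sum3 _ ^+ 2 / r ^+ 2) v0 v1 c0 c1 s0 s1 N0 cs q0 => v c s N q *.
have h1 : 0 <= c * N <= N by rewrite mulr_ge0//= ler_piMl.
have h2 : 0 <= s * N <= N by rewrite mulr_ge0//= ler_piMl.
have h3 : 0 <= s * v * N <= N.
  by rewrite !mulr_ge0//= ler_piMl// mulr_ile1.
have h4 : 0 <= v * q <= q by rewrite mulr_ge0//= ler_piMl.
rewrite ler_norml; apply/andP; split; lra.
Qed.

Let crho : continuous rho := continuous_source cDDU lapU.

Lemma continuous_stress r : continuous (stress DU r).
Proof.
have hc := @continuous_cut R r; have hn := continuous_nrm2 cDU.
have hco := @continuous_co R.
have hw := @continuous_cutw R r; have hs := @continuous_nsq R.
by rewrite /stress /sum3; cont.
Qed.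

Lemma integrable_stress r : 0 < r -> leb3.-integrable setT (EFin \o stress DU r).
Proof.
move=> r0; apply: (@integrable3 _ _ r); first exact: continuous_stress.
by move=> x rx; rewrite /stress /cutf (cutw_out' r0 rx) !expr0n/= !(mulr0, mul0r, subr0, addr0).
Qed.

Lemma virial_bound (r : R) : 0 < r ->
  `|\int[@leb3 R]_x (cutf r x * sum3 (fun i => co i x * DU i x) * rho x)| <=
  12 * \int[@leb3 R]_x nrm2 DU x.
Proof.
move=> r0; rewrite (stress_cut U' DU' cDU cDDU lapU r0).
apply: le_trans (le_normr_Rintegral measurableT (integrable_stress r0)) _.
rewrite -RintegralZl//; apply: le_Rintegral => //.
- by apply: integrable_norm; exact: integrable_stress.
- rewrite (_ : _ \o _ = (fun x => (12%:E * (EFin \o nrm2 DU) x)%E)).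
    exact: integrableZl.
  by apply/funext => x /=; rewrite EFinM.
- by move=> x _; exact: stress_bound.
Qed.

Lemma stress_cvg (c w z : nat -> R) (N q s : R) :
  c @ \oo --> (1 : R) -> w @ \oo --> (1 : R) -> z @ \oo --> (0 : R) ->
  (fun n => 2^-1 * (3 * c n - 6 * s * z n * (w n * w n)) * N - c n * N
     + 6 * z n * (w n * w n) * q) @ \oo -->
  (2^-1 * (3 * 1 - 6 * s * 0 * (1 * 1)) * N - 1 * N + 6 * 0 * (1 * 1) * q : R).
Proof.
move=> hc hw hz; have cs (a : R) : (fun _ : nat => a) @ \oo --> a by exact: cvg_cst.
have hww := cvg_seqM hw hw.
exact: (cvg_seqD (cvg_seqB (cvg_seqM (cvg_seqM (cs 2^-1) (cvg_seqB (cvg_seqM (cs 3) hc)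
  (cvg_seqM (cvg_seqM (cs (6 * s)) hz) hww))) (cs N)) (cvg_seqM hc (cs N)))
  (cvg_seqM (cvg_seqM (cvg_seqM (cs 6) hz) hww) (cs q))).
Qed.

(** Pointwise the terms with r^-2 vanish and the stress tends to 3/2 |grad U|^2 - |grad U|^2. The
    factor 1/2 is thus 3/2 - 1, where 3 is the dimension. *)
Lemma virial_limit :
  (fun n : nat => \int[@leb3 R]_x (cutf n.+1%:R x * sum3 (fun i => co i x * DU i x) * rho x))
  @ \oo --> 2^-1 * \int[@leb3 R]_x nrm2 DU x.
Proof.
rewrite (_ : (fun n : nat => _) = (fun n : nat => \int[@leb3 R]_x stress DU n.+1%:R x)); last first.
  by apply/funext => n; apply: (stress_cut U' DU' cDU cDDU lapU).
rewrite -RintegralZl//.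
apply: (@Rintegral_cvg R _ _ (@leb3 R) setT (fun n x => stress DU n.+1%:R x) _ (fun x => 12 * nrm2 DU x)) => //.
- by move=> n; apply: measurable_continuous3; exact: continuous_stress.
- move=> x _.
  rewrite (_ : 2^-1 * nrm2 DU x = 2^-1 * (3 * 1 - 6 * nsq x * 0 * (1 * 1)) * nrm2 DU x - 1 * nrm2 DU x
    + 6 * 0 * (1 * 1) * sum3 (fun i => co i x * DU i x) ^+ 2); last by field.
  have h0 : (fun n : nat => (n.+1%:R ^+ 2)^-1 : R) @ \oo --> (0 : R).
    have h := @cvg_harmonic R.
    rewrite (_ : (fun n => _) = (fun n => harmonic n * harmonic n :> R)); last first.
      by apply/funext => n /=; rewrite expr2 invfM.
    by rewrite -(mulr0 0); apply: cvgM.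
  have hw := @cvg_cutw R x; have hc := @cvg_cut R x.
  rewrite (_ : (fun n => stress DU n.+1%:R x) = (fun n =>
    2^-1 * (3 * cutf n.+1%:R x - 6 * nsq x * (n.+1%:R ^+ 2)^-1 * (cutw n.+1%:R x * cutw n.+1%:R x)) * nrm2 DU x
    - cutf n.+1%:R x * nrm2 DU x
    + 6 * (n.+1%:R ^+ 2)^-1 * (cutw n.+1%:R x * cutw n.+1%:R x) * sum3 (fun i => co i x * DU i x) ^+ 2)); last first.
    by apply/funext => n; rewrite /stress; ring.
  exact: stress_cvg.
- rewrite (_ : _ \o _ = (fun x => (12%:E * (EFin \o nrm2 DU) x)%E)).
    exact: integrableZl.
  by apply/funext => x /=; rewrite EFinM.
- by move=> n x _; exact: stress_bound.
Qed.

End virial.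

(** * Phase-space moments and the interaction integral *)

Section interaction.
Context {R : realType}.
Variables (f : phase R -> R) (K F : R).
Hypothesis cf : continuous f.
Hypothesis f0 : forall z, 0 <= f z.
Hypothesis fK : forall z, K < `|z| -> f z = 0.
Hypothesis F0 : 0 <= F.
Hypothesis fF : {ae leb6, forall z, f z <= F}.

Lemma integrable6 (g : phase R -> R) (L : R) : continuous g ->
  (forall x, L < `|x| -> g x = 0) -> leb6.-integrable setT (EFin \o g).
Proof. by move=> cg gK; exact: (lebesgue_like_integrableT lebesgue_like_leb6 cg gK). Qed.

Lemma fmoment (g : phase R -> R) : continuous g ->
  leb6.-integrable setT (EFin \o (fun z => g z * f z)).
Proof.
move=> cg; apply: (@integrable6 _ K); first by cont.
by move=> z /fK ->; rewrite mulr0.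
Qed.

Definition rho (x : vec3 R) : R := \int[@leb3 R]_p f (x, p).

Lemma rhoE x : (rho x)%:E = (\int[@leb3 R]_p (f (x, p))%:E)%E.
Proof.
rewrite /rho integrable_fin//.
apply: (@integrable3 _ _ K).
  by apply: (@contcomp _ _ _ (fun p => (x, p)) f); [exact: cf|cont].
by move=> p Kp; apply: fK; rewrite prod_normE/= lt_max Kp orbT.
Qed.

Lemma rho_ge0 x : 0 <= rho x.
Proof. by apply: Rintegral_ge0 => p _; exact: f0. Qed.

Lemma rho_out x : K < `|x| -> rho x = 0.
Proof.
move=> Kx; rewrite /rho; have -> : (fun p => f (x, p)) = (fun _ => 0).
  by apply/funext => p; apply: fK; rewrite prod_normE/= lt_max Kx.
by rewrite Rintegral_cst// mul0r.
Qed.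

Lemma measurable_f : measurable_fun [set: mphase R] f.
Proof. exact: measurable_continuous6. Qed.

Lemma measurable_EFin_f : measurable_fun [set: mphase R] (fun z => (f z)%:E).
Proof. by apply/measurable_EFinP; exact: measurable_f. Qed.

Lemma measurable_comp_fst (g : vec3 R -> \bar R) : measurable_fun [set: mvec R] g ->
  measurable_fun [set: mphase R] (fun z => g z.1).
Proof. by move=> mg; apply: (measurableT_comp mg); exact: measurable_fst. Qed.

Lemma measurable_comp_snd (g : vec3 R -> \bar R) : measurable_fun [set: mvec R] g ->
  measurable_fun [set: mphase R] (fun z => g z.2).
Proof. by move=> mg; apply: (measurableT_comp mg); exact: measurable_snd. Qed.

Lemma integral_rho (g : vec3 R -> \bar R) : measurable_fun [set: mvec R] g ->
  (forall x, (0 <= g x)%E) ->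
  (\int[@leb3 R]_x (g x * (rho x)%:E) = \int[@leb6 R]_z (g z.1 * (f z)%:E))%E.
Proof.
move=> mg g0.
have mgf : measurable_fun [set: mphase R] (fun z => (g z.1 * (f z)%:E)%E).
  by apply: emeasurable_funM; [exact: measurable_comp_fst|exact: measurable_EFin_f].
rewrite [RHS](fubini_tonelli1 (fun z : mphase R => (g z.1 * (f z)%:E)%E))//; last first.
  by move=> z; rewrite mule_ge0// lee_fin.
apply: eq_integral => x _; rewrite /fubini_F /= rhoE ge0_integralZl//.
- apply/measurable_EFinP; exact: (measurableT_comp measurable_f (pair1_measurable x)).
- by move=> p _; rewrite lee_fin.
Qed.

Lemma integral_product (g h : vec3 R -> \bar R) : measurable_fun [set: mvec R] g ->
  measurable_fun [set: mvec R] h ->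
  (forall x, (0 <= g x)%E) -> (forall x, (0 <= h x)%E) ->
  (\int[@leb6 R]_z (g z.1 * h z.2) = (\int[@leb3 R]_x g x) * (\int[@leb3 R]_p h p))%E.
Proof.
move=> mg mh g0 h0.
rewrite (fubini_tonelli1 (fun z : mphase R => (g z.1 * h z.2)%E))//; last 2 first.
- by apply: emeasurable_funM; [exact: measurable_comp_fst|exact: measurable_comp_snd].
- by move=> z; rewrite mule_ge0.
rewrite -ge0_integralZr//; last by apply: integral_ge0.
by apply: eq_integral => x _; rewrite /fubini_F /= ge0_integralZl.
Qed.

Definition massf : R := \int[@leb6 R]_z f z.
(** Twice the kinetic energy. *)
Definition kinf : R := \int[@leb6 R]_z (nsq z.2 * f z).

Lemma massfE : (massf%:E = \int[@leb6 R]_z (f z)%:E)%E.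
Proof. by rewrite /massf integrable_fin//; exact: (integrable6 cf fK). Qed.

(** Within distance [r] of [c], [f] is replaced by its bound [F], leaving the volume 8 a^3 of the
    momentum box times the integral of the kernel, at most 64 r. Farther away the kernel is at most
    r^-2 and the mass remains. The radius stays free, to be adapted to [a]. *)
Lemma inner_bound (c : vec3 R) (a r : R) : 0 <= a -> 0 < r ->
  (\int[@leb6 R]_z (f z * kern (c - z.1) * \1_(box 0 a) z.2)%R%:E <=
   (F * (8 * a ^+ 3) * (64 * r) + massf / r ^+ 2)%R%:E)%E.
Proof.
move=> a0 r0.
pose g := (fun x : vec3 R => (kern (c - x))%:E) \_ (box c r).
pose h (p : vec3 R) : \bar R := (\1_(box 0%R a) p)%R%:E.
have mg : measurable_fun [set: mvec R] g.
  apply/(measurable_restrictT _ _).1; first exact: measurable_box.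
  by apply/measurable_funTS/measurable_EFinP; exact: measurable_kern.
have mi : measurable_fun [set: mvec R] (\1_(box 0 a) : vec3 R -> R).
  by apply: measurable_indic; exact: measurable_box.
have mh : measurable_fun [set: mvec R] h by apply/measurable_EFinP.
have g0 x : (0 <= g x)%E.
  by rewrite /g patchE; case: ifP => // _; rewrite lee_fin kern_ge0.
have h0 p : (0 <= h p)%E by rewrite lee_fin.
have mgh : measurable_fun [set: mphase R] (fun z => (g z.1 * h z.2)%E).
  by apply: emeasurable_funM; [exact: measurable_comp_fst|exact: measurable_comp_snd].
have r20 : 0 < r ^+ 2 by rewrite exprn_gt0.
apply: (@le_trans _ _ (\int[@leb6 R]_z (F%:E * (g z.1 * h z.2) + (r ^+ 2)^-1%:E * (f z)%:E))%E).
  apply: ae_ge0_le_integral => //.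
  - by move=> z _; rewrite lee_fin !mulr_ge0// kern_ge0.
  - apply/measurable_EFinP; apply: measurable_funM; first apply: measurable_funM.
    + exact: measurable_f.
    + by apply: (measurableT_comp (measurable_kern c)); exact: measurable_fst.
    + by apply: (measurableT_comp mi); exact: measurable_snd.
  - move=> z _; apply: adde_ge0; first by rewrite mule_ge0// mule_ge0.
    by rewrite mule_ge0// lee_fin// invr_ge0 ltW.
  - apply: emeasurable_funD; apply: emeasurable_funM => //; try exact: measurable_cst.
    exact: measurable_EFin_f.
  (* The bound [F] comes from an essential supremum, so the integrands are compared off the
     exceptional null set. *)
  case: fF => N [mN N0 sN]; exists N; split => //.
  apply: subset_trans sN => z /= h1 h2; apply: h1 => _; move: h2 => fz.
  rewrite /g patchE; case: ifPn => [zb|zb].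
    rewrite -!EFinM -EFinD lee_fin -mulrA -[leLHS]addr0 lerD//.
      by rewrite ler_wpM2r// mulr_ge0// kern_ge0.
    by rewrite mulr_ge0// invr_ge0 ltW.
  rewrite mul0e mule0 add0e -EFinM lee_fin -mulrA mulrC ler_wpM2r//.
  have rz : r < `|c - z.1|.
    by move: zb => /negP; rewrite inE /box /= => /negP; rewrite -ltNge.
  apply: (@le_trans _ _ (kern (c - z.1))).
    by rewrite ler_piMr ?kern_ge0// indicE; case: (_ \in _).
  rewrite lef_pV2 ?posrE//.
    apply: le_trans (normr_nsq _); rewrite lerXn2r ?nnegrE ?ltW//.
    exact: lt_trans rz.
  apply: lt_le_trans (normr_nsq _); rewrite exprn_gt0//; exact: lt_trans rz.
rewrite ge0_integralD//; last 4 first.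
- by move=> z _; rewrite mule_ge0// mule_ge0.
- by apply: emeasurable_funM.
- by move=> z _; rewrite mule_ge0// lee_fin// invr_ge0 ltW.
- by apply: emeasurable_funM => //; exact: measurable_EFin_f.
rewrite EFinD; apply: leeD; last first.
  rewrite ge0_integralZl_EFin//; last 3 first.
  - by move=> z _; rewrite lee_fin.
  - exact: measurable_EFin_f.
  - by rewrite invr_ge0 ltW.
  by rewrite -massfE -EFinM mulrC.
rewrite ge0_integralZl_EFin//; last by move=> z _; rewrite mule_ge0.
rewrite integral_product// -(mulrA F) [X in (_ <= X)%E]EFinM; apply: lee_wpmul2l => //.
rewrite [X in (_ <= X)%E]EFinM muleC; apply: lee_pmul => //.
- exact: integral_ge0.
- exact: integral_ge0.
- rewrite /h integral_indic ?setIT//; last exact: measurable_box.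
  by rewrite [leLHS](leb3_box 0 a0).
- by rewrite /g -integral_mkcond; exact: integral_kern_box.
Qed.

End interaction.

Section pair_interaction.
Context {R : realType}.
Variables (f : phase R -> R) (K F : R).
Hypothesis cf : continuous f.
Hypothesis f0 : forall z, 0 <= f z.
Hypothesis fK : forall z, K < `|z| -> f z = 0.
Hypothesis F0 : 0 <= F.
Hypothesis fF : {ae leb6, forall z, f z <= F}.

Lemma lebesgue_like_leb12 : lebesgue_like (id : (mphase R * mphase R)%type -> phase R * phase R) (@leb6 R \x @leb6 R)%E.
Proof. by apply: lebesgue_like_ext (lebesgue_like_prod lebesgue_like_leb6 lebesgue_like_leb6) _ => -[]. Qed.

Lemma lebesgue_like_leb9 : lebesgue_like (id : (mvec R * mphase R)%type -> vec3 R * phase R) (@leb3 R \x @leb6 R)%E.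
Proof. by apply: lebesgue_like_ext (lebesgue_like_prod lebesgue_like_leb3 lebesgue_like_leb6) _ => -[]. Qed.

Variables M kin : R.
Hypothesis massM : massf f = M.
Hypothesis kinE : kinf f = kin.

(* By symmetry only the pairs with |p'| <= |p| have to be estimated. *)
Definition slow_pairs (h : vec3 R) (w : phase R * phase R) : R :=
  f w.1 * (f w.2 * kern (w.1.1 + h - w.2.1) * \1_(box 0 `|w.1.2|) w.2.2).

Lemma slow_pairs_ge0 h w : 0 <= slow_pairs h w.
Proof. by rewrite /slow_pairs mulr_ge0// mulr_ge0// mulr_ge0// kern_ge0. Qed.

Lemma measurable_slow_pairs h : measurable_fun [set: (mphase R * mphase R)%type] (slow_pairs h).
Proof.
have cn := @continuous_nsq R.
have mc (g : phase R * phase R -> R) : continuous g ->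
    measurable_fun [set: (mphase R * mphase R)%type] g.
  exact: lebesgue_like_measurable lebesgue_like_leb12 g.
rewrite /slow_pairs; apply: measurable_funM; first by apply: (mc (fun w => f w.1)); cont.
apply: measurable_funM; first apply: measurable_funM.
- by apply: (mc (fun w => f w.2)); cont.
- by apply: measurable_inv; apply: (mc (fun w => nsq (w.1.1 + h - w.2.1))); cont.
- rewrite (_ : (fun w => _) = \1_[set w : phase R * phase R | `|w.2.2| <= `|w.1.2|]); last first.
    apply/funext => w; rewrite !indicE; congr (_ %:R); congr nat_of_bool.
    by apply/idP/idP; rewrite !inE /box /= sub0r normrN.
  apply: measurable_indic.
  have := @measurable_fun_ler _ (mphase R * mphase R)%type R setT
    (fun w => `|w.2.2 : vec3 R|) (fun w => `|w.1.2 : vec3 R|).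
  have m1 : measurable_fun [set: (mphase R * mphase R)%type] (fun w => `|w.2.2 : vec3 R|).
    apply: (mc (fun w => `|w.2.2|)).
    by apply: (@contcomp _ _ _ (fun w : phase R * phase R => w.2.2) (fun v => `|v|)); [exact: norm_continuous|cont].
  have m2 : measurable_fun [set: (mphase R * mphase R)%type] (fun w => `|w.1.2 : vec3 R|).
    apply: (mc (fun w => `|w.1.2|)).
    by apply: (@contcomp _ _ _ (fun w : phase R * phase R => w.1.2) (fun v => `|v|)); [exact: norm_continuous|cont].
  move=> /(_ m1 m2) /(_ measurableT [set true] I).
  by rewrite setTI.
Qed.

Lemma massf_ge0 : 0 <= M.
Proof. by rewrite -massM; apply: Rintegral_ge0 => z _. Qed.

(** With a = |p| and radius 1/(1 + a), [inner_bound] gives 512 F a^3 / (1 + a) + M (1 + a)^2, where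
    512 = 8 * 64. Both terms are controlled by (1 + a)^2 <= 2 (1 + a^2), the source of the factor 2;
    this quadratic growth is what the kinetic energy can pay for. *)
Definition Cint : R := 2 * (512 * F + M).

Lemma Cint_ge0 : 0 <= M -> 0 <= Cint.
Proof.
move=> M0; rewrite /Cint.
have h512 : 0 <= 512 :> R by exact: ler0n.
have h1 : 0 <= 512 * F by exact: mulr_ge0.
have h2 : 0 <= 512 * F + M by exact: addr_ge0.
exact: mulr_ge0.
Qed.

(* For fixed (x, p), split the (y, p') integral at distance 1/(1 + |p|): inside,
   f <= F and p' ranges over a box of side 2|p|; outside, the kernel is at most
   (1 + |p|)^2. *)
Lemma slow_pairs_bound h :
  (\int[@leb6 R]_z \int[@leb6 R]_z' (slow_pairs h (z, z'))%:E <= (Cint * (M + kin))%:E)%E.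
Proof.
have M0 := massf_ge0.
have C0 := Cint_ge0 M0.
apply: (@le_trans _ _ (\int[@leb6 R]_z (Cint * (f z + nsq z.2 * f z))%R%:E)%E).
  apply: ge0_le_integral => //.
  - by move=> z _; apply: integral_ge0 => z' _; rewrite lee_fin slow_pairs_ge0.
  - apply: (measurable_fun_fubini_tonelli_F (m2 := leb6) (fun w : mphase R * mphase R => (slow_pairs h w)%:E)).
      by apply/measurable_EFinP; exact: measurable_slow_pairs.
    by move=> w; rewrite lee_fin slow_pairs_ge0.
  - apply/measurable_EFinP; apply: (@measurable_continuous6 _ (fun z => Cint * (f z + nsq z.2 * f z))).
    by have cn := @continuous_nsq R; cont.
  move=> z _; rewrite /slow_pairs /=; under eq_integral do rewrite EFinM.
  have a0 : 0 <= `|z.2| by [].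
  have a1 : 0 < 1 + `|z.2| by rewrite ltr_pwDl.
  have r0 : 0 < (1 + `|z.2|)^-1 by rewrite invr_gt0.
  have B := inner_bound cf f0 fK F0 fF (z.1 + h) a0 r0; rewrite massM in B.
  rewrite ge0_integralZl_EFin//; last 2 first.
  - by move=> z' _; rewrite lee_fin mulr_ge0// mulr_ge0// kern_ge0.
  - apply/measurable_EFinP; apply: measurable_funM; first apply: measurable_funM.
    + exact: measurable_f.
    + by apply: (measurableT_comp (measurable_kern (z.1 + h))); exact: measurable_fst.
    + have mi : measurable_fun [set: mvec R] (\1_(box 0 `|z.2|) : vec3 R -> R).
        by apply: measurable_indic; exact: measurable_box.
      by apply: (measurableT_comp mi); exact: measurable_snd.
  apply: (le_trans (lee_wpmul2l _ B)); first by rewrite lee_fin.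
  rewrite -EFinM lee_fin.
  rewrite (_ : Cint * _ = f z * (Cint * (1 + nsq z.2))); last by ring.
  rewrite ler_wpM2l//.
  have n2 := normr_nsq z.2.
  rewrite /Cint exprVn invrK.
  move: n2; move: (nsq z.2) => N.
  move: `|z.2| a0 a1 r0 => a a0 a1 r0 n2.
  have q : a ^+ 3 / (1 + a) <= (1 + a) ^+ 2.
    by rewrite ler_pdivrMr// -exprSr lerXn2r ?nnegrE ?addr_ge0// lerDr.
  have p : (1 + a) ^+ 2 <= 2 * (1 + N) by have := sqr_ge0 (1 - a); nra.
  have qF := ler_wpM2l F0 (le_trans q p).
  have pM := ler_wpM2l M0 p.
  rewrite (_ : F * _ * _ = 512 * (F * (a ^+ 3 / (1 + a)))); last by ring.
  rewrite (_ : 2 * _ * _ = 512 * (F * (2 * (1 + N))) + M * (2 * (1 + N))); last by ring.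
  by apply: lerD pM; apply: ler_wpM2l qF; exact: ler0n.
have cn := @continuous_nsq R.
have i1 : leb6.-integrable setT (EFin \o (fun z => nsq z.2 * f z)).
  by apply: (fmoment cf fK); cont.
have i0 := integrable6 cf fK.
have i01 : leb6.-integrable setT (EFin \o (fun z => f z + nsq z.2 * f z)).
  apply: (@integrable6 _ _ K); first by cont.
  by move=> z /fK ->; rewrite mulr0 addr0.
rewrite integrable_fin//; last first.
  apply: (@integrable6 _ _ K); first by cont.
  by move=> z /fK ->; rewrite mulr0 addr0 mulr0.
by rewrite RintegralZl// RintegralD// -massM -kinE.
Qed.

(** The convolution of |.|^-2 with the density, evaluated at [x + h]. The shift is there for the
    difference quotients of the potential. *)
Definition Phi (h x : vec3 R) : \bar R :=
  (\int[@leb6 R]_z (kern (x + h - z.1) * f z)%R%:E)%E.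

Lemma measurable_Phi h : measurable_fun [set: mvec R] (Phi h).
Proof.
apply: (measurable_fun_fubini_tonelli_F (m2 := leb6) (fun w : mvec R * mphase R => (kern (w.1 + h - w.2.1) * f w.2)%R%:E)).
  have cn := @continuous_nsq R.
  have mc (g : vec3 R * phase R -> R) : continuous g ->
      measurable_fun [set: (mvec R * mphase R)%type] g.
    exact: lebesgue_like_measurable lebesgue_like_leb9 g.
  apply/measurable_EFinP; apply: measurable_funM.
    by apply: measurable_inv; apply: (mc (fun w => nsq (w.1 + h - w.2.1))); cont.
  by apply: (mc (fun w => f w.2)); cont.
by move=> w; rewrite lee_fin mulr_ge0// kern_ge0.
Qed.

Lemma Phi_ge0 h x : (0 <= Phi h x)%E.
Proof. by apply: integral_ge0 => z _; rewrite lee_fin mulr_ge0// kern_ge0. Qed.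

(** In every pair one of the two momenta is at most the other, so the integrand is bounded by
    [slow_pairs h (z, z')] plus [slow_pairs (- h) (z', z)]: exchanging the particles reverses the
    shift, as [kern] is even. Tonelli reduces the second term to the first, whence the factor 2. *)
Lemma interaction h :
  (\int[@leb3 R]_x (Phi h x * (rho f x)%:E) <= (2 * Cint * (M + kin))%:E)%E.
Proof.
rewrite (integral_rho cf f0 fK (measurable_Phi h) (Phi_ge0 h)).
have mh k : measurable_fun [set: (mphase R * mphase R)%type] (fun w => (slow_pairs k w)%:E).
  by apply/measurable_EFinP; exact: measurable_slow_pairs.
have h0 k w : (0 <= (slow_pairs k w)%:E)%E by rewrite lee_fin slow_pairs_ge0.
have ms : measurable_fun [set: (mphase R * mphase R)%type] (fun w => (slow_pairs (- h) (w.2, w.1))%:E).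
  apply: (measurableT_comp (mh (- h))).
  apply/measurable_fun_pairP; split; [exact: measurable_snd|exact: measurable_fst].
apply: (@le_trans _ _ (\int[@leb6 R]_z (\int[@leb6 R]_z' (slow_pairs h (z, z'))%:E + \int[@leb6 R]_z' (slow_pairs (- h) (z', z))%:E))%E).
  apply: ge0_le_integral => //.
  - by move=> z _; rewrite mule_ge0// ?Phi_ge0// lee_fin.
  - apply: emeasurable_funM; last exact: measurable_EFin_f.
    by apply: (measurable_comp_fst); exact: measurable_Phi.
  - apply: emeasurable_funD.
      exact: (measurable_fun_fubini_tonelli_F (m2 := leb6) (fun w : mphase R * mphase R => (slow_pairs h w)%:E)).
    exact: (measurable_fun_fubini_tonelli_F (m2 := leb6) (fun w : mphase R * mphase R => (slow_pairs (- h) (w.2, w.1))%:E)).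
  move=> z _.
  have mh1 k : measurable_fun [set: mphase R] (fun z' => (slow_pairs k (z, z'))%:E).
    exact: (measurableT_comp (mh k) (pair1_measurable z)).
  have mh2 k : measurable_fun [set: mphase R] (fun z' => (slow_pairs k (z', z))%:E).
    exact: (measurableT_comp (mh k) (pair2_measurable z)).
  rewrite -ge0_integralD// /Phi muleC -ge0_integralZl_EFin//; last 2 first.
  - by move=> z' _; rewrite lee_fin mulr_ge0// kern_ge0.
  - apply/measurable_EFinP; apply: measurable_funM; last exact: measurable_f.
    by apply: (measurableT_comp (measurable_kern (z.1 + h))); exact: measurable_fst.
  apply: ge0_le_integral => //.
  - by move=> z' _; rewrite mule_ge0// lee_fin// mulr_ge0// kern_ge0.
  - apply: emeasurable_funM => //.
    apply/measurable_EFinP; apply: measurable_funM; last exact: measurable_f.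
    by apply: (measurableT_comp (measurable_kern (z.1 + h))); exact: measurable_fst.
  - by apply: emeasurable_funD.
  move=> z' _; rewrite -EFinM -EFinD lee_fin /slow_pairs /= (mulrC (kern _)).
  have -> : kern (z'.1 - h - z.1) = kern (z.1 + h - z'.1).
    by rewrite -kernN; congr kern; rewrite !opprB addrA.
  rewrite (_ : _ + _ = f z * (f z' * kern (z.1 + h - z'.1)) *
     (\1_(box 0 `|z.2|) z'.2 + \1_(box 0 `|z'.2|) z.2)); last by ring.
  rewrite ler_peMr//; first by rewrite !mulr_ge0// kern_ge0.
  have [le|/ltW le] := leP `|z.2| `|z'.2|.
    by rewrite addrC [in X in X + _]indicE mem_set /box /= ?sub0r ?normrN// lerDl.
  by rewrite [in X in X + _]indicE mem_set /box /= ?sub0r ?normrN// lerDl.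
rewrite ge0_integralD//; last 4 first.
- by move=> z _; apply: integral_ge0.
- exact: (measurable_fun_fubini_tonelli_F (m2 := leb6) (fun w : mphase R * mphase R => (slow_pairs h w)%:E)).
- by move=> z _; apply: integral_ge0.
- exact: (measurable_fun_fubini_tonelli_F (m2 := leb6) (fun w : mphase R * mphase R => (slow_pairs (- h) (w.2, w.1))%:E)).
rewrite (_ : 2 * _ * _ = Cint * (M + kin) + Cint * (M + kin)); last by ring.
rewrite EFinD; apply: leeD; first exact: slow_pairs_bound.
apply: (@le_trans _ _ (\int[@leb6 R]_z' \int[@leb6 R]_z (slow_pairs (- h) (z', z))%:E)%E); last exact: slow_pairs_bound.
rewrite le_eqVlt; apply/orP; left; apply/eqP.
exact: (fubini_tonelli (m1 := leb6) (m2 := leb6) (fun w : mphase R * mphase R => (slow_pairs (- h) (w.2, w.1))%:E)).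
Qed.

End pair_interaction.

(** * The Newtonian kernel 1/|w| *)

Section newtonian.
Context {R : realType}.
Implicit Types (x y w c : vec3 R).

Definition newt w : R := (enorm w)^-1.

Lemma enormE w : enorm w = Num.sqrt (nsq w).
Proof. by rewrite /enorm /dot /nsq /sum3 /= !expr2. Qed.

Lemma enorm_sqr w : enorm w ^+ 2 = nsq w.
Proof. by rewrite enormE sqr_sqrtr// nsq_ge0. Qed.

Lemma newt_ge0 w : 0 <= newt w.
Proof. by rewrite invr_ge0 sqrtr_ge0. Qed.

Lemma newt_sqr w : newt w ^+ 2 = kern w.
Proof. by rewrite /newt exprVn enorm_sqr. Qed.

Lemma continuous_enorm : continuous (@enorm R).
Proof.
rewrite (_ : @enorm R = fun w => Num.sqrt (nsq w)); last by apply/funext => w; rewrite enormE.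
by apply: (@contcomp _ _ _ (@nsq R) Num.sqrt); [exact: sqrt_continuous|exact: continuous_nsq].
Qed.

Lemma measurable_newt c : measurable_fun [set: mvec R] (fun y => newt (c - y)).
Proof.
apply: measurable_inv; apply: (@measurable_continuous3 _ (fun y => enorm (c - y))).
by have h := continuous_enorm; cont.
Qed.

(** Young's inequality t <= e t^2 + 1/(4e), from the square (2 e t - 1)^2. *)
Lemma newt_le (e : R) w : 0 < e -> newt w <= e * kern w + (4 * e)^-1.
Proof.
move=> e0; rewrite -newt_sqr; move: (newt w) => t.
rewrite -subr_ge0 (_ : _ - _ = (2 * e * t - 1) ^+ 2 / (4 * e)).
  by rewrite divr_ge0 ?sqr_ge0// mulr_ge0// ltW.
by field; rewrite gt_eqF.
Qed.

Lemma nsq_eq0 w : nsq w = 0 -> w = 0.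
Proof.
move=> h; have := normr_nsq w; rewrite h => h'.
apply/eqP; rewrite -normr_eq0 -sqrf_eq0; apply/eqP/le_anti.
by rewrite h' sqr_ge0.
Qed.

(* The tangent of the convex function s |-> s^(-1/2) at s = L^2. *)
Lemma newt_tangent (L : R) w : 0 < L -> w != 0 ->
  3 / (2 * L) <= newt w + (2 * L ^+ 3)^-1 * nsq w.
Proof.
move=> L0 w0.
have n0 : 0 < nsq w.
  by rewrite lt_neqAle nsq_ge0 andbT eq_sym; apply: contra_neq w0 => /nsq_eq0.
have d0 : 0 < enorm w by rewrite enormE sqrtr_gt0.
rewrite -enorm_sqr /newt; move: (enorm w) d0 => d d0.
rewrite -subr_ge0 (_ : _ - _ = (L - d) ^+ 2 * (2 * L + d) / (2 * L ^+ 3 * d)).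
  apply: divr_ge0; apply: mulr_ge0; rewrite ?sqr_ge0 ?(ltW d0)//.
    by rewrite addr_ge0 ?(ltW d0)// mulr_ge0// ltW.
  by rewrite mulr_ge0// exprn_ge0// ltW.
by field; rewrite !gt_eqF.
Qed.

Lemma enorm_triangle (x v : vec3 R) : `|enorm (x + v) - enorm x| <= enorm v.
Proof.
have cs := @cauchy_schwarz3 R (fun i => co i x) (fun i => co i (x + v)).
have a0 : 0 <= enorm (x + v) by rewrite sqrtr_ge0.
have b0 : 0 <= enorm x by rewrite sqrtr_ge0.
have c0 : 0 <= enorm v by rewrite sqrtr_ge0.
have ea := enorm_sqr (x + v); have eb := enorm_sqr x; have ec := enorm_sqr v.
rewrite -[sum3 (fun i => co i x ^+ 2)]/(nsq x) -[sum3 (fun i => co i (x + v) ^+ 2)]/(nsq (x + v)) in cs.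
set p := sum3 _ in cs.
have ev : nsq v = nsq x + nsq (x + v) - 2 * p.
  by rewrite /p /nsq /sum3 /=; ring.
rewrite -ler_sqr ?nnegrE ?normr_ge0// real_normK ?num_real//.
have pab : p <= enorm x * enorm (x + v).
  rewrite (le_trans (ler_norm _))// -ler_sqr ?nnegrE ?mulr_ge0//.
  by rewrite real_normK ?num_real// exprMn eb ea.
rewrite sqrrB ea eb ec ev; move: pab; rewrite (mulrC (enorm x)).
move: (enorm (x + v) * enorm x) => q; rewrite -mulr_natl; lra.
Qed.

(** For nonzero lengths a and b, 1/a - 1/b = (b - a)/(ab), where |b - a| <= s and 1/(ab) <= 1/a^2 +
    1/b^2. If one length is 0 its inverse is 0 by convention; the other length b is then at most s,
    so 1/b <= s/b^2. *)
Lemma newt_diff (x v : vec3 R) (s : R) : 0 < s -> enorm v = s ->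
  `|newt (x + v) - newt x| <= s * (kern (x + v) + kern x).
Proof.
move=> s0 vs; rewrite -!newt_sqr /newt.
have t := enorm_triangle x v; rewrite vs in t.
have a0 : 0 <= enorm (x + v) by rewrite sqrtr_ge0.
have b0 : 0 <= enorm x by rewrite sqrtr_ge0.
move: (enorm (x + v)) (enorm x) a0 b0 t => a b.
rewrite le_eqVlt => /predU1P[<-|a0]; rewrite le_eqVlt => /predU1P[<-|b0].
- by rewrite !invr0 subr0 normr0 expr0n/= addr0 mulr0.
- rewrite sub0r normrN gtr0_norm// => bs.
  rewrite !invr0 sub0r normrN expr0n/= add0r gtr0_norm ?invr_gt0//.
  by rewrite expr2 mulrA; apply: ler_peMl; [rewrite invr_ge0 ltW|rewrite ler_pdivlMr// mul1r].
- rewrite subr0 gtr0_norm// => bs.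
  rewrite !invr0 subr0 expr0n/= addr0 gtr0_norm ?invr_gt0//.
  by rewrite expr2 mulrA; apply: ler_peMl; [rewrite invr_ge0 ltW|rewrite ler_pdivlMr// mul1r].
- move=> t.
  have -> : a^-1 - b^-1 = (b - a) * (a^-1 * b^-1) by field; rewrite !gt_eqF.
  have ai : 0 < a^-1 by rewrite invr_gt0. have bi : 0 < b^-1 by rewrite invr_gt0.
  rewrite normrM (gtr0_norm (mulr_gt0 ai bi)) distrC.
  apply: ler_pM => //; first by rewrite mulr_ge0 ?ltW.
  by move: (a^-1) (b^-1) ai bi => u v' ? ?; nra.
Qed.

End newtonian.

(** * Newtonian potential and force at a fixed time *)

Section fixed_time.
Context {R : realType}.
Variables (f : phase R -> R) (K F : R).
Hypothesis cf : continuous f.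
Hypothesis f0 : forall z, 0 <= f z.
Hypothesis fK : forall z, K < `|z| -> f z = 0.
Hypothesis F0 : 0 <= F.
Hypothesis fF : {ae leb6, forall z, f z <= F}.
Variables M kin : R.
Hypothesis massM : massf f = M.
Hypothesis kinE : kinf f = kin.

Lemma measurable_kernf c :
  measurable_fun [set: mphase R] (fun z => (kern (c - z.1) * f z)%:E).
Proof.
apply/measurable_EFinP; apply: measurable_funM; last exact: measurable_f.
by apply: (measurableT_comp (measurable_kern c)); exact: measurable_fst.
Qed.

Lemma measurable_newtf c :
  measurable_fun [set: mphase R] (fun z => (newt (c - z.1) * f z)%:E).
Proof.
apply/measurable_EFinP; apply: measurable_funM; last exact: measurable_f.
by apply: (measurableT_comp (measurable_newt c)); exact: measurable_fst.
Qed.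

Lemma kernf_ge0 c z : (0 <= (kern (c - z.1) * f z)%:E)%E.
Proof. by rewrite lee_fin mulr_ge0// kern_ge0. Qed.

Lemma newtf_ge0 c z : (0 <= (newt (c - z.1) * f z)%:E)%E.
Proof. by rewrite lee_fin mulr_ge0// newt_ge0. Qed.

(** The momenta in the support lie in the box of radius |K|, so [inner_bound] applies with that box
    and radius 1. The absolute value covers a negative [K]. *)
Lemma Phi_fin h x : (Phi f h x < +oo)%E.
Proof.
have a0 : 0 <= `|K| by [].
apply: le_lt_trans (ltry _).
apply: le_trans (inner_bound cf f0 fK F0 fF (x + h) a0 ltr01).
rewrite /Phi le_eqVlt; apply/orP; left; apply/eqP; apply: eq_integral => z _.
congr EFin; rewrite mulrC; have [zK|zK] := leP `|z| K.
  rewrite indicE mem_set ?mulr1// /box /= sub0r normrN.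
  rewrite (le_trans _ (ler_norm K))// (le_trans _ zK)//.
  by rewrite [leRHS]prod_normE le_max lexx orbT.
by rewrite fK// !mul0r.
Qed.

Lemma Phi0E x : Phi f 0%R x = (\int[@leb6 R]_z (kern (x - z.1) * f z)%:E)%E.
Proof. by rewrite /Phi; apply: eq_integral => z _; rewrite addr0. Qed.

(** The potential multiplied by - 4 pi and written over phase space, extended-real valued so that it
    can be estimated before integrability is known. *)
Definition Psi x : \bar R := (\int[@leb6 R]_z (newt (x - z.1) * f z)%:E)%E.

Lemma mass_ge0 : 0 <= M.
Proof. by rewrite -massM; exact: Rintegral_ge0. Qed.

Lemma Psi_le (e : R) x : 0 < e -> (Psi x <= e%:E * Phi f 0%R x + (M / (4 * e))%:E)%E.
Proof.
move=> e0; rewrite Phi0E.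
have e4 : 0 <= (4 * e)^-1 by rewrite invr_ge0 mulr_ge0// ltW.
apply: (@le_trans _ _ (\int[@leb6 R]_z (e%:E * (kern (x - z.1) * f z)%:E + (4 * e)^-1%:E * (f z)%:E))%E).
  apply: ge0_le_integral => //.
  - by move=> z _; exact: newtf_ge0.
  - exact: measurable_newtf.
  - apply: emeasurable_funD; apply: emeasurable_funM => //.
      exact: measurable_kernf.
    exact: measurable_EFin_f.
  move=> z _; rewrite -!EFinM -EFinD lee_fin mulrA -mulrDl.
  by rewrite ler_wpM2r// newt_le.
rewrite ge0_integralD//; first last.
- by apply: emeasurable_funM => //; exact: measurable_EFin_f.
- by move=> z _; rewrite mule_ge0// lee_fin.
- by apply: emeasurable_funM => //; exact: measurable_kernf.
- by move=> z _; rewrite mule_ge0 ?kernf_ge0// lee_fin ltW.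
rewrite ge0_integralZl_EFin//; first last.
- exact: ltW.
- exact: measurable_kernf.
- by move=> z _; exact: kernf_ge0.
rewrite ge0_integralZl_EFin//; first last.
- exact: measurable_EFin_f.
- by move=> z _; rewrite lee_fin.
by rewrite -(massfE cf fK) massM -EFinM (mulrC M).
Qed.

Lemma Psi_fin x : (Psi x < +oo)%E.
Proof.
apply: le_lt_trans (Psi_le x ltr01) _.
by rewrite mul1e lte_add_pinfty ?Phi_fin ?ltry.
Qed.

Lemma integrable_newtf c : leb6.-integrable setT (EFin \o (fun z => newt (c - z.1) * f z)).
Proof.
apply/integrableP; split; first exact: measurable_newtf.
apply: le_lt_trans (Psi_fin c).
rewrite le_eqVlt; apply/orP; left; apply/eqP; apply: eq_integral => z _.
by rewrite gee0_abs// newtf_ge0.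
Qed.

Lemma PsiE x : Psi x = (\int[@leb6 R]_z (newt (x - z.1) * f z))%:E.
Proof. by rewrite /Psi integrable_fin//; exact: integrable_newtf. Qed.

Variables (U : vec3 R -> R) (DU : axis -> vec3 R -> R)
  (DDU : axis -> axis -> vec3 R -> R).
Hypothesis U' : forall i x, is_derive x (ax i) U (DU i x).
Hypothesis DU' : forall i j x, is_derive x (ax j) (DU i) (DDU i j x).
Hypothesis cU : continuous U.
Hypothesis cDU : forall i, continuous (DU i).
Hypothesis cDDU : forall i j, continuous (DDU i j).
Hypothesis lapU : forall x, sum3 (fun i => DDU i i x) = rho f x.
Hypothesis UE : forall x, U x = - (4 * pi)^-1 * \int[@leb3 R]_y (rho f y / enorm (x - y)).

Lemma UPsi x : U x = - (4 * pi)^-1 * \int[@leb6 R]_z (newt (x - z.1) * f z).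
Proof.
have E : (\int[@leb3 R]_y (rho f y / enorm (x - y))%:E)%E = Psi x.
  rewrite /Psi -(integral_rho cf f0 fK (g := fun y => (newt (x - y))%:E)).
  - by apply: eq_integral => y _; rewrite mulrC EFinM.
  - by apply/measurable_EFinP; exact: measurable_newt.
  - by move=> y; rewrite lee_fin newt_ge0.
by rewrite UE /Rintegral E PsiE.
Qed.

Lemma pi4_ge1 : 1 <= 4 * pi :> R.
Proof. by have := @pi_ge2 R; lra. Qed.

(** This is [newt_diff] integrated against [f]; the factor (4 pi)^-1 is at most 1 and is given
    away. *)
Lemma potential_diff x v (s : R) : 0 < s -> enorm v = s ->
  (`|U (x + v) - U x|%:E <= s%:E * (Phi f v x + Phi f 0%R x))%E.
Proof.
move=> s0 vs.
have p0 : 0 < 4 * pi :> R by apply: lt_le_trans pi4_ge1.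
rewrite !UPsi -mulrBr normrM normrN (_ : `|(4 * pi)^-1| = (4 * pi)^-1 :> R); last first.
  by rewrite gtr0_norm ?invr_gt0.
apply: (@le_trans _ _ (`|\int[@leb6 R]_z (newt (x + v - z.1) * f z) - \int[@leb6 R]_z (newt (x - z.1) * f z)|%:E)%E).
  by rewrite lee_fin ler_piMl// invf_le1// pi4_ge1.
rewrite -RintegralB//; [|exact: integrable_newtf|exact: integrable_newtf].
have im : leb6.-integrable setT (EFin \o (fun z => newt (x + v - z.1) * f z - newt (x - z.1) * f z)).
  have := integrableB measurableT (integrable_newtf (x + v)) (integrable_newtf x).
  by apply: eq_integrable.
rewrite EFin_normr_Rintegral//.
apply: (le_trans (le_abse_integral leb6 measurableT (measurable_int _ im))).
rewrite Phi0E /Phi -ge0_integralD//; first last.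
- exact: measurable_kernf.
- by move=> z _; exact: kernf_ge0.
- exact: measurable_kernf.
- by move=> z _; exact: kernf_ge0.
have mk : measurable_fun [set: mphase R] (fun z => ((kern (x + v - z.1) * f z)%:E + (kern (x - z.1) * f z)%:E)%E).
  by apply: emeasurable_funD; exact: measurable_kernf.
rewrite -ge0_integralZl_EFin//; first last.
- exact: ltW.
- by move=> z _; rewrite adde_ge0 ?kernf_ge0.
apply: ge0_le_integral => //.
- exact: (measurableT_comp (@abse_measurable R setT) (measurable_int _ im)).
- by apply: emeasurable_funM.
move=> z _ /=; rewrite -EFinD -EFinM lee_fin -mulrBl -mulrDl mulrA normrM (ger0_norm (f0 z)).
rewrite ler_wpM2r// (_ : x + v - z.1 = x - z.1 + v); last by rewrite addrAC.
exact: newt_diff.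
Qed.

Lemma enorm_ax i (s : R) : 0 <= s -> enorm (s *: ax i) = s.
Proof.
move=> s0; rewrite enormE (_ : nsq _ = s ^+ 2) ?sqrtr_sqr ?ger0_norm//.
by rewrite /nsq /sum3; case: i => /=; rewrite /ax /e1 /e2 /e3 /=;
  rewrite /GRing.scale /=; ring.
Qed.

(* The difference quotients of U are dominated by two copies of the interaction
   integral, one of them shifted; Fatou's lemma passes to the derivative. *)
Lemma force_bound i :
  (\int[@leb3 R]_x (`|DU i x| * rho f x)%:E <= (4 * Cint F M * (M + kin))%:E)%E.
Proof.
have crho : continuous (rho f) := continuous_source cDDU lapU.
pose s (n : nat) : R := n.+1%:R^-1.
have s0 n : 0 < s n by rewrite invr_gt0.
pose D n x : R := `|(s n)^-1 * (U (x + s n *: ax i) - U x)|.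
have cD n : continuous (D n).
  rewrite /D; cont.
have Dlim x : (fun n => D n x) @ \oo --> `|DU i x|.
  apply: cvg_norm; have [dU <-] := U' i x.
  have : s n @[n --> \oo] --> (0 : R)^'.
    move=> P nP.
    have H : \forall n \near \oo, (s n != 0 -> P (s n)) := @cvg_harmonic R _ nP.
    have : \forall n \near \oo, P (s n).
      by apply: filterS H => n; apply; exact: lt0r_neq0 (s0 n).
    exact.
  move=> hs; have := cvg_comp _ _ hs dU.
  apply: cvg_trans; apply: near_eq_cvg; near=> n => /=.
  by rewrite (addrC x).
pose g n x := (D n x * rho f x)%:E.
have D0 n x : 0 <= D n x by exact: normr_ge0.
have g0 n x : (0 <= g n x)%E by rewrite lee_fin; apply: mulr_ge0 => //; exact: rho_ge0.
have mg n : measurable_fun [set: mvec R] (g n).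
  apply/measurable_EFinP; apply: (@measurable_continuous3 _ (fun x => D n x * rho f x)).
  by have h := cD n; cont.
have gB n : (\int[@leb3 R]_x g n x <= (4 * Cint F M * (M + kin))%:E)%E.
  apply: (@le_trans _ _ (\int[@leb3 R]_x (Phi f (s n *: ax i) x * (rho f x)%:E + Phi f 0%R x * (rho f x)%:E))%E).
    apply: ge0_le_integral => //.
    - apply: emeasurable_funD; apply: emeasurable_funM; try exact: measurable_Phi;
        apply/measurable_EFinP; exact: measurable_continuous3.
    move=> x _; rewrite -ge0_muleDl ?Phi_ge0// /g EFinM.
    apply: lee_wpmul2r; first by rewrite lee_fin rho_ge0.
    have := potential_diff x (s0 n) (enorm_ax i (ltW (s0 n))).
    rewrite /D normrM EFinM gtr0_norm ?invr_gt0// => H.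
    by rewrite lee_pdivrMl.
  have mP h : measurable_fun [set: mvec R] (fun x => (Phi f h x * (rho f x)%:E)%E).
    apply: emeasurable_funM; first exact: measurable_Phi.
    by apply/measurable_EFinP; exact: measurable_continuous3.
  have P0 h x : (0 <= Phi f h x * (rho f x)%:E)%E.
    by rewrite mule_ge0 ?Phi_ge0// lee_fin rho_ge0.
  rewrite ge0_integralD//.
  rewrite (_ : 4 * _ * _ = 2 * Cint F M * (M + kin) + 2 * Cint F M * (M + kin)); last by ring.
  by rewrite EFinD; apply: leeD; exact: (interaction cf f0 fK F0 fF massM kinE).
have gl x : limn_einf (fun n => g n x) = (`|DU i x| * rho f x)%:E.
  have cE : (fun n => g n x) @ \oo --> (`|DU i x| * rho f x)%:E.
    by apply: cvg_EFin; [exact: nearW|apply: cvgM; [exact: Dlim|exact: cvg_cst]].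
  rewrite is_cvg_limn_einfE; last by apply/cvg_ex; eexists; exact: cE.
  by rewrite (cvg_lim _ cE).
have := @fatou _ _ _ (@leb3 R) setT measurableT g mg (fun n x _ => g0 n x).
under eq_integral do rewrite gl.
move/le_trans; apply.
rewrite limn_einf_lim; apply: lime_le; first exact: is_cvg_einfs.
apply: nearW => n; apply: le_trans (gB n).
by apply: ereal_inf_lbound; exists n => /=.
Unshelve. all: by end_near. Qed.

End fixed_time.

(** * Upper and lower bounds on the field energy *)

Section energy_bounds.
Context {R : realType}.
Variables (f : phase R -> R) (K F : R).
Hypothesis cf : continuous f.
Hypothesis f0 : forall z, 0 <= f z.
Hypothesis fK : forall z, K < `|z| -> f z = 0.
Hypothesis F0 : 0 <= F.
Hypothesis fF : {ae leb6, forall z, f z <= F}.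
Variables M kin : R.
Hypothesis massM : massf f = M.
Hypothesis kinE : kinf f = kin.

Variables (U : vec3 R -> R) (DU : axis -> vec3 R -> R)
  (DDU : axis -> axis -> vec3 R -> R).
Hypothesis U' : forall i x, is_derive x (ax i) U (DU i x).
Hypothesis DU' : forall i j x, is_derive x (ax j) (DU i) (DDU i j x).
Hypothesis cU : continuous U.
Hypothesis cDU : forall i, continuous (DU i).
Hypothesis cDDU : forall i j, continuous (DDU i j).
Hypothesis lapU : forall x, sum3 (fun i => DDU i i x) = rho f x.
Hypothesis UE : forall x, U x = - (4 * pi)^-1 * \int[@leb3 R]_y (rho f y / enorm (x - y)).

Let psi x := \int[@leb6 R]_z (newt (x - z.1) * f z).

Lemma psiU x : psi x = - (4 * pi) * U x.
Proof.
rewrite (UPsi cf f0 fK F0 fF massM UE) -/(psi x) mulrA mulrNN mulfV ?mul1r//.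
by rewrite gt_eqF// mulr_gt0// pi_gt0.
Qed.

Lemma Psi_psi x : Psi f x = (psi x)%:E.
Proof. exact: (PsiE cf f0 fK F0 fF massM). Qed.

Lemma psi_ge0 x : 0 <= psi x.
Proof. by apply: Rintegral_ge0 => z _; apply: mulr_ge0 => //; exact: newt_ge0. Qed.

Lemma continuous_psi : continuous psi.
Proof. by rewrite (_ : psi = fun x => - (4 * pi) * U x); [cont|apply/funext => x; exact: psiU]. Qed.

(** In the max norm |x - y| >= |x| / 2. Passing to Euclidean lengths costs a factor 3 on squares, so
    |x|^2 <= 12 |x - y|^2, and 12 is rounded up to 16 = 4^2. *)
Lemma newt_far x y (L : R) : 2 * L + 1 < `|x| -> `|y| <= L -> newt (x - y) <= 4 * newt x.
Proof.
move=> xL yL; have L0 : 0 <= L by exact: le_trans yL.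
have x0 : 0 < `|x| by apply: le_lt_trans xL; rewrite addr_ge0// mulr_ge0.
have h1 : `|x| / 2 <= `|x - y|.
  have := lerB_dist x y; lra.
have h2 : (`|x| / 2) ^+ 2 <= nsq (x - y).
  apply: le_trans (normr_nsq _); by rewrite lerXn2r ?nnegrE ?divr_ge0.
have h3 := nsq_normr x.
have h4 : 0 < nsq x by apply: lt_le_trans (normr_nsq x); rewrite exprn_gt0.
have h5 : 0 < nsq (x - y) by apply: lt_le_trans h2; rewrite exprn_gt0// divr_gt0.
rewrite -ler_sqr ?nnegrE ?mulr_ge0 ?newt_ge0// exprMn !newt_sqr /kern.
rewrite -[leLHS]mul1r ler_pdivrMr// mulrAC ler_pdivlMr// mul1r.
apply: le_trans h3 _; move: h2; rewrite expr_div_n.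
have := sqr_ge0 `|x|; move: (`|x| ^+ 2) (nsq (x - y)) h5 => a b b0 a0 h2'.
have -> : 4 ^+ 2 = 16 :> R by rewrite -natrX.
have e4 : 2 ^+ 2 = 4 :> R by rewrite -natrX.
rewrite e4 in h2'; lra.
Qed.

(** Far from the support each source contributes at most 4 newt x. This is the [decay] hypothesis
    under which the spatial cutoff was removed from the energy identity. *)
Lemma potential_decay x : 2 * `|K| + 1 < `|x| -> U x ^+ 2 <= (4 * M) ^+ 2 * kern x.
Proof.
move=> xK.
have M0 : 0 <= M := mass_ge0 f0 massM.
have le1 : psi x <= 4 * M * newt x.
  rewrite -massM /massf (mulrC 4) -mulrA -RintegralZr//; last exact: (integrable6 cf fK).
  apply: le_Rintegral => //.
  - exact: (integrable_newtf cf f0 fK F0 fF massM).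
  - apply: (@integrable6 _ _ K); first by cont.
    by move=> z /fK ->; rewrite mul0r.
  move=> z _; rewrite mulrC; have [zK|zK] := leP `|z| K; last by rewrite fK// !mul0r.
  rewrite ler_wpM2l//; apply: newt_far xK _.
  rewrite (le_trans _ (ler_norm K))// (le_trans _ zK)//.
  by rewrite [leRHS]prod_normE le_max lexx.
have U1 : `|U x| <= psi x.
  rewrite psiU -[X in _ <= X]ger0_norm; last by rewrite -psiU psi_ge0.
  by rewrite normrM normrN ler_peMl// ger0_norm ?pi4_ge1// mulr_ge0// pi_ge0.
rewrite -newt_sqr -exprMn -real_normK ?num_real// lerXn2r ?nnegrE ?mulr_ge0 ?newt_ge0//.
exact: le_trans le1.
Qed.

Let crho : continuous (rho f) := continuous_source cDDU lapU.

Lemma field_energy :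
  leb3.-integrable setT (EFin \o nrm2 DU) /\
  4 * pi * (\int[@leb3 R]_x nrm2 DU x) = \int[@leb3 R]_x (psi x * rho f x).
Proof.
have R10 : 0 < 2 * `|K| + 1 by rewrite ltr_wpDl// mulr_ge0.
have [i1 i2] := nrm2_integral U' DU' cU cDU cDDU lapU (rho_out fK)
  (sqr_ge0 (4 * M)) R10 potential_decay.
split => //; rewrite i2 mulrN -mulNr -RintegralZl//.
  by apply: eq_RintegralT => x; rewrite psiU mulrA.
apply: (@integrable3 _ _ K); first by cont.
by move=> x /(rho_out fK) ->; rewrite mulr0.
Qed.

Lemma integral_rho1 : (\int[@leb3 R]_x (rho f x)%:E = M%:E)%E.
Proof.
rewrite -massM (massfE cf fK).
have := integral_rho cf f0 fK (g := fun=> 1%E) (measurable_cst _) (fun=> lee01).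
under eq_integral do rewrite mul1e.
by under [in X in _ = X -> _]eq_integral do rewrite mul1e.
Qed.

(** Young's inequality inside the double integral: the term in [e] is the interaction integral
    without shift, and the constant term integrates to M^2 / (4e). The factor 4 pi >= 1 is given
    away. *)
Lemma energy_upper (e : R) : 0 < e ->
  \int[@leb3 R]_x nrm2 DU x <= e * (2 * Cint F M * (M + kin)) + M ^+ 2 / (4 * e).
Proof.
move=> e0; have [_ E] := field_energy.
have M0 : 0 <= M := mass_ge0 f0 massM.
have A0 : 0 <= \int[@leb3 R]_x nrm2 DU x by apply: Rintegral_ge0 => x _; exact: nrm2_ge0.
apply: (@le_trans _ _ (4 * pi * \int[@leb3 R]_x nrm2 DU x)).
  by rewrite ler_peMl// pi4_ge1.
rewrite E.
have mr : measurable_fun [set: mvec R] (fun x => (rho f x)%:E).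
  by apply/measurable_EFinP; exact: measurable_continuous3.
have ip : leb3.-integrable setT (EFin \o (fun x => psi x * rho f x)).
  have h := continuous_psi; apply: (@integrable3 _ _ K); first by cont.
  by move=> x /(rho_out fK) ->; rewrite mulr0.
have mP : measurable_fun [set: mvec R] (fun x => (Phi f 0%R x * (rho f x)%:E)%E).
  by apply: emeasurable_funM => //; exact: measurable_Phi.
have P0 x : (0 <= Phi f 0%R x * (rho f x)%:E)%E.
  by rewrite mule_ge0 ?Phi_ge0// lee_fin rho_ge0.
have c0 : 0 <= M / (4 * e) by rewrite divr_ge0// mulr_ge0// ltW.
rewrite -lee_fin -integrable_fin//.
apply: (@le_trans _ _ (\int[@leb3 R]_x (e%:E * (Phi f 0%R x * (rho f x)%:E) + (M / (4 * e))%:E * (rho f x)%:E))%E).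
  apply: ge0_le_integral => //.
  - by move=> x _; rewrite lee_fin mulr_ge0 ?psi_ge0 ?rho_ge0.
  - exact: measurable_int ip.
  - by apply: emeasurable_funD; apply: emeasurable_funM.
  move=> x _; rewrite EFinM -Psi_psi muleA -ge0_muleDl.
  - apply: lee_wpmul2r; first by rewrite lee_fin rho_ge0.
    exact: (Psi_le cf f0 fK massM).
  - by rewrite mule_ge0 ?Phi_ge0// lee_fin ltW.
  - by rewrite lee_fin.
rewrite ge0_integralD//; first last.
- by apply: emeasurable_funM.
- by move=> x _; rewrite mule_ge0// lee_fin// rho_ge0.
- by apply: emeasurable_funM.
- by move=> x _; rewrite mule_ge0// lee_fin ltW.
rewrite ge0_integralZl_EFin//; last exact: ltW.
rewrite ge0_integralZl_EFin//; last by move=> x _; rewrite lee_fin rho_ge0.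
rewrite integral_rho1 -EFinM EFinD; apply: leeD; last first.
  by rewrite lee_fin (_ : M ^+ 2 / _ = M / (4 * e) * M)//; ring.
rewrite EFinM; apply: lee_wpmul2l; first by rewrite lee_fin ltW.
exact: (interaction cf f0 fK F0 fF massM kinE).
Qed.

Lemma Rintegral_rho (g : vec3 R -> R) : continuous g ->
  \int[@leb3 R]_x (g x * rho f x) = \int[@leb6 R]_z (g z.1 * f z).
Proof.
move=> cg.
have ig : leb6.-integrable setT (EFin \o (fun z : phase R => g z.1 * f z)).
  by apply: (fmoment cf fK); cont.
rewrite /Rintegral; congr fine.
transitivity (\int[@leb3 R]_x fubini_F leb3 (fun z : mphase R => (g z.1 * f z)%R%:E) x)%E; last first.
  exact: (integral12_prod_meas1 (m1 := leb3) (m2 := leb3) ig).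
apply: eq_integral => x _; rewrite /fubini_F /= EFinM (rhoE cf fK).
have ifx : leb3.-integrable setT (EFin \o (fun p => f (x, p))).
  apply: (@integrable3 _ _ K).
    by apply: (@contcomp _ _ _ (fun p => (x, p)) f); [exact: cf|cont].
  by move=> p Kp; apply: fK; rewrite prod_normE/= lt_max Kp orbT.
by rewrite -integralZl//; apply: eq_integral => p _; rewrite EFinM.
Qed.

Definition mom1 i : R := \int[@leb6 R]_z (co i z.1 * f z).
Definition mom2 : R := \int[@leb6 R]_z (nsq z.1 * f z).

(** The tangent inequality [newt_tangent] integrated over the sources. Its quadratic term expands
    into moments of [f], which turns the lower bound into a polynomial in [x]. *)
Lemma psi_lower (L : R) x : 0 < L ->
  3 * M / (2 * L) <= psi x + (2 * L ^+ 3)^-1 * (nsq x * M - 2 * sum3 (fun i => co i x * mom1 i) + mom2).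
Proof.
move=> L0.
have cn := @continuous_nsq R; have cc := @continuous_co R.
have L30 : 0 <= (2 * L ^+ 3)^-1 by rewrite invr_ge0 mulr_ge0// exprn_ge0// ltW.
have i0 := integrable6 cf fK.
have i1 i : leb6.-integrable setT (EFin \o (fun z : phase R => co i z.1 * f z)).
  by apply: (fmoment cf fK); cont.
have i2 : leb6.-integrable setT (EFin \o (fun z : phase R => nsq z.1 * f z)).
  by apply: (fmoment cf fK); cont.
have iq : leb6.-integrable setT (EFin \o (fun z : phase R => nsq (x - z.1) * f z)).
  by apply: (fmoment cf fK); cont.
have inw : leb6.-integrable setT (EFin \o (fun z : phase R => newt (x - z.1) * f z)).
  exact: (integrable_newtf cf f0 fK F0 fF massM).
have -> : nsq x * M - 2 * sum3 (fun i => co i x * mom1 i) + mom2 =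
    \int[@leb6 R]_z (nsq (x - z.1) * f z).
  have e (z : phase R) : nsq (x - z.1) * f z = nsq x * f z +
     (- (2 * co ax1 x)) * (co ax1 z.1 * f z) + (- (2 * co ax2 x)) * (co ax2 z.1 * f z) +
     (- (2 * co ax3 x)) * (co ax3 z.1 * f z) + nsq z.1 * f z.
    by rewrite /nsq /sum3 /=; ring.
  have fm (g : phase R -> R) : continuous g -> leb6.-integrable setT (EFin \o (fun z => g z * f z)).
    exact: (fmoment cf fK).
  transitivity (\int[@leb6 R]_z (nsq x * f z +
     (- (2 * co ax1 x)) * (co ax1 z.1 * f z) + (- (2 * co ax2 x)) * (co ax2 z.1 * f z) +
     (- (2 * co ax3 x)) * (co ax3 z.1 * f z) + nsq z.1 * f z)); last first.
    by apply: eq_RintegralT => z; rewrite e.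
  have j0 : leb6.-integrable setT (EFin \o (fun z : phase R => nsq x * f z)).
    by apply: fm; cont.
  have j1 i : leb6.-integrable setT (EFin \o (fun z : phase R => (- (2 * co i x)) * (co i z.1 * f z))).
    apply: (@integrable6 _ _ K); first by cont.
    by move=> z /fK ->; rewrite !mulr0.
  have j01 : leb6.-integrable setT (EFin \o (fun z : phase R => nsq x * f z +
     (- (2 * co ax1 x)) * (co ax1 z.1 * f z))).
    apply: (@integrable6 _ _ K); first by cont.
    by move=> z /fK ->; rewrite !mulr0 addr0.
  have j02 : leb6.-integrable setT (EFin \o (fun z : phase R => nsq x * f z +
     (- (2 * co ax1 x)) * (co ax1 z.1 * f z) + (- (2 * co ax2 x)) * (co ax2 z.1 * f z))).
    apply: (@integrable6 _ _ K); first by cont.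
    by move=> z /fK ->; rewrite !mulr0 !addr0.
  have j03 : leb6.-integrable setT (EFin \o (fun z : phase R => nsq x * f z +
     (- (2 * co ax1 x)) * (co ax1 z.1 * f z) + (- (2 * co ax2 x)) * (co ax2 z.1 * f z) +
     (- (2 * co ax3 x)) * (co ax3 z.1 * f z))).
    apply: (@integrable6 _ _ K); first by cont.
    by move=> z /fK ->; rewrite !mulr0 !addr0.
  rewrite RintegralD// RintegralD// RintegralD// RintegralD// !RintegralZl//.
  rewrite /sum3 -massM /massf /mom1 /mom2; ring.
rewrite -RintegralZl// /psi -RintegralD//; last first.
  apply: (@integrable6 _ _ K); first by cont.
  by move=> z /fK ->; rewrite !mulr0.
rewrite (_ : 3 * M / (2 * L) = 3 / (2 * L) * M); last by ring.
rewrite -massM /massf -RintegralZl//.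
have ia : leb6.-integrable setT (EFin \o (fun z => 3 / (2 * L) * f z)).
  apply: (@integrable6 _ _ K); first by cont.
  by move=> z /fK ->; rewrite !mulr0.
have ib : leb6.-integrable setT (EFin \o (fun z : phase R => newt (x - z.1) * f z + (2 * L ^+ 3)^-1 * (nsq (x - z.1) * f z))).
  have := integrableD measurableT inw (integrableZl measurableT (2 * L ^+ 3)^-1 iq).
  by apply: eq_integrable.
rewrite -lee_fin -(integrable_fin ia)// -(integrable_fin ib)//.
apply: ae_ge0_le_integral => //.
- move=> z _; rewrite lee_fin; apply: mulr_ge0 => //; apply: divr_ge0 => //.
  by rewrite mulr_ge0// ltW.
- exact: measurable_int ia.
- move=> z _; rewrite lee_fin; apply: addr_ge0; last by rewrite mulr_ge0// mulr_ge0// nsq_ge0.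
  by rewrite mulr_ge0// newt_ge0.
- exact: measurable_int ib.
(* The tangent inequality fails on the diagonal, where [newt] is 0; the sources located at [x] form
   the product of a box of radius 0 with momentum space, a null set. *)
exists (box x 0 `*` setT); split.
- by apply: measurableX => //; exact: measurable_box.
- rewrite [LHS](_ : _ = (@leb3 R (box x 0%R) * @leb3 R setT)%E); last first.
    by apply: product_measure1E => //; exact: measurable_box.
  by rewrite (leb3_box x (lexx 0)) expr0n/= mulr0 mul0e.
move=> z /= h; split => //; rewrite /box /= normr_le0; apply/eqP; apply: contrapT => zx.
apply: h => _; rewrite lee_fin mulrA -mulrDl ler_wpM2r// newt_tangent//.
exact/eqP.
Qed.

(** Integrating [psi_lower] against the density turns the polynomial into twice M [mom2] -
    |[mom1]|^2, which is M^2 times the dispersion. The length [L] is free and will be matched to a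
    bound on the dispersion. *)
Lemma energy_lower (L : R) : 0 < L ->
  3 * M ^+ 2 / (2 * L) - (M * mom2 - sum3 (fun i => mom1 i ^+ 2)) / L ^+ 3 <=
  4 * pi * \int[@leb3 R]_x nrm2 DU x.
Proof.
move=> L0; have [_ ->] := field_energy.
have cn := @continuous_nsq R; have cc := @continuous_co R; have cp := continuous_psi.
have ir (g : vec3 R -> R) : continuous g -> leb3.-integrable setT (EFin \o (fun x => g x * rho f x)).
  move=> cg; apply: (@integrable3 _ _ K); first by cont.
  by move=> x /(rho_out fK) ->; rewrite mulr0.
pose c := (2 * L ^+ 3)^-1.
pose q x := nsq x * M - 2 * sum3 (fun i => co i x * mom1 i) + mom2.
have cq : continuous q by rewrite /q /sum3; cont.
have E1 : \int[@leb3 R]_x rho f x = M.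
  have := @Rintegral_rho (fun=> 1) (@contcst _ _ (1 : R)).
  have -> : (fun x => 1 * rho f x) = rho f by apply/funext => x; rewrite mul1r.
  have -> : (fun z => 1 * f z) = f by apply/funext => x; rewrite mul1r.
  by rewrite -massM.
have Eq : \int[@leb3 R]_x (q x * rho f x) = 2 * (M * mom2 - sum3 (fun i => mom1 i ^+ 2)).
  have jn := ir _ cn; have jc i := ir _ (cc i); have j1 := ir _ (@contcst _ _ (1 : R)).
  transitivity (\int[@leb3 R]_x (M * (nsq x * rho f x) + (- (2 * mom1 ax1)) * (co ax1 x * rho f x)
    + (- (2 * mom1 ax2)) * (co ax2 x * rho f x) + (- (2 * mom1 ax3)) * (co ax3 x * rho f x)
    + mom2 * rho f x)).
    by apply: eq_RintegralT => x; rewrite /q /sum3; ring.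
  have jr : leb3.-integrable setT (EFin \o rho f).
    by move: j1; apply: eq_integrable => // x _ /=; rewrite mul1r.
  have J g (a : R) : leb3.-integrable setT (EFin \o (g : vec3 R -> R)) ->
      leb3.-integrable setT (EFin \o (fun x => a * g x)).
    by move=> /(integrableZl measurableT a); apply: eq_integrable.
  have JD g h : leb3.-integrable setT (EFin \o (g : vec3 R -> R)) ->
      leb3.-integrable setT (EFin \o (h : vec3 R -> R)) ->
      leb3.-integrable setT (EFin \o (fun x => g x + h x)).
    by move=> ig ih; have := integrableD measurableT ig ih; apply: eq_integrable.
  have k0 := J _ M jn; have k1 := J _ (- (2 * mom1 ax1)) (jc ax1).
  have k2 := J _ (- (2 * mom1 ax2)) (jc ax2); have k3 := J _ (- (2 * mom1 ax3)) (jc ax3).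
  have k4 := J _ mom2 jr.
  have k01 := JD _ _ k0 k1; have k02 := JD _ _ k01 k2; have k03 := JD _ _ k02 k3.
  rewrite (RintegralD measurableT k03 k4) (RintegralD measurableT k02 k3).
  rewrite (RintegralD measurableT k01 k2) (RintegralD measurableT k0 k1).
  rewrite (RintegralZl _ measurableT jn) !(RintegralZl _ measurableT (jc _)) (RintegralZl _ measurableT jr).
  rewrite E1 !Rintegral_rho// -!/(mom1 _) -/mom2 /sum3; ring.
have H : \int[@leb3 R]_x (3 * M / (2 * L) * rho f x) <=
    \int[@leb3 R]_x (psi x * rho f x + c * (q x * rho f x)).
  apply: le_Rintegral => //.
  - by apply: ir; cont.
  - apply: (@integrable3 _ _ K); first by cont.
    by move=> x /(rho_out fK) ->; rewrite !mulr0 addr0.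
  move=> x _; rewrite mulrA -mulrDl ler_wpM2r ?rho_ge0//; exact: psi_lower.
move: H; rewrite RintegralD//; [|exact: ir|]; last first.
  apply: (@integrable3 _ _ K); first by cont.
  by move=> x /(rho_out fK) ->; rewrite !mulr0.
rewrite RintegralZl//; last first.
  apply: (@integrable3 _ _ K); first by cont.
  by move=> x /(rho_out fK) ->.
rewrite RintegralZl//; last exact: ir.
rewrite E1 Eq /c.
have -> : 3 * M / (2 * L) * M = 3 * M ^+ 2 / (2 * L) by ring.
have -> : (2 * L ^+ 3)^-1 * (2 * (M * mom2 - sum3 (fun i => mom1 i ^+ 2))) =
  (M * mom2 - sum3 (fun i => mom1 i ^+ 2)) / L ^+ 3 by field; rewrite gt_eqF.
by rewrite lerBlDr.
Qed.

End energy_bounds.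

Lemma pair_ext (A B : Type) (a b : A * B) : a.1 = b.1 -> a.2 = b.2 -> a = b.
Proof. by case: a b => [x y] [x' y'] /= -> ->. Qed.

(** * The transport equation in weak form *)

Section transport.
Context {R : realType}.

Lemma lebesgue_like_time_phase : lebesgue_like (id : (measurableTypeR R * mphase R)%type -> R * phase R) (@lebesgue_measure R \x @leb6 R)%E.
Proof. by apply: lebesgue_like_ext (lebesgue_like_prod lebesgue_like_lebesgue lebesgue_like_leb6) _ => -[]. Qed.

Variable f : R * phase R -> R.
Hypothesis C1f : C1 f.

Definition ft (z : R * phase R) : R := 'D_((1 : R), (0 : phase R)) f z.
Definition fx i (z : R * phase R) : R := 'D_((0 : R), ((ax i, 0) : phase R)) f z.
Definition fp i (z : R * phase R) : R := 'D_((0 : R), ((0, ax i) : phase R)) f z.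

Lemma continuous_f : continuous f.
Proof. by move=> z; apply: differentiable_continuous; exact: C1f.1. Qed.

Lemma continuous_ft : continuous ft. Proof. exact: C1f.2. Qed.
Lemma continuous_fx i : continuous (fx i). Proof. exact: C1f.2. Qed.
Lemma continuous_fp i : continuous (fp i). Proof. exact: C1f.2. Qed.

Lemma is_derive_f z v : is_derive z v f ('D_v f z).
Proof. by apply: derivableP; apply: diff_derivable; exact: C1f.1. Qed.

Lemma is_derive_ft t z : is_derive (t : R) (1 : R) (fun s : R => f (s, z)) (ft (t, z)).
Proof.
apply: (@is_derive_affine _ _ _ (fun s : R => (s, z))) (is_derive_f _ _).
by move=> h; apply: pair_ext => //=; rewrite scaler0 add0r.
Qed.

Lemma is_derive_fx i t x p :
  is_derive x (ax i) (fun y => f (t, (y, p))) (fx i (t, (x, p))).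
Proof.
apply: (@is_derive_affine _ _ _ (fun y => (t, (y, p)))) (is_derive_f _ _).
by move=> h; apply: pair_ext => /=; [|apply: pair_ext => //=]; rewrite scaler0 add0r.
Qed.

Lemma is_derive_fp i t x p :
  is_derive p (ax i) (fun q => f (t, (x, q))) (fp i (t, (x, p))).
Proof.
apply: (@is_derive_affine _ _ _ (fun q => (t, (x, q)))) (is_derive_f _ _).
by move=> h; apply: pair_ext => /=; [|apply: pair_ext => //=]; rewrite scaler0 add0r.
Qed.

(** The fundamental theorem of calculus at each phase point, then Fubini. Compact support of [phi]
    confines everything to a compact set of time-phase space, so no control on how the support of
    [f] moves is required. *)
Lemma time_integral (phi : phase R -> R) (K S T : R) : S < T -> continuous phi ->
  (forall z, K < `|z| -> phi z = 0) ->
  lebesgue_measure.-integrable `[S, T] (EFin \o (fun t => \int[@leb6 R]_z (phi z * ft (t, z)))) /\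
  \int[@leb6 R]_z (phi z * f (T, z)) - \int[@leb6 R]_z (phi z * f (S, z)) =
  \int[@lebesgue_measure R]_(t in `[S, T]) (\int[@leb6 R]_z (phi z * ft (t, z))).
Proof.
move=> ST cphi phiK.
have cf := continuous_f; have cft := continuous_ft.
pose H (w : R * phase R) := phi w.2 * ft w.
have cH : continuous H by rewrite /H; cont.
pose B : set (measurableTypeR R * mphase R) := `[S, T] `*` [set z : phase R | `|z| <= K].
have [_ _ nb] := @lebesgue_like_leb6 R.
have mB : measurable B by apply: measurableX => //; exact: (nb K).1.
have iH : (lebesgue_measure \x leb6)%E.-integrable B (EFin \o H).
  apply: (lebesgue_like_integrable lebesgue_like_time_phase cH mB (K := Num.max K (Num.max `|S| `|T|))).
  move=> [t z] [/=]; rewrite in_itv/= => /andP[tS tT] zK.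
  rewrite prod_normE/= ge_max !le_max zK/= andbT.
  apply/orP; right; case: (leP 0 t) => t0.
    by apply/orP; right; rewrite !ger0_norm// (le_trans t0).
  by apply/orP; left; rewrite !ltr0_norm ?lerN2// (le_lt_trans tS).
pose h := (EFin \o H) \_ B.
have ih : (lebesgue_measure \x leb6)%E.-integrable setT h.
  by move/(integrable_mkcond _ mB): (iH).
have hE t z : h (t, z) = (((fun t => (phi z * ft (t, z))%:E) \_ `[S, T]) t).
  rewrite /h !patchE; have [tI|tI] := boolP (t \in `[S, T]%classic).
    have [zK|zK] := leP `|z| K.
      by rewrite mem_set//; split => //=; rewrite inE in tI.
    by rewrite phiK// mul0r /H /= phiK// mul0r; case: ifP.
  by rewrite memNset// => -[/= tI' _]; move: tI; rewrite mem_set.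
have hE' t z : h (t, z) = (if t \in `[S, T]%classic then (phi z * ft (t, z))%:E else 0%E).
  by rewrite hE patchE.
have ictr t : leb6.-integrable setT (EFin \o (fun z => phi z * ft (t, z))).
  apply: (@integrable6 _ _ K); last by move=> z /phiK ->; rewrite mul0r.
  apply: contM => //.
  by apply: (@contcomp _ _ _ (fun z : phase R => (t, z)) ft) => //; cont.
have icf t : leb6.-integrable setT (EFin \o (fun z => phi z * f (t, z))).
  apply: (@integrable6 _ _ K); last by move=> z /phiK ->; rewrite mul0r.
  apply: contM => //.
  by apply: (@contcomp _ _ _ (fun z : phase R => (t, z)) f) => //; cont.
have GE t : fubini_F leb6 h t = ((EFin \o (fun t => \int[@leb6 R]_z (phi z * ft (t, z)))) \_ `[S, T]) t.
  rewrite /fubini_F patchE; under eq_integral do rewrite hE'.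
  case: ifP => _; last by rewrite integral0.
  by rewrite /= -integrable_fin.
have FE z : fubini_G lebesgue_measure h z = (phi z * f (T, z) - phi z * f (S, z))%:E.
  rewrite /fubini_G; under eq_integral do rewrite hE.
  rewrite -integral_mkcond.
  have cz : continuous (fun t => phi z * ft (t, z)).
    apply: contM; first by cont.
    by apply: (@contcomp _ _ _ (fun t : R => (t, z)) ft) => //; cont.
  have dz t : is_derive (t : R) (1 : R) (fun s : R => phi z * f (s, z)) (phi z * ft (t, z)).
    have h1 := is_derive_ft t z.
    eapply is_derive_eq; first by eapply isdM; [exact: isdcst|exact: h1].
    by rewrite mulr0 addr0.
  have cF : continuous (fun s : R => phi z * f (s, z)).
    apply: contM; first by cont.
    by apply: (@contcomp _ _ _ (fun t : R => (t, z)) f) => //; cont.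
  rewrite (@continuous_FTC2 _ (fun t => phi z * ft (t, z)) (fun t => phi z * f (t, z)))//.
  - by apply: continuous_subspaceT.
  - split.
    + by move=> s _; case: (dz s).
    + by apply: cvg_at_right_filter; exact: cF.
    + by apply: cvg_at_left_filter; exact: cF.
  - by move=> s _; rewrite derive1E; case: (dz s).
have iG := integrable_fubini_F ih.
split.
  apply/(integrable_mkcond _ _).2 => //.
  by move: iG; apply: eq_integrable => // t _; exact: GE.
rewrite -RintegralB//; apply: (@EFin_inj R).
rewrite -integrable_fin//; last first.
  have := integrableB measurableT (icf T) (icf S); exact: eq_integrable.
transitivity (\int[@leb6 R]_z fubini_G lebesgue_measure h z)%E.
  by apply: eq_integral => z _; rewrite FE.
rewrite (integral21_prod_meas1 (m1 := lebesgue_measure) (m2 := leb6) ih).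
rewrite -(integral12_prod_meas1 (m1 := lebesgue_measure) (m2 := leb6) ih).
rewrite -integrable_fin//; last first.
  apply/(integrable_mkcond _ _).2 => //.
  by move: iG; apply: eq_integrable => // t _; exact: GE.
by rewrite [RHS]integral_mkcond; apply: eq_integral => t _; rewrite GE.
Qed.

End transport.

Section weak_form.
Context {R : realType}.
Variable f : R * phase R -> R.
Hypothesis C1f : C1 f.
Variables (t K : R).
Hypothesis fK : forall z, K < `|z| -> f (t, z) = 0.

Let g (z : phase R) := f (t, z).

Lemma continuous_slice (h : R * phase R -> R) : continuous h -> continuous (fun z : phase R => h (t, z)).
Proof. by move=> ch; apply: (@contcomp _ _ _ (fun z : phase R => (t, z)) h) => //; cont. Qed.

Lemma is_derive_slice (z v : phase R) : is_derive z v g ('D_((0 : R), v) f (t, z)).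
Proof.
apply: (@is_derive_affine _ _ _ (fun z => (t, z))) (is_derive_f C1f _ _).
by move=> h; apply: pair_ext => //=; rewrite scaler0 add0r.
Qed.

Lemma fx_out i z : K < `|z| -> fx f i (t, z) = 0.
Proof. exact: is_derive_out fK (is_derive_slice z _). Qed.

Lemma fp_out i z : K < `|z| -> fp f i (t, z) = 0.
Proof. exact: is_derive_out fK (is_derive_slice z _). Qed.

Definition null_integral (h : phase R -> R) :=
  leb6.-integrable setT (EFin \o h) /\ \int[@leb6 R]_z h z = 0.

Lemma null_integralD h1 h2 : null_integral h1 -> null_integral h2 ->
  null_integral (fun z => h1 z + h2 z).
Proof.
move=> [i1 e1] [i2 e2]; split; last by rewrite RintegralD// e1 e2 addr0.
by have := integrableD measurableT i1 i2; apply: eq_integrable.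
Qed.

Lemma null_integralB h1 h2 : null_integral h1 -> null_integral h2 ->
  null_integral (fun z => h1 z - h2 z).
Proof.
move=> [i1 e1] [i2 e2]; split; last by rewrite RintegralB// e1 e2 subr0.
by have := integrableB measurableT i1 i2; apply: eq_integrable.
Qed.

Lemma null_integral_x (h : phase R -> R) : continuous h ->
  (forall z, K < `|z| -> h z = 0) ->
  (forall p, \int[@leb3 R]_x h (x, p) = 0) -> null_integral h.
Proof.
move=> ch hK h0; have ih := integrable6 ch hK; split => //.
rewrite /Rintegral -(integral21_prod_meas1 (m1 := leb3) (m2 := leb3) ih).
rewrite integral0_eq// => p _; rewrite /fubini_G /= integrable_fin ?h0//.
apply: (@integrable3 _ _ K).
  by apply: (@contcomp _ _ _ (fun x => (x, p)) h) => //; cont.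
by move=> x Kx; apply: hK; rewrite prod_normE/= lt_max Kx.
Qed.

Lemma null_integral_p (h : phase R -> R) : continuous h ->
  (forall z, K < `|z| -> h z = 0) ->
  (forall x, \int[@leb3 R]_p h (x, p) = 0) -> null_integral h.
Proof.
move=> ch hK h0; have ih := integrable6 ch hK; split => //.
rewrite /Rintegral -(integral12_prod_meas1 (m1 := leb3) (m2 := leb3) ih).
rewrite integral0_eq// => x _; rewrite /fubini_F /= integrable_fin ?h0//.
apply: (@integrable3 _ _ K).
  by apply: (@contcomp _ _ _ (fun p => (x, p)) h) => //; cont.
by move=> p Kp; apply: hK; rewrite prod_normE/= lt_max Kp orbT.
Qed.

(** For fixed momentum the integrand is a constant times the derivative of b f along axis [i], and f
    vanishes far out. *)
Lemma ibp_x i (a b db : vec3 R -> R) : continuous a -> continuous b ->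
  continuous db -> (forall x, is_derive x (ax i) b (db x)) ->
  null_integral (fun z => a z.2 * (b z.1 * fx f i (t, z) + g z * db z.1)).
Proof.
move=> ca cb cdb b'.
have cg : continuous g := continuous_slice (continuous_f C1f).
have cgx : continuous (fun z => fx f i (t, z)) := continuous_slice (@continuous_fx _ _ C1f i).
have ch : continuous (fun z : phase R => a z.2 * (b z.1 * fx f i (t, z) + g z * db z.1)).
  by apply: contM; [cont|apply: contD; apply: contM => //; cont].
apply: null_integral_x => //.
  by move=> z Kz; rewrite /g fK// fx_out//; ring.
move=> p.
apply: (@integral_derive0 _ i (fun x => a p * (b x * g (x, p))) _ K).
- move=> x; have h1 := is_derive_fx C1f i t x p.
  eapply is_derive_eq; first by eapply isdM; [exact: isdcst|eapply isdM; [exact: b'|exact: h1]].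
  by rewrite /g; ring.
- by apply: (@contcomp _ _ _ (fun x => (x, p)) (fun z : phase R => a z.2 * (b z.1 * fx f i (t, z) + g z * db z.1))) => //; cont.
- by move=> x Kx; rewrite /g fK ?mulr0// prod_normE/= lt_max Kx.
Qed.

Lemma ibp_p i (a b db : vec3 R -> R) : continuous a -> continuous b ->
  continuous db -> (forall x, is_derive x (ax i) b (db x)) ->
  null_integral (fun z => a z.1 * (b z.2 * fp f i (t, z) + g z * db z.2)).
Proof.
move=> ca cb cdb b'.
have cg : continuous g := continuous_slice (continuous_f C1f).
have cgx : continuous (fun z => fp f i (t, z)) := continuous_slice (@continuous_fp _ _ C1f i).
have ch : continuous (fun z : phase R => a z.1 * (b z.2 * fp f i (t, z) + g z * db z.2)).
  by apply: contM; [cont|apply: contD; apply: contM => //; cont].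
apply: null_integral_p => //.
  by move=> z Kz; rewrite /g fK// fp_out//; ring.
move=> x.
apply: (@integral_derive0 _ i (fun p => a x * (b p * g (x, p))) _ K).
- move=> p; have h1 := is_derive_fp C1f i t x p.
  eapply is_derive_eq; first by eapply isdM; [exact: isdcst|eapply isdM; [exact: b'|exact: h1]].
  by rewrite /g; ring.
- by apply: (@contcomp _ _ _ (fun p => (x, p)) (fun z : phase R => a z.1 * (b z.2 * fp f i (t, z) + g z * db z.2))) => //; cont.
- by move=> p Kp; rewrite /g fK ?mulr0// prod_normE/= lt_max Kp orbT.
Qed.

Variable DU : axis -> vec3 R -> R.
Hypothesis cDU : forall i, continuous (DU i).
Hypothesis transport : forall z, ft f (t, z) =
  - sum3 (fun i => co i z.2 * fx f i (t, z)) + sum3 (fun i => DU i z.1 * fp f i (t, z)).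

(* The adjoint of the transport operator applied to b(x) p(v), when [db] and [dp]
   are the gradients. *)
Definition weak_rhs (b p : vec3 R -> R) (db dp : axis -> vec3 R -> R) (z : phase R) : R :=
  sum3 (fun i => co i z.2 * db i z.1) * p z.2 -
  sum3 (fun i => DU i z.1 * dp i z.2) * b z.1.

(** The velocity coefficients do not depend on position and the force coefficients do not depend on
    momentum, so integration by parts moves the derivatives onto [b] and [p] alone. At a fixed time
    [f] has compact support, and [b] and [p] may grow. *)
Lemma weak_form (b p : vec3 R -> R) (db dp : axis -> vec3 R -> R) :
  continuous b -> continuous p ->
  (forall i, continuous (db i)) -> (forall i, continuous (dp i)) ->
  (forall i x, is_derive x (ax i) b (db i x)) ->
  (forall i x, is_derive x (ax i) p (dp i x)) ->
  \int[@leb6 R]_z (b z.1 * p z.2 * ft f (t, z)) =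
  \int[@leb6 R]_z (weak_rhs b p db dp z * f (t, z)).
Proof.
move=> cb cp cdb cdp b' p'.
have cc := @continuous_co R.
have cft : continuous (fun z : phase R => ft f (t, z)) := continuous_slice (continuous_ft C1f).
have cg : continuous g := continuous_slice (continuous_f C1f).
have ca i : continuous (fun q => co i q * p q) by cont.
have ca' i : continuous (fun x => DU i x * b x) by cont.
have nx i := ibp_x (ca i) cb (cdb i) (b' i).
have np i := ibp_p (ca' i) cp (cdp i) (p' i).
have := null_integralB (null_integralD (null_integralD (nx ax1) (nx ax2)) (nx ax3))
  (null_integralD (null_integralD (np ax1) (np ax2)) (np ax3)).
move=> [_ E].
apply/eqP; rewrite eq_sym -subr_eq0 -RintegralB//.
- apply/eqP; rewrite -[RHS]E; apply: eq_RintegralT => z.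
  rewrite transport /weak_rhs /g /sum3.
  move: (fx f ax1 (t, z)) (fx f ax2 (t, z)) (fx f ax3 (t, z)) (fp f ax1 (t, z))
    (fp f ax2 (t, z)) (fp f ax3 (t, z)) (f (t, z)) => x1 x2 x3 p1 p2 p3 y.
  by ring.
- apply: (@integrable6 _ _ K); last by move=> z Kz; rewrite fK// mulr0.
  by rewrite /weak_rhs /sum3; apply: contM => //; cont.
- apply: (@integrable6 _ _ K).
    by apply: contM => //; cont.
  by move=> z Kz; rewrite transport /sum3 !fx_out// !fp_out//; ring.
Qed.

End weak_form.

Section cutoff_bounds.
Context {R : realType}.

Lemma cvg_inv_sqr : (fun n : nat => (n.+1%:R ^+ 2)^-1 : R) @ \oo --> (0 : R).
Proof.
have h := @cvg_harmonic R; have := cvg_seqM h h; rewrite mulr0.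
rewrite (_ : (fun n => (n.+1%:R ^+ 2)^-1) = (fun n => harmonic n * harmonic n :> R))//.
by apply/funext => n /=; rewrite expr2 invfM.
Qed.

Lemma cvg_cut1 i (x : vec3 R) : (fun n : nat => cut1 n.+1%:R i x) @ \oo --> (0 : R).
Proof.
have hw := @cvg_cutw R x; have h0 := cvg_inv_sqr.
have cs (a : R) : (fun _ : nat => a) @ \oo --> a by exact: cvg_cst.
have := cvg_seqM (cvg_seqM (cs (- 6 * co i x)) h0) (cvg_seqM hw hw); rewrite mulr0 mul0r.
rewrite (_ : (fun n : nat => cut1 n.+1%:R i x) = (fun n : nat =>
  - 6 * co i x * (n.+1%:R ^+ 2)^-1 * (cutw n.+1%:R x * cutw n.+1%:R x)))//.
by apply/funext => n; rewrite /cut1; ring.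
Qed.

Lemma co_sqr i (x : vec3 R) : co i x ^+ 2 <= nsq x.
Proof.
have h j : 0 <= co j x ^+ 2 by exact: sqr_ge0.
have h1 := h ax1; have h2 := h ax2; have h3 := h ax3.
by rewrite /nsq /sum3; case: i; lra.
Qed.

Lemma cut1_bound (r : R) i (x : vec3 R) : 0 < r -> `|cut1 r i x| <= 6 / r.
Proof.
move=> r0; have [h|h] := leP (r ^+ 2) (nsq x).
  rewrite /cut1 (cutw_out r0 h) expr0n/= mulr0 normr0 divr_ge0// ltW//.
have w0 := cutw_ge0 r x; have w1 := cutw_le1 r x.
have cr : `|co i x| <= r.
  rewrite -ler_sqr ?nnegrE ?(ltW r0)// real_normK ?num_real//.
  exact: le_trans (co_sqr i x) (ltW h).
rewrite /cut1 (_ : _ * _ = - (6 / r * (co i x / r) * cutw r x ^+ 2)); last by field; rewrite gt_eqF.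
have s0 : 0 <= 6 / r by rewrite divr_ge0 ?ler0n ?ltW.
have v0 : 0 <= cutw r x ^+ 2 by exact: sqr_ge0.
rewrite normrN normrM normrM (ger0_norm s0) (ger0_norm v0) -mulrA.
apply: ler_piMr => //; apply: mulr_ile1 => //; last by rewrite exprn_ile1.
by rewrite normrM normfV (gtr0_norm r0) ler_pdivrMr// mul1r.
Qed.

(** The derivative of the cutoff is at most 6/r and vanishes for |x| >= r, so it compensates a
    factor of linear growth. This makes the truncated moments dominated uniformly in [r]. *)
Lemma cut1_moment_bound (r : R) i j (c : R) (x : vec3 R) : 1 <= r ->
  `|(co j x - c) * cut1 r i x| <= 6 + 6 * `|c|.
Proof.
move=> r1; have r0 : 0 < r by apply: lt_le_trans r1.
have [h|h] := leP (r ^+ 2) (nsq x).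
  rewrite /cut1 (cutw_out r0 h) expr0n/= !mulr0 normr0 addr_ge0// ?mulr_ge0//.
have cr : `|co j x| <= r.
  rewrite -ler_sqr ?nnegrE ?(ltW r0)// real_normK ?num_real//.
  exact: le_trans (co_sqr j x) (ltW h).
rewrite normrM.
apply: (@le_trans _ _ ((r + `|c|) * (6 / r))).
  apply: ler_pM => //; last exact: cut1_bound.
  by rewrite (le_trans (ler_normB _ _))// lerD.
rewrite [leLHS](_ : _ = 6 + 6 * (`|c| / r)); last by field; rewrite gt_eqF.
by rewrite lerD2l ler_wpM2l ?ler0n// ler_pdivrMr// ler_peMr.
Qed.

End cutoff_bounds.

Section spatial_test.
Context {R : realType}.
Variable f : R * phase R -> R.
Hypothesis C1f : C1 f.
Hypothesis f0 : forall z, 0 <= f z.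
Variable Kt : R -> R.
Hypothesis fK : forall t z, Kt t < `|z| -> f (t, z) = 0.
Variable DU : R -> axis -> vec3 R -> R.
Hypothesis cDU : forall t i, continuous (DU t i).
Hypothesis transport : forall t z, ft f (t, z) =
  - sum3 (fun i => co i z.2 * fx f i (t, z)) + sum3 (fun i => DU t i z.1 * fp f i (t, z)).
Variables M Kk Fb : R.
Hypothesis massM : forall t, massf (fun z => f (t, z)) = M.
Hypothesis kinK : forall t, kinf (fun z => f (t, z)) <= Kk.
Hypothesis forceF : forall t i, \int[@leb6 R]_z (`|DU t i z.1| * f (t, z)) <= Fb.

Lemma integrable_at t (h : phase R -> R) : continuous h ->
  leb6.-integrable setT (EFin \o (fun z => h z * f (t, z))).
Proof.
move=> ch; apply: (@integrable6 _ _ (Kt t)); last by move=> z /fK ->; rewrite mulr0.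
by apply: contM => //; exact: (@continuous_slice _ t _ (continuous_f C1f)).
Qed.

Lemma cvg_at t (h_ : nat -> phase R -> R) (h W : phase R -> R) :
  (forall n, continuous (h_ n)) -> continuous W ->
  (forall z, h_ ^~ z @ \oo --> h z) -> (forall n z, `|h_ n z| <= W z) ->
  (fun n => \int[@leb6 R]_z (h_ n z * f (t, z))) @ \oo --> \int[@leb6 R]_z (h z * f (t, z)).
Proof.
move=> ch cW hh hW.
apply: (@Rintegral_cvg R _ _ (@leb6 R) setT (fun n z => h_ n z * f (t, z)) _ (fun z => W z * f (t, z))) => //.
- move=> n; apply: (@measurable_continuous6 _ (fun z => h_ n z * f (t, z))).
  exact: contM (ch n) (@continuous_slice _ t _ (continuous_f C1f)).
- by move=> z _; apply: cvg_seqM; [exact: hh|exact: cvg_cst].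
- exact: integrable_at.
- by move=> n z _; rewrite normrM (ger0_norm (f0 _)) ler_wpM2r.
Qed.

Lemma bound_at t (h W : phase R -> R) : continuous h -> continuous W ->
  (forall z, `|h z| <= W z) ->
  `|\int[@leb6 R]_z (h z * f (t, z))| <= \int[@leb6 R]_z (W z * f (t, z)).
Proof.
move=> ch cW hW.
apply: le_trans (le_normr_Rintegral measurableT (integrable_at t ch)) _.
apply: le_Rintegral => //; first exact: integrable_norm (integrable_at t ch).
- exact: integrable_at.
- by move=> z _; rewrite normrM (ger0_norm (f0 _)) ler_wpM2r.
Qed.

Variables (b : vec3 R -> R) (db : axis -> vec3 R -> R) (L B c : R) (j : axis).
Hypothesis cb : continuous b.
Hypothesis cdb : forall i, continuous (db i).
Hypothesis b' : forall i x, is_derive x (ax i) b (db i x).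
Hypothesis bL : forall x, L < `|x| -> b x = 0.
Hypothesis bB : forall x, `|b x| <= B.
Hypothesis dbB : forall i x, `|db i x| <= B.

Let p (q : vec3 R) := co j q - c.
Let pn (n : nat) (q : vec3 R) := p q * cutf n.+1%:R q.
Let dpn (n : nat) i (q : vec3 R) := p q * cut1 n.+1%:R i q + cutf n.+1%:R q * kronecker j i.
(** A majorant independent of the momentum cutoff. The first term bounds products of two momentum
    factors along the three axes; in 7 + 6 |c|, the part 6 + 6 |c| comes from [cut1_moment_bound]
    and 1 from the cutoff itself. *)
Let W t (z : phase R) := B * (3 * (2 * nsq z.2 + c ^+ 2)) +
  B * (7 + 6 * `|c|) * sum3 (fun i => `|DU t i z.1|).

Let cp : continuous p.
Proof. by have h := @continuous_co R; rewrite /p; cont. Qed.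

Let cpn n : continuous (pn n).
Proof. by have h := @continuous_cut R n.+1%:R; rewrite /pn; cont. Qed.

Let cdpn n i : continuous (dpn n i).
Proof.
have h := @continuous_cut R n.+1%:R; have h1 := @continuous_cut1 R n.+1%:R.
by rewrite /dpn; cont.
Qed.

Let cW t : continuous (W t).
Proof. by have h := @continuous_nsq R; have h' i := @cDU t i; rewrite /W /sum3; cont. Qed.

Let B0 : 0 <= B. Proof. exact: le_trans (bB 0). Qed.

Lemma weak_rhs_bound t n z : `|weak_rhs (DU t) b (pn n) db (dpn n) z| <= W t z.
Proof.
rewrite /weak_rhs; apply: le_trans (ler_normB _ _) _; rewrite /W; apply: lerD.
  have pp : `|pn n z.2| <= `|p z.2|.
    rewrite /pn normrM ler_piMr// ger0_norm ?cut_ge0//; exact: cut_le1.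
  have term i : `|co i z.2 * db i z.1| * `|p z.2| <= B * (2 * nsq z.2 + c ^+ 2).
    rewrite normrM mulrAC mulrC; apply: ler_pM => //.
    have e1 := real_normK (num_real (co i z.2)).
    have e2 : `|p z.2| ^+ 2 = (co j z.2 - c) ^+ 2 by rewrite real_normK ?num_real.
    have := co_sqr i z.2; have := co_sqr j z.2.
    have := sqr_ge0 (`|co i z.2| - `|p z.2|); have := sqr_ge0 (co j z.2 + c).
    move: e1 e2; move: `|co i z.2| `|p z.2| (co i z.2) (co j z.2) (nsq z.2).
    by move=> u v a a' N *; nra.
  rewrite normrM; apply: (@le_trans _ _ (`|sum3 (fun i => co i z.2 * db i z.1)| * `|p z.2|)).
    by rewrite ler_wpM2l.
  apply: (@le_trans _ _ (sum3 (fun i => `|co i z.2 * db i z.1|) * `|p z.2|)).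
    rewrite ler_wpM2r// /sum3 (le_trans (ler_normD _ _))// lerD2r.
    exact: ler_normD.
  apply: le_trans (_ : _ <= sum3 (fun=> B * (2 * nsq z.2 + c ^+ 2))) _; last first.
    by rewrite /sum3; move: (2 * nsq z.2 + c ^+ 2) => u; lra.
  by rewrite /sum3 2!mulrDl; apply: lerD (term ax3); apply: lerD.
have term i : `|DU t i z.1 * dpn n i z.2| <= (7 + 6 * `|c|) * `|DU t i z.1|.
  rewrite normrM mulrC ler_wpM2r// /dpn (le_trans (ler_normD _ _))//.
  have h1 : `|p z.2 * cut1 n.+1%:R i z.2| <= 6 + 6 * `|c|.
    by apply: cut1_moment_bound; rewrite ler1n.
  have h2 : `|cutf n.+1%:R z.2 * kronecker j i| <= 1.
    rewrite normrM mulr_ile1// ger0_norm ?cut_ge0 ?cut_le1//.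
      by case: (j) (i) => -[].
    by case: (j) (i) => -[].
  lra.
rewrite normrM mulrC -mulrA; apply: ler_pM => //.
apply: (@le_trans _ _ (sum3 (fun i => `|DU t i z.1 * dpn n i z.2|))).
  by rewrite /sum3 (le_trans (ler_normD _ _))// lerD2r; exact: ler_normD.
have h1 := term ax1; have h2 := term ax2; have h3 := term ax3.
rewrite [leRHS](_ : _ = sum3 (fun i => (7 + 6 * `|c|) * `|DU t i z.1|)).
  by apply: lerD h3; apply: lerD.
by rewrite /sum3 [in LHS]mulrDr [X in X + _]mulrDr.
Qed.

Lemma W_bound t : \int[@leb6 R]_z (W t z * f (t, z)) <=
  B * (3 * (2 * Kk + c ^+ 2 * M)) + B * (7 + 6 * `|c|) * (3 * Fb).
Proof.
have cn := @continuous_nsq R; have ca i : continuous (fun z : phase R => `|DU t i z.1|).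
  by have h i0 := @cDU t i0; cont.
have kin : \int[@leb6 R]_z (nsq z.2 * f (t, z)) <= Kk := kinK t.
have ms : \int[@leb6 R]_z f (t, z) = M := massM t.
have i0 : leb6.-integrable setT (EFin \o (fun z => nsq z.2 * f (t, z))).
  by apply: integrable_at; cont.
have i1 : leb6.-integrable setT (EFin \o (fun z => f (t, z))).
  apply: (@integrable6 _ _ (Kt t)); last by move=> z /fK.
  exact: (@continuous_slice _ t _ (continuous_f C1f)).
have ia i := integrable_at t (ca i).
have Z (h : phase R -> R) (a : R) : leb6.-integrable setT (EFin \o h) ->
    leb6.-integrable setT (EFin \o (fun z => a * h z)).
  by move=> /(integrableZl measurableT a); apply: eq_integrable.
have D (h k : phase R -> R) : leb6.-integrable setT (EFin \o h) ->
    leb6.-integrable setT (EFin \o k) -> leb6.-integrable setT (EFin \o (fun z => h z + k z)).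
  by move=> ih ik; have := integrableD measurableT ih ik; apply: eq_integrable.
set cc := B * (7 + 6 * `|c|).
have j0 := Z _ (6 * B) i0; have j1 := Z _ (3 * B * c ^+ 2) i1.
have k1 := Z _ cc (ia ax1); have k2 := Z _ cc (ia ax2); have k3 := Z _ cc (ia ax3).
have l1 := D _ _ j0 j1; have l2 := D _ _ l1 k1; have l3 := D _ _ l2 k2.
rewrite (_ : \int[@leb6 R]_z (W t z * f (t, z)) = \int[@leb6 R]_z
   (6 * B * (nsq z.2 * f (t, z)) + 3 * B * c ^+ 2 * f (t, z) +
    cc * (`|DU t ax1 z.1| * f (t, z)) + cc * (`|DU t ax2 z.1| * f (t, z)) +
    cc * (`|DU t ax3 z.1| * f (t, z)))); last first.
  by apply: eq_RintegralT => z; rewrite /W /sum3 /cc; ring.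
rewrite (RintegralD measurableT l3 k3) (RintegralD measurableT l2 k2).
rewrite (RintegralD measurableT l1 k1) (RintegralD measurableT j0 j1).
rewrite (RintegralZl _ measurableT i0) (RintegralZl _ measurableT i1) !(RintegralZl _ measurableT (ia _)).
rewrite ms.
have cc0 : 0 <= cc by rewrite /cc mulr_ge0// addr_ge0// mulr_ge0.
have q1 := ler_wpM2l cc0 (forceF t ax1); have q2 := ler_wpM2l cc0 (forceF t ax2).
have q3 := ler_wpM2l cc0 (forceF t ax3); have q0 := ler_wpM2l B0 kin.
rewrite (_ : B * (3 * (2 * Kk + c ^+ 2 * M)) = 6 * (B * Kk) + 3 * B * c ^+ 2 * M); last by ring.
rewrite -(mulrA 6); move: q0 q1 q2 q3.
set A := \int[@leb6 R]_z (nsq z.2 * f (t, z)).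
set A1 := \int[@leb6 R]_z _; set A2 := \int[@leb6 R]_z _; set A3 := \int[@leb6 R]_z _.
move: (cc * A1) (cc * A2) (cc * A3) (B * A) (B * Kk) (3 * B * c ^+ 2 * M).
by move=> *; lra.
Qed.

Definition test_rate t : R := \int[@leb6 R]_z
  (weak_rhs (DU t) b p db (fun i _ => kronecker j i) z * f (t, z)).

(** Removal of the momentum cutoff, the spatial test function [b] being fixed and compactly
    supported. Dominated convergence is used twice: in phase space with [W], and in time with the
    constant of [W_bound], which rests on the uniform kinetic and force bounds. *)
Lemma spatial_test S T : S < T ->
  lebesgue_measure.-integrable `[S, T] (EFin \o test_rate) /\
  \int[@leb6 R]_z (b z.1 * p z.2 * f (T, z)) - \int[@leb6 R]_z (b z.1 * p z.2 * f (S, z)) =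
  \int[@lebesgue_measure R]_(t in `[S, T]) test_rate t.
Proof.
move=> ST.
pose gn n t := \int[@leb6 R]_z (weak_rhs (DU t) b (pn n) db (dpn n) z * f (t, z)).
have pn' n i x : is_derive x (ax i) (pn n) (dpn n i x).
  have h1 := is_derive_cut n.+1%:R i x; have h2 := is_derive_co j i x.
  rewrite /pn /p; eapply is_derive_eq.
    eapply isdM; last exact: h1.
    by eapply isdB; [exact: h2|exact: isdcst].
  by rewrite /dpn /p subr0.
have gnE n t : gn n t = \int[@leb6 R]_z (b z.1 * pn n z.2 * ft f (t, z)).
  rewrite (weak_form C1f (@fK t) (@cDU t) (transport t) cb (@cpn n) cdb (@cdpn n) b' (pn' n))//.
have cbp n : continuous (fun z : phase R => b z.1 * pn n z.2).
  by have h := @cpn n; cont.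
have bp0 n (z : phase R) : Num.max L n.+1%:R < `|z| -> b z.1 * pn n z.2 = 0.
  rewrite prod_normE/= gt_max; case: (leP `|z.1| `|z.2|) => _ /andP[zL zn].
    by rewrite /pn /cutf (cutw_out' _ zn)// expr0n/= !mulr0.
  by rewrite bL// mul0r.
have TI n := @time_integral R f C1f (fun z => b z.1 * pn n z.2) _ S T ST (cbp n) (bp0 n).
have cst (t : R) (h : R) : (fun _ : nat => h) @ \oo --> h by exact: cvg_cst.
have lim1 t : (fun n => \int[@leb6 R]_z (b z.1 * pn n z.2 * f (t, z))) @ \oo -->
    \int[@leb6 R]_z (b z.1 * p z.2 * f (t, z)).
  apply: (@cvg_at t _ _ (fun z => `|b z.1 * p z.2|)) => //.
  - by cont.
  - move=> z; have := cvg_seqM (cst 0 (b z.1)) (cvg_seqM (cst 0 (p z.2)) (@cvg_cut R z.2)).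
    by rewrite mulr1.
  - move=> n z; rewrite /pn mulrA normrM ler_piMr// ger0_norm ?cut_ge0//; exact: cut_le1.
have lim2 t : (fun n => gn n t) @ \oo --> test_rate t.
  apply: (@cvg_at t _ _ (W t)) => //.
  - move=> n; have h := @cpn n; have h' := @cdpn n; have h'' i := @cDU t i; have cc := @continuous_co R.
    by rewrite /weak_rhs /sum3; cont.
  - move=> z; rewrite /weak_rhs.
    have hp : (fun n => pn n z.2) @ \oo --> p z.2.
      by have := cvg_seqM (cst 0 (p z.2)) (@cvg_cut R z.2); rewrite mulr1.
    have hd i : (fun n => dpn n i z.2) @ \oo --> kronecker j i.
      have := cvg_seqD (cvg_seqM (cst 0 (p z.2)) (cvg_cut1 i z.2)) (cvg_seqM (@cvg_cut R z.2) (cst 0 (kronecker j i))).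
      by rewrite mulr0 add0r mul1r.
    have hs i := cvg_seqM (cst 0 (DU t i z.1)) (hd i).
    exact: (cvg_seqB (cvg_seqM (cst 0 _) hp) (cvg_seqM (cvg_seqD (cvg_seqD (hs ax1) (hs ax2)) (hs ax3)) (cst 0 (b z.1)))).
  - by move=> n z; exact: weak_rhs_bound.
have [] := @Rintegral_dominated R _ _ (@lebesgue_measure R) `[S, T] gn test_rate
   (fun=> B * (3 * (2 * Kk + c ^+ 2 * M)) + B * (7 + 6 * `|c|) * (3 * Fb)).
- exact: measurable_itv.
- move=> n; have [i _] := TI n.
  have := measurable_int _ i; move=> /measurable_EFinP.
  by apply: eq_measurable_fun => t _; rewrite gnE.
- by move=> t _; exact: lim2.
- apply: continuous_compact_integrable; first exact: segment_compact.
  by apply: continuous_subspaceT; exact: cst_continuous.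
- move=> n t _; apply: le_trans (W_bound t); apply: bound_at => //.
    have h := @cpn n; have h' := @cdpn n; have h'' i := @cDU t i; have cc := @continuous_co R.
    by rewrite /weak_rhs /sum3; cont.
  by move=> z; exact: weak_rhs_bound.
move=> ig lim3; split => //.
apply: cvg_unique lim3 => //.
have := cvg_seqB (lim1 T) (lim1 S); apply: cvg_trans.
rewrite (_ : (fun n => \int[@lebesgue_measure R]_(t in `[S, T]) gn n t) = (fun n =>
  \int[@leb6 R]_z (b z.1 * pn n z.2 * f (T, z)) - \int[@leb6 R]_z (b z.1 * pn n z.2 * f (S, z))))//.
apply/funext => n; have [_ ->] := TI n.
by apply: eq_Rintegral => t _; rewrite gnE.
Qed.

End spatial_test.

(** * The virial identity in time *)

Section virial_identity.
Context {R : realType}.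
Variable f : R * phase R -> R.
Hypothesis C1f : C1 f.
Hypothesis f0 : forall z, 0 <= f z.
Variable Kt : R -> R.
Hypothesis fK : forall t z, Kt t < `|z| -> f (t, z) = 0.
Variables (U : R -> vec3 R -> R) (DU : R -> axis -> vec3 R -> R)
  (DDU : R -> axis -> axis -> vec3 R -> R).
Hypothesis U' : forall t i x, is_derive x (ax i) (U t) (DU t i x).
Hypothesis DU' : forall t i j x, is_derive x (ax j) (DU t i) (DDU t i j x).
Hypothesis cDU : forall t i, continuous (DU t i).
Hypothesis cDDU : forall t i j, continuous (DDU t i j).
Hypothesis lapU : forall t x, sum3 (fun i => DDU t i i x) = rho (fun z => f (t, z)) x.
Hypothesis inrm : forall t, leb3.-integrable setT (EFin \o nrm2 (DU t)).
Hypothesis transport : forall t z, ft f (t, z) =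
  - sum3 (fun i => co i z.2 * fx f i (t, z)) + sum3 (fun i => DU t i z.1 * fp f i (t, z)).
Variables M Kk Fb Ab : R.
Hypothesis massM : forall t, massf (fun z => f (t, z)) = M.
Hypothesis kinK : forall t, kinf (fun z => f (t, z)) <= Kk.
Hypothesis forceF : forall t i, \int[@leb6 R]_z (`|DU t i z.1| * f (t, z)) <= Fb.
Hypothesis nrm2A : forall t, \int[@leb3 R]_x nrm2 (DU t) x <= Ab.
Variable V : axis -> R.

Let bx (n : nat) j (x : vec3 R) := cutf n.+1%:R x * co j x.
Let dbx (n : nat) j i (x : vec3 R) := cutf n.+1%:R x * kronecker j i + co j x * cut1 n.+1%:R i x.

Let cbx n j : continuous (bx n j).
Proof. by have h := @continuous_cut R n.+1%:R; have h' := @continuous_co R; rewrite /bx; cont. Qed.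

Let cdbx n j i : continuous (dbx n j i).
Proof.
have h := @continuous_cut R n.+1%:R; have h' := @continuous_co R.
by have h1 := @continuous_cut1 R n.+1%:R; rewrite /dbx; cont.
Qed.

Let bx' n j i x : is_derive x (ax i) (bx n j) (dbx n j i x).
Proof.
have h1 := is_derive_cut n.+1%:R i x; have h2 := is_derive_co j i x.
by rewrite /bx; eapply is_derive_eq; [eapply isdM; [exact: h1|exact: h2]|].
Qed.

Let dbx_bound n j i x : `|dbx n j i x| <= 7.
Proof.
rewrite /dbx (le_trans (ler_normD _ _))//.
have h1 : `|co j x * cut1 n.+1%:R i x| <= 6.
  have := @cut1_moment_bound R n.+1%:R i j 0 x; rewrite subr0 normr0 mulr0 addr0.
  by apply; rewrite ler1n.
have h2 : `|cutf n.+1%:R x * kronecker j i| <= 1.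
  rewrite normrM mulr_ile1// ger0_norm ?cut_ge0 ?cut_le1//.
    by case: (j) (i) => -[].
  by case: (j) (i) => -[].
lra.
Qed.

Let bx_out n j x : n.+1%:R < `|x| -> bx n j x = 0.
Proof. by move=> h; rewrite /bx /cutf cutw_out'// expr0n/= mul0r. Qed.

Let bx_bound n j x : `|bx n j x| <= n.+1%:R.
Proof.
have [h|h] := ltP n.+1%:R `|x|; first by rewrite bx_out// normr0.
rewrite /bx normrM; apply: le_trans h; apply: le_trans (co_normr j x).
by rewrite ler_piMl// ger0_norm ?cut_ge0// cut_le1.
Qed.

Let A n j t := \int[@leb6 R]_z
  (sum3 (fun i => co i z.2 * dbx n j i z.1) * (co j z.2 - V j) * f (t, z)).
Let Vi n j t := \int[@leb6 R]_z (DU t j z.1 * bx n j z.1 * f (t, z)).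

Let test_rateE n j t : test_rate f DU (bx n j) (dbx n j) (V j) j t = A n j t - Vi n j t.
Proof.
have h := @cbx n j; have h1 := @cdbx n j; have hD := @cDU t j; have hc := @continuous_co R.
rewrite /test_rate /A /Vi -RintegralB//; last 2 first.
- apply: (@integrable_at _ _ C1f _ (@fK) t (fun z => sum3 (fun i => co i z.2 * dbx n j i z.1) * (co j z.2 - V j))).
  by rewrite /sum3; cont.
- by apply: (@integrable_at _ _ C1f _ (@fK) t (fun z => DU t j z.1 * bx n j z.1)); cont.
apply: eq_RintegralT => z; rewrite /weak_rhs /sum3.
by clear; case: (j); rewrite /kronecker; ring.
Qed.

(** Summing over the axes restores x . grad U, so the stress tensor identity applies to the sum of
    the force terms. *)
Let virialE n t : sum3 (fun j => Vi n j t) = \int[@leb3 R]_x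
  (cutf n.+1%:R x * sum3 (fun i => co i x * DU t i x) * rho (fun z => f (t, z)) x).
Proof.
have hc := @continuous_cut R n.+1%:R; have hD i := @cDU t i; have h' := @continuous_co R.
have hb j := @cbx n j.
rewrite (@Rintegral_rho _ _ (Kt t))//; last 3 first.
- exact: (@continuous_slice _ t _ (continuous_f C1f)).
- exact: fK.
- by rewrite /sum3; cont.
have i1 j := @integrable_at _ _ C1f _ (@fK) t (fun z => DU t j z.1 * bx n j z.1).
have i2 j : leb6.-integrable setT (EFin \o (fun z => DU t j z.1 * bx n j z.1 * f (t, z))).
  by apply: i1; cont.
rewrite /sum3 /Vi -RintegralD// -RintegralD//.
  by apply: eq_RintegralT => z; rewrite /bx; ring.
by have := integrableD measurableT (i2 ax1) (i2 ax2); apply: eq_integrable.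
Qed.

Let a_bound n j z : `|sum3 (fun i => co i z.2 * dbx n j i z.1) * (co j z.2 - V j)| <=
  21 * (2 * nsq z.2 + V j ^+ 2).
Proof.
rewrite normrM; set v := `|co j z.2 - V j|; have v0 : 0 <= v by rewrite /v.
have term i : `|co i z.2 * dbx n j i z.1| * v <= 7 * (2 * nsq z.2 + V j ^+ 2).
  rewrite normrM mulrAC mulrC; apply: ler_pM => //; first by rewrite mulr_ge0.
  have e1 := real_normK (num_real (co i z.2)).
  have e2 : v ^+ 2 = (co j z.2 - V j) ^+ 2 by rewrite real_normK ?num_real.
  have := co_sqr i z.2; have := co_sqr j z.2.
  have := sqr_ge0 (`|co i z.2| - v); have := sqr_ge0 (co j z.2 + V j).
  move: e1 e2 v0; move: v `|co i z.2| (co i z.2) (co j z.2) (nsq z.2) (V j).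
  by move=> *; nra.
apply: (@le_trans _ _ (sum3 (fun i => `|co i z.2 * dbx n j i z.1|) * v)).
  rewrite ler_wpM2r// ?normr_ge0// /sum3 (le_trans (ler_normD _ _))// lerD2r.
  exact: ler_normD.
have h1 := term ax1; have h2 := term ax2; have h3 := term ax3.
apply: le_trans (_ : _ <= sum3 (fun=> 7 * (2 * nsq z.2 + V j ^+ 2))) _; last first.
  by rewrite /sum3; move: (2 * nsq z.2 + V j ^+ 2) => u; lra.
by rewrite /sum3 2!mulrDl; apply: lerD h3; apply: lerD.
Qed.

Let ca n j : continuous (fun z : phase R => sum3 (fun i => co i z.2 * dbx n j i z.1) * (co j z.2 - V j)).
Proof. by have h1 := @cdbx n j; have hc := @continuous_co R; rewrite /sum3; cont. Qed.

Let cw j : continuous (fun z : phase R => 21 * (2 * nsq z.2 + V j ^+ 2)).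
Proof. by have hc := @continuous_nsq R; cont. Qed.

Let W_int j t : \int[@leb6 R]_z (21 * (2 * nsq z.2 + V j ^+ 2) * f (t, z)) <=
  42 * Kk + 21 * V j ^+ 2 * M.
Proof.
have cn := @continuous_nsq R.
have i0 : leb6.-integrable setT (EFin \o (fun z => nsq z.2 * f (t, z))).
  by apply: (@integrable_at _ _ C1f _ (@fK) t (fun z => nsq z.2)); cont.
have i1 : leb6.-integrable setT (EFin \o (fun z => f (t, z))).
  apply: (@integrable6 _ _ (Kt t)); last by move=> z /fK.
  exact: (@continuous_slice _ t _ (continuous_f C1f)).
have Z (h : phase R -> R) (a : R) : leb6.-integrable setT (EFin \o h) ->
    leb6.-integrable setT (EFin \o (fun z => a * h z)).
  by move=> /(integrableZl measurableT a); apply: eq_integrable.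
have j0 := Z _ 42 i0; have j1 := Z _ (21 * V j ^+ 2) i1.
rewrite (_ : Rintegral _ _ _ = \int[@leb6 R]_z
   (42 * (nsq z.2 * f (t, z)) + 21 * V j ^+ 2 * f (t, z))); last first.
  by apply: eq_RintegralT => z; ring.
rewrite (RintegralD measurableT j0 j1).
rewrite (RintegralZl _ measurableT i0) (RintegralZl _ measurableT i1).
have ms : \int[@leb6 R]_z f (t, z) = M := massM t.
by rewrite ms lerD2r ler_wpM2l//; exact: kinK.
Qed.

Let A_bound n j t : `|A n j t| <= 42 * Kk + 21 * V j ^+ 2 * M.
Proof.
apply: le_trans (W_int j t).
by apply: (@bound_at _ _ C1f f0 _ (@fK) t _ _ (@ca n j) (@cw j)) => z; exact: a_bound.
Qed.

Let A_lim j t : (fun n => A n j t) @ \oo -->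
  \int[@leb6 R]_z (co j z.2 * (co j z.2 - V j) * f (t, z)).
Proof.
apply: (@cvg_at _ _ C1f f0 _ (@fK) t _ _ _ (fun n => @ca n j) (@cw j)) => [z|n z]; last exact: a_bound.
have cst (h : R) : (fun _ : nat => h) @ \oo --> h by exact: cvg_cst.
have hd i : (fun n => dbx n j i z.1) @ \oo --> kronecker j i.
  have := cvg_seqD (cvg_seqM (@cvg_cut R z.1) (cst (kronecker j i))) (cvg_seqM (cst (co j z.1)) (cvg_cut1 i z.1)).
  by rewrite mulr0 addr0 mul1r.
have hs i := cvg_seqM (cst (co i z.2)) (hd i).
have := cvg_seqM (cvg_seqD (cvg_seqD (hs ax1) (hs ax2)) (hs ax3)) (cst (co j z.2 - V j)).
have -> : co ax1 z.2 * kronecker j ax1 + co ax2 z.2 * kronecker j ax2 + co ax3 z.2 * kronecker j ax3 = co j z.2.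
  by clear; case: (j); rewrite /kronecker; ring.
exact.
Qed.

Definition virial_rate t : R :=
  sum3 (fun j => \int[@leb6 R]_z (co j z.2 * (co j z.2 - V j) * f (t, z))) -
  2^-1 * \int[@leb3 R]_x nrm2 (DU t) x.

Definition virial_moment t : R :=
  sum3 (fun j => \int[@leb6 R]_z (co j z.1 * (co j z.2 - V j) * f (t, z))).

Let moment_lim j t : (fun n => \int[@leb6 R]_z (bx n j z.1 * (co j z.2 - V j) * f (t, z))) @ \oo -->
  \int[@leb6 R]_z (co j z.1 * (co j z.2 - V j) * f (t, z)).
Proof.
have hb n := @cbx n j; have hc := @continuous_co R.
apply: (@cvg_at _ _ C1f f0 _ (@fK) t (fun n z => bx n j z.1 * (co j z.2 - V j)) _
  (fun z => `|co j z.1 * (co j z.2 - V j)|)).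
- by move=> n; have h := hb n; cont.
- by cont.
- move=> z; have cst (h : R) : (fun _ : nat => h) @ \oo --> h by exact: cvg_cst.
  have := cvg_seqM (cvg_seqM (@cvg_cut R z.1) (cst (co j z.1))) (cst (co j z.2 - V j)).
  by rewrite mul1r.
- move=> n z; rewrite /bx -mulrA normrM ler_piMl// ger0_norm ?cut_ge0//; exact: cut_le1.
Qed.

(** Removal of the spatial cutoff. The kinetic part converges by domination in phase space, the
    force part by [virial_limit]; both are bounded uniformly in time, which allows the limit under
    the time integral. *)
Lemma virial_identity S T : S < T ->
  lebesgue_measure.-integrable `[S, T] (EFin \o virial_rate) /\
  virial_moment T - virial_moment S =
  \int[@lebesgue_measure R]_(t in `[S, T]) virial_rate t.
Proof.
move=> ST.
pose rate n t := sum3 (fun j => test_rate f DU (bx n j) (dbx n j) (V j) j t).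
have TI n j : lebesgue_measure.-integrable `[S, T]
      (EFin \o test_rate f DU (bx n j) (dbx n j) (V j) j) /\
    \int[@leb6 R]_z (bx n j z.1 * (co j z.2 - V j) * f (T, z)) -
    \int[@leb6 R]_z (bx n j z.1 * (co j z.2 - V j) * f (S, z)) =
    \int[@lebesgue_measure R]_(t in `[S, T]) test_rate f DU (bx n j) (dbx n j) (V j) j t.
  (* The bound n + 1 + 7 on the test function and its gradient may grow with [n], because [n] is
     fixed here; uniformity in [n] is obtained afterwards from [A_bound] and [virial_bound]. *)
  apply: (@spatial_test _ _ C1f f0 _ (@fK) DU cDU transport M Kk Fb massM kinK forceF
    (bx n j) (dbx n j) n.+1%:R (n.+1%:R + 7) (V j) j) => //.
  - exact: bx_out.
  - by move=> x; rewrite (le_trans (bx_bound n j x))// lerDl.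
  - by move=> i x; rewrite (le_trans (dbx_bound n j i x))// lerDr.
have irate n : lebesgue_measure.-integrable `[S, T] (EFin \o rate n) /\
    \int[@lebesgue_measure R]_(t in `[S, T]) rate n t = sum3 (fun j =>
    \int[@lebesgue_measure R]_(t in `[S, T]) test_rate f DU (bx n j) (dbx n j) (V j) j t).
  have [i1 _] := TI n ax1; have [i2 _] := TI n ax2; have [i3 _] := TI n ax3.
  have mI : measurable (`[S, T] : set (measurableTypeR R)) by exact: measurable_itv.
  have i12 : lebesgue_measure.-integrable `[S, T] (EFin \o (fun t =>
      test_rate f DU (bx n ax1) (dbx n ax1) (V ax1) ax1 t +
      test_rate f DU (bx n ax2) (dbx n ax2) (V ax2) ax2 t)).
    by have := integrableD mI i1 i2; apply: eq_integrable.
  split; first by have := integrableD mI i12 i3; apply: eq_integrable.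
  by rewrite /rate /sum3 (RintegralD mI i12 i3) (RintegralD mI i1 i2).
have rateE n t : rate n t = sum3 (fun j => A n j t) - sum3 (fun j => Vi n j t).
  by rewrite /rate /sum3 !test_rateE; ring.
pose C := sum3 (fun j => 42 * Kk + 21 * V j ^+ 2 * M) + 12 * Ab.
have [] := @Rintegral_dominated R _ _ (@lebesgue_measure R) `[S, T] rate virial_rate (fun=> C).
- exact: measurable_itv.
- by move=> n; have [i _] := irate n; have := measurable_int _ i; move=> /measurable_EFinP.
- move=> t _.
  have := cvg_seqB (cvg_seqD (cvg_seqD (@A_lim ax1 t) (@A_lim ax2 t)) (@A_lim ax3 t))
    (virial_limit (@U' t) (@DU' t) (@cDU t) (@cDDU t) (lapU t) (inrm t)).
  apply: cvg_trans; rewrite (_ : rate ^~ t = (fun n => A n ax1 t + A n ax2 t + A n ax3 t -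
    \int[@leb3 R]_x (cutf n.+1%:R x * sum3 (fun i => co i x * DU t i x) *
      rho (fun z => f (t, z)) x)))//.
  by apply/funext => n; rewrite rateE virialE.
- apply: continuous_compact_integrable; first exact: segment_compact.
  by apply: continuous_subspaceT; exact: cst_continuous.
- move=> n t _; rewrite rateE virialE (le_trans (ler_normB _ _))// lerD//.
    rewrite /sum3 (le_trans (ler_normD _ _))// lerD// (le_trans (ler_normD _ _))// lerD//.
  apply: le_trans (virial_bound (@U' t) (@DU' t) (@cDU t) (@cDDU t) (lapU t) (inrm t) _) _ => //.
  by rewrite ler_wpM2l.
move=> ig lim3; split => //.
apply: cvg_unique lim3 => //.
have ml j := cvg_seqB (@moment_lim j T) (@moment_lim j S).
have := cvg_seqD (cvg_seqD (ml ax1) (ml ax2)) (ml ax3).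
set l := (X in _ --> X); have -> : l = virial_moment T - virial_moment S.
  by rewrite /l /virial_moment /sum3; ring.
apply: cvg_trans; apply: near_eq_cvg; apply: nearW => n /=.
by have [_ ->] := irate n; rewrite /sum3 -!(TI n _).2.
Qed.

End virial_identity.

Section fixed_time_moments.
Context {R : realType}.
Variables (f : phase R -> R) (K : R).
Hypothesis cf : continuous f.
Hypothesis f0 : forall z, 0 <= f z.
Hypothesis fK : forall z, K < `|z| -> f z = 0.

Definition ev (h : phase R -> R) : R := \int[@leb6 R]_z (h z * f z).

Lemma evD h k : continuous h -> continuous k -> ev (fun z => h z + k z) = ev h + ev k.
Proof.
move=> ch ck; have ih := fmoment cf fK ch; have ik := fmoment cf fK ck.
rewrite /ev -(RintegralD measurableT ih ik).
by apply: eq_RintegralT => z; rewrite mulrDl.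
Qed.

Lemma evZ (a : R) h : continuous h -> ev (fun z => a * h z) = a * ev h.
Proof.
move=> ch; have ih := fmoment cf fK ch.
rewrite /ev -(RintegralZl _ measurableT ih).
by apply: eq_RintegralT => z; rewrite mulrA.
Qed.

Lemma ev_le h k : continuous h -> continuous k -> (forall z, h z <= k z) -> ev h <= ev k.
Proof.
move=> ch ck hk; apply: le_Rintegral => //.
- exact: (fmoment cf fK ch).
- exact: (fmoment cf fK ck).
- by move=> z _; rewrite ler_wpM2r.
Qed.

Lemma ev_mass : ev (fun=> 1) = massf f.
Proof. by apply: eq_RintegralT => z; rewrite mul1r. Qed.

Lemma ev_square (g : phase R -> R) (a : R) : continuous g ->
  ev (fun z => (g z - a) ^+ 2) = ev (fun z => g z ^+ 2) - 2 * a * ev g + a ^+ 2 * massf f.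
Proof.
move=> cg; have c1 : continuous (fun _ : phase R => 1 : R) by exact: contcst.
have cg2 : continuous (fun z => g z ^+ 2) by cont.
have c2 : continuous (fun z => - (2 * a) * g z) by cont.
have c3 : continuous (fun _ : phase R => a ^+ 2 * 1) by cont.
have c4 : continuous (fun z => g z ^+ 2 + - (2 * a) * g z) by cont.
rewrite (_ : (fun z => _) = (fun z => g z ^+ 2 + - (2 * a) * g z + a ^+ 2 * 1)).
  by rewrite evD// evD// !evZ// ev_mass mulNr.
by apply/funext => z; ring.
Qed.

Lemma ev_sum3 (h : axis -> phase R -> R) : (forall i, continuous (h i)) ->
  ev (fun z => sum3 (fun i => h i z)) = sum3 (fun i => ev (h i)).
Proof.
move=> ch; have c1 := ch ax1; have c2 := ch ax2; have c3 := ch ax3.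
have c12 : continuous (fun z => h ax1 z + h ax2 z) by cont.
by rewrite /sum3 evD// evD.
Qed.

(** The fluctuation p - V has mean zero, so the position may be recentred at the centre of mass [X]
    without changing the integral. This is why the bound involves the variance of the position and
    not its second moment. *)
Lemma moment_bound (V : axis -> R) : 0 < massf f ->
  (forall j, ev (fun z => co j z.2) = massf f * V j) ->
  `|sum3 (fun j => ev (fun z => co j z.1 * (co j z.2 - V j)))| <=
  2^-1 * (mom2 f - (massf f)^-1 * sum3 (fun i => mom1 f i ^+ 2)) +
  2^-1 * (kinf f - massf f * sum3 (fun i => V i ^+ 2)).
Proof.
move=> M0 pV; have hc := @continuous_co R.
pose X j := mom1 f j / massf f.
have cx j : continuous (fun z : phase R => co j z.1) by cont.
have cp j : continuous (fun z : phase R => co j z.2) by cont.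
have cpV j : continuous (fun z : phase R => co j z.2 - V j) by cont.
have cxp j : continuous (fun z : phase R => co j z.1 * (co j z.2 - V j)) by cont.
have cx2 j : continuous (fun z : phase R => 2^-1 * (co j z.1 - X j) ^+ 2) by cont.
have cp2 j : continuous (fun z : phase R => 2^-1 * (co j z.2 - V j) ^+ 2) by cont.
have cX2 j : continuous (fun z : phase R => (co j z.1 - X j) ^+ 2) by cont.
have cP2 j : continuous (fun z : phase R => (co j z.2 - V j) ^+ 2) by cont.
have cq j : continuous (fun z : phase R => co j z.2 ^+ 2) by cont.
have cr j : continuous (fun z : phase R => co j z.1 ^+ 2) by cont.
have c0 a : continuous (fun _ : phase R => a * 1 : R) by cont.
have c1 : continuous (fun _ : phase R => 1 : R) by exact: contcst.
have cl j (s : R) : continuous (fun z : phase R => s * (co j z.1 * (co j z.2 - V j))) by cont.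
have cm j (s : R) : continuous (fun z : phase R => s * (co j z.2 - V j)) by cont.
have pV0 j : ev (fun z => co j z.2 - V j) = 0.
  rewrite (_ : (fun z => _) = (fun z : phase R => co j z.2 + - V j * 1)).
    by rewrite evD// evZ// ev_mass pV; ring.
  by apply/funext => z; rewrite mulr1.
pose D j := 2^-1 * ev (fun z => (co j z.1 - X j) ^+ 2) + 2^-1 * ev (fun z => (co j z.2 - V j) ^+ 2).
have hdf j (s : R) : `|s| = 1 -> s * ev (fun z => co j z.1 * (co j z.2 - V j)) <= D j.
  move=> s1; have s2 : s ^+ 2 = 1 by rewrite -real_normK ?num_real// s1 expr1n.
  have E : s * ev (fun z => co j z.1 * (co j z.2 - V j)) =
      ev (fun z => s * (co j z.1 * (co j z.2 - V j)) + - (s * X j) * (co j z.2 - V j)).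
    by rewrite evD// !evZ// pV0 mulr0 addr0.
  rewrite E /D -!evZ// -evD//; apply: ev_le.
  - by cont.
  - by cont.
  - (* AM-GM, with the sign s = +-1 *)
    move=> z; move: (co j z.1) (co j z.2) (X j) (V j) => a b c d.
    have := sqr_ge0 (s * (a - c) - (b - d)); rewrite sqrrB exprMn s2 mul1r; lra.
have nD j : `|ev (fun z => co j z.1 * (co j z.2 - V j))| <= D j.
  rewrite ler_norml; apply/andP; split.
    by have := hdf j (-1); rewrite normrN1 mulN1r lerNl; apply.
  by have := hdf j 1; rewrite normr1 mul1r; apply.
have DE j : D j = 2^-1 * (ev (fun z => co j z.1 ^+ 2) - (massf f)^-1 * mom1 f j ^+ 2) +
    2^-1 * (ev (fun z => co j z.2 ^+ 2) - massf f * V j ^+ 2).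
  rewrite /D !ev_square// pV -/(mom1 f j) /X.
  rewrite (_ : ev (fun z => co j z.1) = mom1 f j)//.
  by field; rewrite gt_eqF.
have M2 : mom2 f = sum3 (fun j => ev (fun z => co j z.1 ^+ 2)) by rewrite -ev_sum3.
have K2 : kinf f = sum3 (fun j => ev (fun z => co j z.2 ^+ 2)) by rewrite -ev_sum3.
rewrite M2 K2; apply: (@le_trans _ _ (sum3 D)).
  by rewrite /sum3 (le_trans (ler_normD _ _))// lerD// (le_trans (ler_normD _ _))// lerD.
by rewrite /sum3 !DE le_eqVlt; apply/orP; left; apply/eqP; ring.
Qed.

End fixed_time_moments.

(** * Growth of the virial moment *)

Section growth.
Context {R : realType}.
Variable f : R * phase R -> R.
Hypothesis C1f : C1 f.
Hypothesis f0 : forall z, 0 <= f z.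
Variable Kt : R -> R.
Hypothesis fK : forall t z, Kt t < `|z| -> f (t, z) = 0.
Variable F : R.
Hypothesis F0 : 0 <= F.
Hypothesis fF : forall t, {ae leb6, forall z, f (t, z) <= F}.
Variables (U : R -> vec3 R -> R) (DU : R -> axis -> vec3 R -> R)
  (DDU : R -> axis -> axis -> vec3 R -> R).
Hypothesis U' : forall t i x, is_derive x (ax i) (U t) (DU t i x).
Hypothesis DU' : forall t i j x, is_derive x (ax j) (DU t i) (DDU t i j x).
Hypothesis cU : forall t, continuous (U t).
Hypothesis cDU : forall t i, continuous (DU t i).
Hypothesis cDDU : forall t i j, continuous (DDU t i j).
Hypothesis lapU : forall t x, sum3 (fun i => DDU t i i x) = rho (fun z => f (t, z)) x.
Hypothesis UE : forall t x,
  U t x = - (4 * pi)^-1 * \int[@leb3 R]_y (rho (fun z => f (t, z)) y / enorm (x - y)).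
Hypothesis transport : forall t z, ft f (t, z) =
  - sum3 (fun i => co i z.2 * fx f i (t, z)) + sum3 (fun i => DU t i z.1 * fp f i (t, z)).
Variables (M : R) (V : axis -> R).
Hypothesis M0 : 0 < M.
Hypothesis massM : forall t, massf (fun z => f (t, z)) = M.
Hypothesis momV : forall t j, \int[@leb6 R]_z (co j z.2 * f (t, z)) = M * V j.
Hypothesis energyE : forall t, kinf (fun z => f (t, z)) - \int[@leb3 R]_x nrm2 (DU t) x =
  M * sum3 (fun i => V i ^+ 2).

Let g t (z : phase R) := f (t, z).
Let cg t : continuous (g t). Proof. exact: (@continuous_slice _ t _ (continuous_f C1f)). Qed.
Let A2 t := \int[@leb3 R]_x nrm2 (DU t) x.
Let C := Cint F M.
Let C0 : 0 <= C.
Proof. exact: (Cint_ge0 F0 (ltW M0)). Qed.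
(** Equal to |Q|^2 / M, that is 2 E. *)
Let P := M * sum3 (fun i => V i ^+ 2).
(* With this weight [energy_upper] charges at most half of the kinetic energy,
   which is then absorbed. *)
Let e := (4 * (C + 1))^-1.
Let e0 : 0 < e. Proof. by rewrite invr_gt0 mulr_gt0// ltr_wpDl. Qed.
(** The solution, slightly rounded up, of k <= P + 1/2 (M + k) + M^2 / (4e), where k is twice the
    kinetic energy. *)
Let Kk := 2 * (P + M + M ^+ 2 / (4 * e)).

Let kinK t : kinf (g t) <= Kk.
Proof.
have up := energy_upper (@cg t) (fun z => f0 (t, z)) (@fK t) F0 (@fF t) (massM t) erefl
  (@U' t) (@DU' t) (@cU t) (@cDU t) (@cDDU t) (lapU t) (UE t) e0.
have kin0 : 0 <= kinf (g t).
  by apply: Rintegral_ge0 => z _; rewrite mulr_ge0 ?nsq_ge0//; exact: f0.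
have eC : e * (2 * C) <= 2^-1.
  by rewrite /e mulrC ler_pdivrMr ?mulr_gt0// ?ltr_wpDl//; lra.
have := energyE t; rewrite -/(g t) -/P.
move: up; rewrite -/(g t) -/C /Kk.
move: (\int[@leb3 R]_x nrm2 (DU t) x) (kinf (g t)) kin0 => a k k0 up E.
have : e * (2 * C * (M + k)) <= 2^-1 * (M + k).
  by rewrite mulrA ler_wpM2r// addr_ge0// ltW.
move: up E; move: (e * _) (M ^+ 2 / _) P M0 => u v p m0; lra.
Qed.

Let P0 : 0 <= P.
Proof. by rewrite mulr_ge0 ?(ltW M0)// /sum3 !addr_ge0// sqr_ge0. Qed.

Let A2E t : A2 t = kinf (g t) - P.
Proof. by have := energyE t; rewrite -/(A2 t) -/(g t) -/P => <-; ring. Qed.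

Let forceF t i : \int[@leb6 R]_z (`|DU t i z.1| * f (t, z)) <= 4 * C * (M + Kk).
Proof.
have h := force_bound (@cg t) (fun z => f0 (t, z)) (@fK t) F0 (@fF t) (massM t) erefl
  (@U' t) (@cU t) (@cDDU t) (lapU t) (UE t) i.
have ca : continuous (fun x : vec3 R => `|DU t i x|) by have hD := @cDU t i; cont.
have E := Rintegral_rho (@cg t) (@fK t) ca; rewrite /g in E; rewrite -E.
rewrite -lee_fin -integrable_fin//; last first.
  apply: (@integrable3 _ _ (Kt t)).
    have cr : continuous (rho (g t)).
      rewrite (_ : rho (g t) = fun x => sum3 (fun i => DDU t i i x)).
        by have hd i := @cDDU t i i; rewrite /sum3; cont.
      by apply/funext => x; rewrite lapU.
    by rewrite /g in cr; cont.
  by move=> x /(rho_out (@fK t)) ->; rewrite mulr0.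
apply: le_trans h _; rewrite lee_fin.
have hk : M + kinf (g t) <= M + Kk by rewrite lerD2l; exact: kinK.
have C40 : 0 <= 4 * C by apply: mulr_ge0 C0; exact: ler0n.
exact: (ler_wpM2l C40 hk).
Qed.

Let nrm2i t : leb3.-integrable setT (EFin \o nrm2 (DU t)).
Proof.
exact: (field_energy (@cg t) (fun z => f0 (t, z)) (@fK t) F0 (@fF t) (massM t)
  (@U' t) (@DU' t) (@cU t) (@cDU t) (@cDDU t) (lapU t) (UE t)).1.
Qed.

(** The field energy enters twice: with coefficient 1 through the energy relation, which equates it
    with the kinetic term centred at [V], and with coefficient - 1/2 through the virial of the
    force. *)
Let rateE t : virial_rate f DU V t = 2^-1 * A2 t.
Proof.
have hc := @continuous_co R.
have q j : \int[@leb6 R]_z (co j z.2 * (co j z.2 - V j) * f (t, z)) =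
    ev (g t) (fun z => co j z.2 ^+ 2) - V j * (M * V j).
  have h1 : continuous (fun z : phase R => co j z.2) by cont.
  have h2 : continuous (fun z : phase R => co j z.2 ^+ 2) by cont.
  have h3 : continuous (fun z : phase R => - V j * co j z.2) by cont.
  rewrite -(momV t j) -mulNr -[X in _ * X]/(ev (g t) (fun z => co j z.2)).
  rewrite -(evZ (@cg t) (@fK t))// -(evD (@cg t) (@fK t))//.
  by apply: eq_RintegralT => z; congr (_ * _); ring.
rewrite /virial_rate -/(A2 t) /sum3 !q.
have -> : A2 t = sum3 (fun j => ev (g t) (fun z => co j z.2 ^+ 2)) - P.
  rewrite A2E -(ev_sum3 (@cg t) (@fK t))// => i.
  by have h := hc i; cont.
rewrite /P /sum3; move: (ev _ _) (ev _ _) (ev _ _) => a b c.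
by field.
Qed.

Lemma dispersion_unbounded (B : R) : 0 <= B -> exists2 t, 0 < t &
  B < (M * mom2 (g t) - sum3 (fun i => mom1 (g t) i ^+ 2)) / M ^+ 2.
Proof.
move=> B0; apply: contrapT => nB.
have D t : 0 < t -> M * mom2 (g t) - sum3 (fun i => mom1 (g t) i ^+ 2) <= B * M ^+ 2.
  move=> t0; rewrite -ler_pdivrMr ?exprn_gt0// leNgt; apply/negP => h.
  by apply: nB; exists t.
(* This choice ensures B <= L^2, so the dispersion term B M^2 / L^3 of [energy_lower] is at most M^2
   / L. *)
pose L := B + 1; have L0 : 0 < L by rewrite ltr_wpDl.
have p4 : 0 < 4 * pi :> R by rewrite mulr_gt0// pi_gt0.
(* From 3 M^2 / (2L) the dispersion term takes at most M^2 / L and leaves M^2 / (2L). The divisions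
   by 4 pi and by 2 come from [energy_lower] and from the factor 1/2 in the rate. *)
pose c := M ^+ 2 / (2 * L) / (4 * pi) / 2.
have c0 : 0 < c by rewrite !divr_gt0// ?exprn_gt0// mulr_gt0.
have lo t : 0 < t -> c <= 2^-1 * A2 t.
  move=> t0; have := energy_lower (@cg t) (fun z => f0 (t, z)) (@fK t) F0 (@fF t) (massM t)
    (@U' t) (@DU' t) (@cU t) (@cDU t) (@cDDU t) (lapU t) (UE t) L0.
  rewrite -/(A2 t) -/(g t) => h.
  rewrite /c [leLHS]mulrC ler_wpM2l// ler_pdivrMr// [leRHS]mulrC; apply: le_trans h.
  have := D _ t0; move: (M * _ - _) => d dB.
  have : d / L ^+ 3 <= M ^+ 2 / L.
    rewrite ler_pdivrMr ?exprn_gt0//; apply: (le_trans dB).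
    rewrite (_ : M ^+ 2 / L * L ^+ 3 = L ^+ 2 * M ^+ 2); last by field; rewrite gt_eqF.
    by rewrite ler_wpM2r ?sqr_ge0// /L; nra.
  rewrite (_ : 3 * M ^+ 2 / (2 * L) = M ^+ 2 / (2 * L) + M ^+ 2 / L); last by field; rewrite gt_eqF.
  lra.
pose G := 2^-1 * (B * M) + 2^-1 * (Kk - P).
have Gb t : 0 < t -> `|virial_moment f V t| <= G.
  move=> t0; have := @moment_bound _ (g t) (Kt t) (@cg t) (fun z => f0 (t, z)) (@fK t) V.
  rewrite massM => /(_ M0 (momV t)) h; apply: le_trans h _; apply: lerD.
    rewrite ler_wpM2l//.
    rewrite -(ler_pM2l M0) mulrBr mulVKf ?gt_eqF//.
    by apply: le_trans (D _ t0) _; rewrite le_eqVlt; apply/orP; left; apply/eqP; ring.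
  by rewrite ler_wpM2l// lerB// kinK.
(* The growth over [[1, T]] is at least c (T - 1) = c + 2 G, more than the 2 G allowed by the bound.
   The interval starts at 1 because the assumed bound on the dispersion concerns positive times. *)
pose T := 2 + 2 * G / c.
have G0 : 0 <= G by apply: le_trans (Gb 1 _).
have T1 : 1 < T by rewrite /T; apply: (@lt_le_trans _ _ 2); [rewrite ltr1n|rewrite lerDl; apply: divr_ge0; [exact: mulr_ge0|exact: ltW]].
have A2K t : A2 t <= Kk by rewrite A2E; have := kinK t; move: P0; lra.
have [iV E] := virial_identity C1f f0 (@fK) (@U') (@DU') (@cDU) (@cDDU) lapU nrm2i
  transport massM kinK forceF A2K V T1.
have : c * (T - 1) <= \int[@lebesgue_measure R]_(t in `[1, T]) virial_rate f DU V t.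
  rewrite (_ : c * (T - 1) = \int[@lebesgue_measure R]_(t in `[1, T]) c); last first.
    rewrite Rintegral_cst//.
    have := lebesgue_measure_itv `[1, T]; rewrite /= lte_fin T1 => E1.
    by congr (_ * _); rewrite [RHS](congr1 fine E1).
  apply: le_Rintegral => //.
  - apply: continuous_compact_integrable; first exact: segment_compact.
    by apply: continuous_subspaceT; exact: cst_continuous.
  - move=> t /=; rewrite in_itv/= => /andP[t1 _]; rewrite rateE lo//.
    exact: lt_le_trans t1.
rewrite -E leNgt => /negP; apply.
have T0 : 0 < T by exact: lt_trans T1.
have h1 : `|virial_moment f V 1| <= G by exact: Gb.
have := Gb _ T0; move: h1; rewrite !ler_norml => /andP[h1 _] /andP[_ h2].
rewrite (_ : c * (T - 1) = c + 2 * G); first by move: h1 h2 c0; lra.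
by rewrite /T; field; rewrite gt_eqF.
Qed.

End growth.

(** * Regular solutions: positive mass, uniform bound and conclusion *)

Section solutions.
Context {R : realType}.

Lemma leb6_box (z : phase R) (r : R) : 0 <= r ->
  leb6 (box z.1 r `*` box z.2 r) = ((8 * r ^+ 3) * (8 * r ^+ 3))%:E.
Proof.
move=> r0; rewrite EFinM -{1}(leb3_box z.1 r0) -(leb3_box z.2 r0).
by apply: product_measure1E; exact: measurable_box.
Qed.

(** By continuity g exceeds half of a positive value on a ball; a closed box of half the radius lies
    inside it and has positive measure. *)
Lemma mass_gt0 (g : phase R -> R) (K : R) : continuous g -> (forall z, 0 <= g z) ->
  (forall z, K < `|z| -> g z = 0) -> (exists z, g z != 0) -> 0 < massf g.
Proof.
move=> cg g0 gK [z gz].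
have gz0 : 0 < g z by rewrite lt_neqAle eq_sym gz g0.
have : \forall y \near z, g z / 2 < g y.
  have /cvgrPdist_lt /(_ (g z / 2)) := cg z; rewrite divr_gt0// => /(_ isT).
  by apply: filterS => y; rewrite ltr_distl => /andP[_ h]; lra.
move=> /nbhs_ballP[e /= e0 ze].
pose r := e / 2; have r0 : 0 < r by rewrite divr_gt0.
pose B : set (mphase R) := box z.1 r `*` box z.2 r.
have mB : measurable B by apply: measurableX; exact: measurable_box.
rewrite -lte_fin (massfE cg gK).
apply: (@lt_le_trans _ _ ((g z / 2)%:E * leb6 B)%E).
  by rewrite leb6_box ?ltW// -EFinM lte_fin !mulr_gt0// exprn_gt0.
rewrite -(setIT B) -integral_indic// -ge0_integralZl//; last 2 first.
- by apply/measurable_EFinP; exact: measurable_indic.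
- by rewrite lee_fin divr_ge0// ltW.
apply: ge0_le_integral => //.
- by move=> y _; rewrite -EFinM lee_fin mulr_ge0// divr_ge0// ltW.
- by apply: emeasurable_funM => //; apply/measurable_EFinP; exact: measurable_indic.
- by apply/measurable_EFinP; exact: (measurable_f cg).
move=> y _; rewrite -EFinM lee_fin indicE.
have [/set_mem[y1 y2]|_] := boolP (y \in B); last by rewrite mulr0.
rewrite mulr1 ltW//; apply: ze.
rewrite -ball_normE /ball_ /=; apply: (@le_lt_trans _ _ r).
  by rewrite prod_normE/= ge_max y1 y2.
by rewrite /r ltr_pdivrMr// ltr_pMr// ltr1n.
Qed.

(** At time 0 continuity and compact support give a pointwise bound. Conservation of the essential
    supremum carries it to every other time, as a bound almost everywhere. *)
Lemma ae_bound (f : R -> vec3 R -> vec3 R -> R) (K : R) :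
  continuous (fun z : phase R => f 0 z.1 z.2) ->
  (forall z : phase R, K < `|z| -> f 0 z.1 z.2 = 0) ->
  (forall t, Lq_norm f +oo%E t = Lq_norm f +oo%E 0) ->
  exists2 F, 0 <= F & forall t, {ae leb6, forall z, f t z.1 z.2 <= F}.
Proof.
move=> cf fK fL; have [B B0 fB] := lebesgue_like_bounded lebesgue_like_leb6 cf fK.
exists B => // t.
(* The norm of exponent [+oo] is the essential supremum under the condition that the whole space has
   positive measure. *)
have T0 : (0 < leb6 [set: mphase R])%E.
  apply: (@lt_le_trans _ _ (leb6 (box (0 : vec3 R) 1 `*` box (0 : vec3 R) 1))).
    by rewrite (leb6_box (0, 0)) ?ler01// lte_fin !mulr_gt0// exprn_gt0.
  apply: le_measure; rewrite ?inE//.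
  by apply: measurableX; exact: measurable_box.
have L s : Lq_norm f +oo%E s = ess_sup (@leb6 R) (abse \o (fun z => (f s z.1 z.2)%:E)).
  by rewrite /Lq_norm unlock T0.
have : (ess_sup (@leb6 R) (abse \o (fun z => (f t z.1 z.2)%:E)) <= B%:E)%E.
  rewrite -L fL L; apply/ess_supP; apply: aeW => z /=.
  by rewrite lee_fin; exact: fB.
move=> /ess_supP; apply: filterS => z /=; rewrite lee_fin.
exact: le_trans (ler_norm _).
Qed.

Lemma dotE (u v : vec3 R) : dot u v = sum3 (fun i => co i u * co i v).
Proof. by []. Qed.

End solutions.

Theorem proposition4 (R : realType) (f : R -> vec3 R -> vec3 R -> R)
  (M E : R) (Q : vec3 R)
  (f_regular : regular_solution f)
  (f_mass : forall t : R, mass f t = M)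
  (f_momentum : forall t : R, momentum f t = Q)
  (f_energy : forall t : R, energy f t = E)
  (f_norms : forall q : \bar R, (1 <= q)%E ->
     forall s t : R, Lq_norm f q s = Lq_norm f q t)
  (energy_eq : E = enorm Q ^+ 2 / (2 * M)) :
  statistically_dispersive f.
Proof.
have [[t0 [x0 [p0 nz]]] f0 C1F fc [vl po]] := f_regular.
pose F (z : R * phase R) := f z.1 z.2.1 z.2.2.
have F0 z : 0 <= F z by exact: f0.
(* A radius is chosen for each time separately, with no regularity in [t]. Boundedness of a compact
   set provides every bound strictly above some [K], hence the witness [K + 1]. *)
have /choice[Kt FK] : forall t, exists K, forall z : phase R, K < `|z| -> F (t, z) = 0.
  move=> t; have /compact_bounded[K [_ Kb]] := fc t.
  exists (K + 1) => z Kz; apply: contrapT => /eqP fz.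
  have := Kb (K + 1); rewrite ltrDl => /(_ ltr01) /(_ z) /=.
  move=> h; have /h : closure [set z : phase R | f t z.1 z.2 != 0] z by exact: subset_closure.
  by rewrite leNgt Kz.
have cF t : continuous (fun z => F (t, z)) by exact: (@continuous_slice _ t _ (continuous_f C1F)).
have [B B0 FB] := ae_bound (cF 0) (FK 0) (fun t => f_norms _ (leey _) t 0).
pose U t := potential f t; pose DU t i : vec3 R -> R := 'D_(ax i) (U t).
pose DDU t i j : vec3 R -> R := 'D_(ax j) (DU t i).
have C1D t : C1 (U t) by have [[]] := po t.
have C1DD t i : C1 (DU t i) by have [[_ h] _ _] := po t; exact: h.
have U' t i x : is_derive x (ax i) (U t) (DU t i x).
  by apply: derivableP; apply: diff_derivable; exact: (C1D t).1.
have DU' t i j x : is_derive x (ax j) (DU t i) (DDU t i j x).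
  by apply: derivableP; apply: diff_derivable; exact: (C1DD t i).1.
have cU t : continuous (U t).
  by move=> z; apply: differentiable_continuous; exact: (C1D t).1.
have cDU t i : continuous (DU t i) by exact: (C1D t).2.
have cDDU t i j : continuous (DDU t i j) by exact: (C1DD t i).2.
have lapU t x : sum3 (fun i => DDU t i i x) = rho (fun z => F (t, z)) x.
  by have [_ h _] := po t; exact: h.
have UE t x : U t x = - (4 * pi)^-1 *
    \int[@leb3 R]_y (rho (fun z => F (t, z)) y / enorm (x - y)) by [].
have transport t z : ft F (t, z) =
    - sum3 (fun i => co i z.2 * fx F i (t, z)) + sum3 (fun i => DU t i z.1 * fp F i (t, z)).
  case: z => x p /=; have := vl t x p; rewrite derive1E !dotE.
  have -> : 'D_1 (fun s => f s x p) t = ft F (t, (x, p)) by case: (is_derive_ft C1F t (x, p)).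
  have hx i : co i (grad (fun y => f t y p) x) = fx F i (t, (x, p)).
    by case: (is_derive_fx C1F i t x p) => _ <-; case: (i).
  have hp i : co i (grad (f t x) p) = fp F i (t, (x, p)).
    by case: (is_derive_fp C1F i t x p) => _ <-; case: (i).
  have hU i : co i (grad (potential f t) x) = DU t i x by case: (i).
  rewrite /sum3 !hx !hp !hU.
  move: (ft _ _) (fx _ _ _) (fx _ _ _) (fx _ _ _) (fp _ _ _) (fp _ _ _) (fp _ _ _).
  move: (DU t ax1 x) (DU t ax2 x) (DU t ax3 x) (co ax1 p) (co ax2 p) (co ax3 p).
  clear; move=> u1 u2 u3 q1 q2 q3 a b1 b2 b3 d1 d2 d3 h.
  by apply/eqP; rewrite -subr_eq0; apply/eqP; apply: (etrans _ h); ring.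
have massM t : massf (fun z => F (t, z)) = M by rewrite -(f_mass t).
have M0 : 0 < M.
  rewrite -(massM t0); apply: (mass_gt0 (cF t0) _ (FK t0)) => //.
  by exists (x0, p0).
pose V i := co i Q / M.
have M00 : M != 0 by rewrite gt_eqF.
have MV j : M * V j = co j Q by rewrite /V mulrCA mulfV// mulr1.
have momV t j : \int[@leb6 R]_z (co j z.2 * F (t, z)) = M * V j.
  rewrite MV -(f_momentum t); case: j; apply: eq_RintegralT => z; exact: mulrC.
(* The energy relation doubled: |Q|^2 / M becomes M |V|^2 because Q = M V. *)
have energyE t : kinf (fun z => F (t, z)) - \int[@leb3 R]_x nrm2 (DU t) x =
    M * sum3 (fun i => V i ^+ 2).
  have := f_energy t; rewrite energy_eq enorm_sqr /energy.
  have -> : \int[@leb6 R]_z (enorm z.2 ^+ 2 * f t z.1 z.2) = kinf (fun z => F (t, z)).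
    by apply: eq_RintegralT => z; rewrite enorm_sqr.
  have -> : \int[@leb3 R]_x (enorm (grad (potential f t) x) ^+ 2) = \int[@leb3 R]_x nrm2 (DU t) x.
    by apply: eq_RintegralT => x; rewrite enorm_sqr.
  move: (kinf _) (Rintegral _ _ _) => k a h.
  have -> : k - a = 2 * (nsq Q / (2 * M)) by rewrite -h; field.
  by rewrite /nsq /sum3 /V; field.
have dispE t : dispersion f t = (M * mom2 (fun z => F (t, z)) -
    sum3 (fun i => mom1 (fun z => F (t, z)) i ^+ 2)) / M ^+ 2.
  have hc := @continuous_co R.
  rewrite /dispersion f_mass enorm_sqr.
  have -> : \int[@leb3 R]_x (enorm x ^+ 2 * density f t x) = mom2 (fun z => F (t, z)).
    rewrite -[RHS](Rintegral_rho (cF t) (FK t) (@continuous_nsq R)).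
    by apply: eq_RintegralT => x; rewrite enorm_sqr.
  have m1 i : co i (vintegral3 (fun x => density f t x *: x)) = mom1 (fun z => F (t, z)) i.
    rewrite -[RHS](Rintegral_rho (cF t) (FK t) (hc i)).
    by case: (i); apply: eq_RintegralT => x; exact: mulrC.
  rewrite /nsq /sum3 !m1; move: (mom2 _) (mom1 _ _) (mom1 _ _) (mom1 _ _) => a b c d.
  by field.
have H b : 0 <= b -> exists2 t, 0 < t & b < dispersion f t.
  move=> b0; have [t tt h] := dispersion_unbounded C1F F0 FK B0 FB U' DU' cU cDU cDDU lapU UE
    transport M0 massM momV energyE b0.
  by exists t => //; rewrite dispE.
rewrite /statistically_dispersive; set S := [set _ | _ in _].
have ub t : 0 < t -> ((dispersion f t)%:E <= ereal_sup S)%E.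
  by move=> tt; apply: ereal_sup_ubound; exists t.
(* A finite supremum [r] is exceeded by the dispersion at some positive time, with [Num.max 0 r]
   supplying the nonnegative level that [H] requires; [-oo] is excluded by the value at time 1. *)
move: ub; case: (ereal_sup S) => [r||] // ub.
  have [t tt] := H (Num.max 0 r) (ltac:(by rewrite le_max lexx)).
  rewrite gt_max => /andP[_ h]; have := ub t tt.
  by rewrite lee_fin leNgt h.
by have := ub 1 ltr01.
Qed.
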